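(* Let $1\le p<\infty$, $a\in L^1(\Omega)$, $c_1,c_2\ge 0$, and let $\omega=(\omega_s)_{s\ge0}$ be a family of locally integrable moduli of continuity. For any sequence $(F_h)_h\subseteq\mathcal{W}_{m,p}(a,c_1,c_2,\omega)$ there exist a subsequence $(F_{h_k})_k$ and a functional $F\in\mathcal{W}_{m,p}(a,c_1,c_2,\omega)$ such that $$F(\cdot,A)=\Gamma(W_X^{1,p})\text{-}\lim_{k\to+\infty}F_{h_k}(\cdot,A)\qquad\text{for any }A\in\mathcal{A}.$$
   Context: Setting. $m,n\in\mathbb{N}\setminus\{0\}$ with $m\le n$; $\Omega\subseteq\mathbb{R}^n$ is open and bounded; $\mathcal{A}$ is the family of all open subsets of $\Omega$; $\mathcal{A}_0$ is the family of those $A\in\mathcal{A}$ with $\overline{A}\subseteq\Omega$. $X=(X_1,\dots,X_m)$ is a family of vector fields $X_j=\sum_{i=1}^n c_{j,i}(x)\partial_i$ with each $c_{j,i}$ Lipschitz on $\Omega$, and $C(x)=[c_{j,i}(x)]$ is the corresponding $m\times n$ matrix. $X$ satisfies the linear independence condition (LIC): the set of $x\in\Omega$ such that $X_1(x),\dots,X_m(x)$ (seen as vectors of $\mathbb{R}^n$) are linearly dependent has Lebesgue measure zero. $X$-gradient and $X$-Sobolev space. For $u\in L^1_{loc}(\Omega)$ the distributional $X$-gradient $Xu$ is defined by $\langle Xu,\varphi\rangle=-\int_\Omega u\,\mathrm{div}(\varphi(x)\cdot C(x))\,dx$ for all $\varphi\in C_c^\infty(\Omega,\mathbb{R}^m)$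 ($\varphi$ a row vector). $W_X^{1,p}(\Omega)=\{u\in L^p(\Omega): Xu\in L^p(\Omega,\mathbb{R}^m)\}$ with norm $\|u\|_{W_X^{1,p}(\Omega)}=\|u\|_{L^p(\Omega)}+\|Xu\|_{L^p(\Omega,\mathbb{R}^m)}$. Moduli of continuity. $\omega=(\omega_s)_{s\ge0}$ is a family of locally integrable moduli of continuity if $\omega_s:\Omega\times[0,+\infty)\to[0,+\infty)$ and: $r\mapsto\omega_s(x,r)$ is increasing, continuous and $\omega_s(x,0)=0$ for a.e. $x\in\Omega$ and any $s\ge0$; $s\mapsto\omega_s(x,r)$ is increasing and continuous for a.e. $x\in\Omega$ and any $r\ge0$; $x\mapsto\omega_s(x,r)\in L^1_{loc}(\Omega)$ for any $r,s\ge0$. Strong condition. $F:W_X^{1,p}(\Omega)\times\mathcal{A}\to[0,\infty]$ satisfies the strong condition $(\omega X)$ with respect to $\omega$ if $|F(v,A')-F(u,A')|\le\int_{A'}\omega_s(x,r)\,dx$ for any $s\ge0$, $r\ge0$, $A'\in\mathcal{A}_0$ and $u,v\in W_X^{1,p}(\Omega)$ such that $|u(x)|,|v(x)|,|Xu(x)|,|Xv(x)|\le s$ and $|u(x)-v(x)|,|Xu(x)-Xv(x)|\le r$ for a.e. $x\in A'$. Classes of functionals. $F:W_X^{1,p}(\Omega)\times\mathcal{A}\to[0,\infty]$ belongs to $\mathcal{U}_{m,p}(a,c_1,c_2)$ if there exists a Carathéodory function $f:\Omega\times\mathbb{R}\times\mathbb{R}^m\to[0,\infty]$ (measurable in $x$,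 continuous in $(u,\eta)$ for a.e. $x$) such that $f(x,u,\eta)\le a(x)+c_1|\eta|^p+c_2|u|^p$ for any $(u,\eta)\in\mathbb{R}\times\mathbb{R}^m$ and for a.e. $x\in\Omega$, and $F(u,A)=\int_A f(x,u(x),Xu(x))\,dx$ for any $A\in\mathcal{A}$ and $u\in W_X^{1,p}(\Omega)$. $F$ belongs to $\mathcal{W}_{m,p}(a,c_1,c_2,\omega)$ if $F\in\mathcal{U}_{m,p}(a,c_1,c_2)$ and $F$ satisfies the strong condition $(\omega X)$ with respect to $\omega$. $\Gamma$-convergence. For functionals $G_h$ on $W_X^{1,p}(\Omega)$, $\Gamma(W_X^{1,p})\text{-}\liminf_h G_h(u)=\inf\{\liminf_h G_h(u_h): u_h\to u \text{ strongly in } W_X^{1,p}(\Omega)\}$ and $\Gamma(W_X^{1,p})\text{-}\limsup_h G_h(u)=\inf\{\limsup_h G_h(u_h): u_h\to u\text{ strongly in }W_X^{1,p}(\Omega)\}$; $G=\Gamma(W_X^{1,p})\text{-}\lim_h G_h$ means both coincide with $G(u)$ for every $u\in W_X^{1,p}(\Omega)$. *)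

(* Defs.v *)
From HB Require Import structures.
From mathcomp Require Import all_boot all_order all_algebra.
From mathcomp Require Import all_classical all_reals all_analysis.
From mathcomp Require Import measurable_realfun.

Set Implicit Arguments.
Unset Strict Implicit.
Unset Printing Implicit Defensive.

Import Order.TTheory GRing.Theory Num.Theory.
Import numFieldNormedType.Exports.

Local Open Scope classical_set_scope.
Local Open Scope ring_scope.

(** * Lebesgue measure on 'rV[R]_n

  The library provides Lebesgue measure on the line and binary products.  The
  n-fold product is built on Borel sets of n-tuples, then transported to
  'rV[R]_n and completed by the Caratheodory construction, so that
  "measurable" for subsets of 'rV[R]_n means Lebesgue measurable. *)
Section tuple_lebesgue.
Context {R : realType}.

Local Notation T := (measurableTypeR R).

Definition cons_pair n (z : T * n.-tuple T) : n.+1.-tuple T :=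
  [tuple of z.1 :: z.2].

Definition uncons n (t : n.+1.-tuple T) : T * n.-tuple T :=
  (thead t, [tuple of behead t]).

Lemma measurable_cons_pair n : measurable_fun [set: _] (@cons_pair n).
Proof.
by apply: measurable_cons; [exact: measurable_fst|exact: measurable_snd].
Qed.

Lemma measurable_uncons n : measurable_fun [set: _] (@uncons n).
Proof.
apply/measurable_fun_pairP; split.
  exact: measurable_tnth.
exact: measurable_behead.
Qed.

Lemma cons_pairK n : cancel (@cons_pair n) (@uncons n).
Proof. by case=> x t; congr pair; apply: val_inj. Qed.

Section cons_measure.
Variables (n : nat) (mu : {sigma_finite_measure set (n.-tuple T) -> \bar R}).

Definition cons_measure : set (n.+1.-tuple T) -> \bar R :=
  pushforward ((@lebesgue_measure R) \x mu)%E (@cons_pair n).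

Let cons_measure0 : cons_measure set0 = 0%E.
Proof. by rewrite /cons_measure /pushforward preimage_set0 measure0. Qed.

Let cons_measure_ge0 A : (0 <= cons_measure A)%E.
Proof. by rewrite /cons_measure /pushforward; exact: measure_ge0. Qed.

Let cons_measure_sigma_additive : semi_sigma_additive cons_measure.
Proof.
pose m := measure_function_pushforward__canonical__measure_function_Measure
  ((@lebesgue_measure R) \x mu)%E (@measurable_cons_pair n).
exact: (@measure_semi_sigma_additive _ _ _ m).
Qed.

HB.instance Definition _ := isMeasure.Build _ _ _ cons_measure
  cons_measure0 cons_measure_ge0 cons_measure_sigma_additive.

Let cons_measure_sigma_finite : sigma_finite [set: _] cons_measure.
Proof.
have [F [TF ndF Foo]] := (sigma_finiteP _ _).1
  (sigma_finiteT (@lebesgue_measure R)).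
have [G [TG ndG Goo]] := (sigma_finiteP _ _).1 (sigma_finiteT mu).
exists (fun i => @uncons n @^-1` (F i `*` G i)).
  rewrite -preimage_bigcup (_ : \bigcup_i _ = setT) ?preimage_setT//.
  apply/seteqP; split => // -[x y] _.
  have [i _ Fix] : (\bigcup_i F i) x by rewrite -TF.
  have [k _ Gky] : (\bigcup_i G i) y by rewrite -TG.
  exists (maxn i k) => //; split => /=.
    by move: x Fix; exact/subsetPset/ndF/leq_maxl.
  by move: y Gky; exact/subsetPset/ndG/leq_maxr.
move=> k; have [mF F_oo] := Foo k; have [mG G_oo] := Goo k; split.
  by rewrite -[X in measurable X]setTI; apply: measurable_uncons => //;
    exact: measurableX.
rewrite /cons_measure /pushforward -comp_preimage (_ : _ \o _ = id); last first.
  by apply/funext => z /=; rewrite cons_pairK.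
by rewrite preimage_id product_measure1E// lte_mul_pinfty// ge0_fin_numE.
Qed.

HB.instance Definition _ := Measure_isSigmaFinite.Build _ _ _ cons_measure
  cons_measure_sigma_finite.

End cons_measure.

Fixpoint tuple_lebesgue (n : nat) :
    {sigma_finite_measure set (n.-tuple T) -> \bar R} :=
  match n with
  | 0 => \d_([tuple] : 0.-tuple T)
  | n'.+1 => cons_measure (tuple_lebesgue n')
  end.

End tuple_lebesgue.

Section lebesgue_rV.
Context {R : realType} {n : nat}.

Definition row_of_tuple (t : n.-tuple R) : 'rV[R]_n := \row_i tnth t i.

Definition lebesgue_outer (A : set 'rV[R]_n) : \bar R :=
  (mu_ext (@tuple_lebesgue R n)) (row_of_tuple @^-1` A).

Let outer0 : lebesgue_outer set0 = 0%E.
Proof. by rewrite /lebesgue_outer preimage_set0 outer_measure0. Qed.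

Let outer_ge0 A : (0 <= lebesgue_outer A)%E.
Proof. exact: outer_measure_ge0. Qed.

Let le_outer : {homo lebesgue_outer : A B / A `<=` B >-> (A <= B)%E}.
Proof. by move=> A B AB; apply: le_outer_measure; exact: preimage_subset. Qed.

Let outer_sigma_subadditive : sigma_subadditive lebesgue_outer.
Proof.
move=> F; rewrite /lebesgue_outer preimage_bigcup.
exact: outer_measure_sigma_subadditive.
Qed.

HB.instance Definition _ := isOuterMeasure.Build R 'rV[R]_n lebesgue_outer
  outer0 outer_ge0 le_outer outer_sigma_subadditive.

HB.instance Definition _ :=
  Measurable.copy 'rV[R]_n (caratheodory_type lebesgue_outer).

Definition leb : set 'rV[R]_n -> \bar R := lebesgue_outer.

HB.instance Definition _ := isMeasure.Build _ 'rV[R]_n R leb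
  (@caratheodory_measure0 R 'rV[R]_n lebesgue_outer)
  (@caratheodory_measure_ge0 R 'rV[R]_n lebesgue_outer)
  (@caratheodory_measure_sigma_additive R 'rV[R]_n lebesgue_outer).

End lebesgue_rV.

(** The norm `|v| of 'rV[R]_m is the sup norm; the growth bound and the
  L^p norm of gradients need the Euclidean one. *)
Definition eucl_norm {R : realType} {m : nat} (v : 'rV[R]_m) : R :=
  Num.sqrt (\sum_(j < m) v 0 j ^+ 2).

(** All iterated partial derivatives of order at most k exist and are
  continuous. *)
Fixpoint Ck {R : realType} {n m : nat} (k : nat)
    (f : 'rV[R]_n -> 'rV[R]_m) : Prop :=
  continuous f /\
  if k is k'.+1 then
    forall i : 'I_n, (forall x, derivable f x (delta_mx 0 i)) /\
                     Ck k' ('D_(delta_mx 0 i) f)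
  else True.

Definition smooth {R : realType} {n m : nat} (f : 'rV[R]_n -> 'rV[R]_m) :=
  forall k, Ck k f.

Definition divergence {R : realType} {n : nat} (v : 'rV[R]_n -> 'rV[R]_n)
    (x : 'rV[R]_n) : R :=
  \sum_(i < n) 'D_(delta_mx 0 i) (fun y => v y 0 i) x.

Section X_Sobolev.
Context {R : realType} {m n : nat}.
Variables (Omega : set 'rV[R]_n).

Definition test_fun (phi : 'rV[R]_n -> 'rV[R]_m) :=
  smooth phi /\
  exists K, [/\ compact K, K `<=` Omega & forall x, ~ K x -> phi x = 0].

Definition L1loc (u : 'rV[R]_n -> R) :=
  forall K, compact K -> K `<=` Omega -> leb.-integrable K (EFin \o u).

Definition Lp (p : R) (u : 'rV[R]_n -> R) : Prop :=
  u \_ Omega \in Lfun leb p%:E.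

Definition Lp_norm (p : R) (u : 'rV[R]_n -> R) : \bar R :=
  'N[leb]_p%:E [EFin \o u \_ Omega]%E.

(** The j-th row of C x is the vector X_j(x). *)
Variable C : 'rV[R]_n -> 'M[R]_(m, n).

Definition LIC := leb [set x | Omega x /\ ~~ row_free (C x)] = 0%E.

(** The coefficients C are only Lipschitz, hence phi *m C is differentiable
  almost everywhere (Rademacher); the value of 'D_v at the other points does
  not affect the integral. *)
Definition is_Xgrad (u : 'rV[R]_n -> R) (g : 'rV[R]_n -> 'rV[R]_m) :=
  (forall j, L1loc (fun x => g x 0 j)) /\
  forall phi, test_fun phi ->
    \int[leb]_(x in Omega) (\sum_(j < m) g x 0 j * phi x 0 j) =
    - \int[leb]_(x in Omega) (u x * divergence (fun y => phi y *m C y) x).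

(** A representative of the X-gradient (determined up to a null set); it is
  meaningful when the distributional X-gradient is a locally integrable
  function, and 0 otherwise. *)
Definition Xgrad (u : 'rV[R]_n -> R) : 'rV[R]_n -> 'rV[R]_m :=
  xget (fun=> 0) [set g | is_Xgrad u g].

Variable p : R.

Definition WX : set ('rV[R]_n -> R) :=
  [set u | Lp p u /\
     exists2 g, is_Xgrad u g & forall j, Lp p (fun x => g x 0 j)].

Definition WX_norm (u : 'rV[R]_n -> R) : \bar R :=
  (Lp_norm p u + Lp_norm p (eucl_norm \o Xgrad u))%E.

Definition WX_cvg (u_ : nat -> 'rV[R]_n -> R) (u : 'rV[R]_n -> R) :=
  WX_norm (u_ h \- u) @[h --> \oo] --> 0%E.

Definition Gamma_liminf (G : nat -> ('rV[R]_n -> R) -> \bar R)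
    (u : 'rV[R]_n -> R) : \bar R :=
  ereal_inf [set limn_einf (fun h => G h (u_ h)) |
             u_ in [set u_ | (forall h, WX (u_ h)) /\ WX_cvg u_ u]].

Definition Gamma_limsup (G : nat -> ('rV[R]_n -> R) -> \bar R)
    (u : 'rV[R]_n -> R) : \bar R :=
  ereal_inf [set limn_esup (fun h => G h (u_ h)) |
             u_ in [set u_ | (forall h, WX (u_ h)) /\ WX_cvg u_ u]].

Definition is_Gamma_lim (G : nat -> ('rV[R]_n -> R) -> \bar R)
    (G0 : ('rV[R]_n -> R) -> \bar R) :=
  forall u, WX u -> Gamma_liminf G u = G0 u /\ Gamma_limsup G u = G0 u.

(** [omega s x r] stands for omega_s(x, r); only x in Omega and s, r >= 0
  matter. *)
Definition integrable_moduli (omega : R -> 'rV[R]_n -> R -> R) :=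
  [/\ forall s x r, Omega x -> 0 <= s -> 0 <= r -> 0 <= omega s x r,
      {ae leb, forall x, Omega x -> forall s, 0 <= s ->
        [/\ {in `[0, +oo[ &, {homo omega s x : r1 r2 / r1 <= r2}},
            {within `[0, +oo[, continuous (omega s x)} &
            omega s x 0 = 0]},
      {ae leb, forall x, Omega x -> forall r, 0 <= r ->
        {in `[0, +oo[ &, {homo omega^~ x ^~ r : s1 s2 / s1 <= s2}} /\
        {within `[0, +oo[, continuous (omega^~ x ^~ r)}} &
      forall r s, 0 <= r -> 0 <= s -> L1loc (fun x => omega s x r)].

(** Functionals are defined on functions and sets; only their values at u in
  WX and at open subsets of Omega matter. *)
Implicit Type F : ('rV[R]_n -> R) -> set 'rV[R]_n -> \bar R.

Definition strong_condition (omega : R -> 'rV[R]_n -> R -> R) F :=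
  forall (s r : R) (A : set 'rV[R]_n) (u v : 'rV[R]_n -> R),
    0 <= s -> 0 <= r -> open A -> closure A `<=` Omega -> WX u -> WX v ->
    {ae leb, forall x, A x ->
      [/\ `|u x| <= s, `|v x| <= s,
          eucl_norm (Xgrad u x) <= s & eucl_norm (Xgrad v x) <= s]} ->
    {ae leb, forall x, A x ->
      `|u x - v x| <= r /\ eucl_norm (Xgrad u x - Xgrad v x) <= r} ->
    (`| F v A - F u A | <= \int[leb]_(x in A) (omega s x r)%:E)%E.

Definition caratheodory_fun (f : 'rV[R]_n -> R -> 'rV[R]_m -> \bar R) :=
  (forall u eta, measurable_fun Omega (fun x => f x u eta)) /\
  {ae leb, forall x, Omega x ->
    continuous (fun z : R * 'rV[R]_m => f x z.1 z.2)}.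

Definition class_U (a : 'rV[R]_n -> R) (c1 c2 : R) F :=
  exists f : 'rV[R]_n -> R -> 'rV[R]_m -> \bar R,
    [/\ forall x u eta, Omega x -> (0 <= f x u eta)%E,
        caratheodory_fun f,
        {ae leb, forall x, Omega x -> forall u eta,
          (f x u eta <=
            (a x + c1 * eucl_norm eta `^ p + c2 * `|u| `^ p)%:E)%E} &
        forall (A : set 'rV[R]_n) u, open A -> A `<=` Omega -> WX u ->
          F u A = (\int[leb]_(x in A) f x (u x) (Xgrad u x))%E].

Definition class_W (a : 'rV[R]_n -> R) (c1 c2 : R)
    (omega : R -> 'rV[R]_n -> R -> R) F :=
  class_U a c1 c2 F /\ strong_condition omega F.

End X_Sobolev.

(* Main.v *)
Require Import Defs.
From HB Require Import structures.
From mathcomp Require Import all_boot all_order all_algebra.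
From mathcomp Require Import all_classical all_reals all_analysis.
From mathcomp Require Import measurable_realfun.
From mathcomp Require Import ring lra.

Import Order.TTheory GRing.Theory Num.Theory.
Import numFieldNormedType.Exports.

Local Open Scope classical_set_scope.
Local Open Scope ring_scope.

Set Implicit Arguments.
Unset Strict Implicit.
Unset Printing Implicit Defensive.

(** Why the theorem holds.  The convergence that defines the Gamma-limit is the
  strong one of the Sobolev space, and the functionals of the sequence are
  equicontinuous for it.  So nothing is relaxed: the Gamma-limit is a pointwise
  limit, and the work consists in extracting a subsequence that converges
  pointwise and in showing that the limit is again an integral functional of
  the same class.

  The equicontinuity has to be found on the integrands.  An affine function
  u(x) = c + xi . x belongs to the Sobolev space and its X-gradient is C(x) xi
  ([is_Xgrad_affine]).  Applied to two affine functions on small open sets, the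
  strong condition bounds integrals of f(x,v,Xv) - f(x,u,Xu) by integrals of
  omega_s(x,r), and inequalities between integrals over all open subsets are
  inequalities almost everywhere ([ae_ge0_open]).  Where the X_j are linearly
  independent, the values (u(x), Xu(x)) of affine functions exhaust
  R x R^m.  Hence f(x,.) is uniformly continuous on bounded sets for almost
  every x, with a modulus given by omega alone ([pointwise_modulus],
  [integrand_of_functional]).

  Compactness is then an argument of Ascoli type in the second variable and of
  Dunford-Pettis type in the first one.  For a fixed z in a countable grid of
  R x R^m the functions f_h(.,z) are dominated by an integrable function.  A
  diagonal subsequence makes their integrals converge over every rational box,
  hence over every measurable set, and by the theorem of Radon and Nikodym the
  limits are the integrals of a density g_z ([weak_compactness]).  The bounds
  and the modulus of continuity are inequalities between integrals, so they
  survive for the g_z almost everywhere, and z |-> g_z extends from the grid to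
  a limit integrand ([integrand_compactness]).  For a function u of the Sobolev
  space, (u,Xu) is approximated by maps with values in the grid; the error in
  the integrals is controlled by the common modulus, whence the convergence of
  the functionals at u ([superposition_cvg]), and the same modulus controls the
  effect of replacing u by a sequence that converges to it
  ([superposition_continuous]).

  Behind the statement on affine functions there is an integration by parts
  against fields phi C that are only Lipschitz.  They have directional
  derivatives almost everywhere, of integral zero: by Tonelli's theorem this is
  a statement on lines, where a Lipschitz function is a primitive of a density
  ([lipschitz_derive_cancel], [derive_line_integral]).  The X-gradient is a
  chosen representative, so its uniqueness up to null sets is needed too; it
  comes from testing against smooth functions that increase to the indicators
  of boxes ([is_Xgrad_uniq]). *)

(** * Almost everywhere statements *)

Section ae_tools.
Context d (T : measurableType d) (R : realType) (mu : {measure set T -> \bar R}).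

Lemma ae_imp (P Q : T -> Prop) : (forall x, P x -> Q x) ->
  {ae mu, forall x, P x} -> {ae mu, forall x, Q x}.
Proof.
by move=> PQ [N [mN N0 subN]]; exists N; split => //;
  apply: subset_trans subN => x /=; exact: contra_not (PQ x).
Qed.

Lemma ae_and (P Q : T -> Prop) : {ae mu, forall x, P x} ->
  {ae mu, forall x, Q x} -> {ae mu, forall x, P x /\ Q x}.
Proof. by move=> aeP aeQ; move: aeP aeQ; apply: filterS2 => x. Qed.

Lemma ae_forall_countable (I : countType) (P : I -> T -> Prop) :
  (forall i, {ae mu, forall x, P i x}) -> {ae mu, forall x, forall i, P i x}.
Proof.
move=> aeP.
have : forall k, {ae mu, forall x, if unpickle k is Some i then P i x else True}.
  move=> k; case: (unpickle k : option I) => [i|]; first exact: aeP.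
  by exists set0; split => // x /=; apply.
move=> /ae_foralln; apply: ae_imp => x H i; have := H (pickle i).
by rewrite pickleK.
Qed.

Lemma ae_eq_integrable (D : set T) (f g : T -> \bar R) : measurable D ->
  measurable_fun D g -> ae_eq mu D f g -> mu.-integrable D f ->
  mu.-integrable D g.
Proof.
move=> mD mg fg /integrableP[mf fi]; apply/integrableP; split => //.
suff -> : (\int[mu]_(x in D) `|g x| = \int[mu]_(x in D) `|f x|)%E by exact: fi.
apply/esym; apply: ae_eq_integral => //; [exact: measurableT_comp..|].
exact: ae_eq_abse.
Qed.

End ae_tools.

(** * Lipschitz functions on the line *)

Section lipschitz_line.
Context {R : realType}.
Notation mu := (@lebesgue_measure R).

Section lipschitz_density.
Variables (g : R -> R) (L : R).
Hypothesis L0 : 0 < L.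
Hypothesis gL : forall x y, `|g x - g y| <= L * `|x - y|.

Let G (s : R) (x : R) := 2^-1 * x + s * ((2 * L)^-1 * g x).

Let G_homo s : `|s| = 1 -> {homo G s : x y / x <= y}.
Proof.
move=> s1 x y xy; rewrite -subr_ge0 /G.
have gxy : `|g y - g x| <= L * (y - x).
  by have := gL y x; rewrite (ger0_norm (_ : 0 <= y - x)) ?subr_ge0.
have : `|s * ((2 * L)^-1 * (g y - g x))| <= 2^-1 * (y - x).
  rewrite normrM s1 mul1r normrM ger0_norm ?invr_ge0 ?mulr_ge0 ?(ltW L0)//.
  rewrite ler_pdivrMl ?mulr_gt0//; apply: (le_trans gxy).
  by rewrite le_eqVlt; apply/orP; left; apply/eqP; field.
rewrite ler_norml => /andP[+ _].
by rewrite !mulrBr; lra.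
Qed.

Let g_continuous : continuous g.
Proof.
move=> x; apply/cvgrPdist_le => /= e e0.
near=> t; rewrite (le_trans (gL _ _))// -ler_pdivlMl//.
near: t; apply: cvgr_dist_le; last by rewrite mulr_gt0// invr_gt0.
exact: cvg_id.
Unshelve. all: by end_near. Qed.

Let G_continuous s : continuous (G s).
Proof.
move=> x; rewrite /G; apply: cvgD; first by apply: cvgMr; exact: cvg_id.
by do 2 apply: cvgMr; exact: g_continuous.
Qed.

(** If g is L-Lipschitz, both x/2 + g/(2L) and x/2 - g/(2L) are
  nondecreasing, and their Stieltjes measures add up to Lebesgue measure.  So
  each of them is absolutely continuous, and a Radon-Nikodym density of the
  first one yields a density f of g. *)
Lemma lipschitz_density (b : R) : 0 < b ->
  exists f : R -> R, [/\ mu.-integrable `]-b, b] (EFin \o f),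
    {ae mu, forall x, x \in `]-b, b[ ->
       derivable g x 1 /\ derive1 g x = f x} &
    \int[mu]_(x in `]-b, b]) f x = g b - g (- b)].
Proof.
move=> b0.
pose mixin1 := isCumulative.Build R _ R (G 1) (G_homo (normr1 _))
  (right_continuousW (@G_continuous 1)).
pose mixin2 := isCumulative.Build R _ R (G (-1)) (G_homo (normrN1 _))
  (right_continuousW (@G_continuous (-1))).
pose G1 : cumulative R R := HB.pack (G 1) mixin1.
pose G2 : cumulative R R := HB.pack (G (-1)) mixin2.
have LSE (H : cumulative R R) x y : x <= y ->
    lebesgue_stieltjes_measure H `]x, y]%classic = (H y - H x)%:E.
  move=> xy; rewrite /lebesgue_stieltjes_measure /measure_extension/=.
  rewrite measurable_mu_extE/=; last exact: is_ocitv.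
  by rewrite wlength_itv_bnd.
have G1E X : ocitv X -> mu X =
    (lebesgue_stieltjes_measure G1 X + lebesgue_stieltjes_measure G2 X)%E.
  move=> [[x y] _ <-] /=.
  have [xy|yx] := leP x y; last first.
    by rewrite set_itv_ge ?bnd_simp -?leNgt ?(ltW yx)// !measure0 adde0.
  rewrite !LSE// lebesgue_measure_itv/= lte_fin.
  case: ltgtP xy => // [xy _|-> _]; last by rewrite !subrr adde0.
  by rewrite -EFinB -EFinD; congr EFin; rewrite /G /=; lra.
pose la : {measure set (measurableTypeR R) -> \bar R} :=
  measure_add (lebesgue_stieltjes_measure G1) (lebesgue_stieltjes_measure G2).
have muE A : measurable A -> mu A =
    (lebesgue_stieltjes_measure G1 A + lebesgue_stieltjes_measure G2 A)%E.
  move=> mA; rewrite -measure_addE.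
  apply: (@lebesgue_measure_unique _ la) => // X /G1E ->.
  exact/esym/measure_addE.
pose D : set (measurableTypeR R) := `]-b, b]%classic.
have mD : measurable D.
  exact: measurable_itv.
have nuD : (lebesgue_stieltjes_measure G1 D < +oo)%E.
  by rewrite /D LSE ?ltry// ge0_cp// ltW.
pose nu : {finite_measure set (measurableTypeR R) -> \bar R} := mfrestr mD nuD.
have numu : nu `<< mu.
  apply/null_content_dominatesP => A mA /= muA0; apply/eqP; rewrite -measure_le0.
  apply: (@le_trans _ _ (lebesgue_stieltjes_measure G1 A)).
    by apply: le_measure; rewrite ?inE//; exact: measurableI.
  by rewrite -muA0 muE// leeDl.
have [f [f0 ffin fint fE]] := radon_nikodym_sigma_finite numu.
pose F x := \int[mu]_(t in `]-b, x]) fine (f t).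
have int_fine : mu.-integrable [set: R] (EFin \o (fine \o f)).
  by apply: eq_integrable fint => // x _ /=; rewrite fineK.
have FE x : -b <= x <= b -> F x = G 1 x - G 1 (-b).
  move=> /andP[bx xb]; rewrite /F /Rintegral.
  under eq_integral do rewrite fineK//.
  rewrite -fE//= /mfrestr /mrestr.
  rewrite setIidl ?LSE//; last first.
    move=> t /=; rewrite /D/= !in_itv/= => /andP[-> tx].
    exact: le_trans tx xb.
pose h (x : R) : R := fine (f x) - 2^-1.
have int_f2 : mu.-integrable D (EFin \o h).
  have -> : EFin \o h =
    (EFin \o (fine \o f) \- (EFin \o cst 2^-1%R))%E by apply/funext.
  apply: integrableB => //; first exact: integrableS int_fine.
  apply/integrableP; split; first exact/measurable_EFinP/measurable_cst.
  by rewrite /= integral_cst//= lebesgue_measure_itv/=; case: ifP;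
     rewrite ?mule0 ?ltry.
exists (fun x => 2 * L * h x); split.
- have -> : EFin \o (fun x => 2 * L * h x) =
    (fun x => (2 * L)%:E * (EFin \o h) x)%E by apply/funext.
  exact: integrableZl.
- have : {ae mu, forall x, (BRight (- b) < BRight x)%O ->
     derivable F x 1 /\ derive1 F x = fine (f x)}.
    have := @FTC1 R (fine \o f) (BRight (- b)); apply.
      by move=> y; exact: integrableS int_fine.
    by apply: open_integrable_locally => //; exact: openT.
  apply: filterS; first exact: (ae_filter_ringOfSetsType mu).
  move=> x Fx xb.
  have bx : -b < x by move: xb; rewrite in_itv/= => /andP[].
  have [dF F'] := Fx bx.
  have gF : {near x, g =1 (fun t => 2 * L * (F t - 2^-1 * t) + (2 * L * G 1 (- b)))}.
    near=> t.
    rewrite FE; last first.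
      near: t.
      have := near_in_itvoo xb.
      by apply: filterS => t; rewrite in_itv/= => /andP[/ltW -> /ltW ->].
    by rewrite /G; field; rewrite gt_eqF.
  have dF' : is_derive x 1 F (fine (f x)).
    by apply: DeriveDef; [exact: dF|rewrite -derive1E; exact: F'].
  have dg : is_derive x 1 g (2 * L * (fine (f x) - 2^-1)).
    apply: (@near_eq_is_derive _ _ _
      (fun t => 2 * L * (F t - 2^-1 * t) + (2 * L * G 1 (- b)))).
      by near=> t; apply/esym; near: t.
    by apply: is_derive_eq; rewrite addr0 -[_%:A]/(2^-1 * 1) mulr1.
  by split; [exact: ex_derive|rewrite derive1E derive_val].
- rewrite RintegralZl// RintegralB//; last 2 first.
    exact: integrableS int_fine.
    apply/integrableP; split; first exact/measurable_EFinP/measurable_cst.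
    by rewrite /= integral_cst//= lebesgue_measure_itv/=; case: ifP;
       rewrite ?mule0 ?ltry.
  rewrite -/(F b) FE ?lexx ?andbT ?ge0_cp ?ltW//.
  rewrite Rintegral_cst//. rewrite [X in fine X]lebesgue_measure_itv/= lte_fin gtrN// -EFinB/=.
  by rewrite /G; field; rewrite gt_eqF.
Unshelve. all: by end_near. Qed.
End lipschitz_density.

(** A compactly supported Lipschitz function is a primitive of its
  derivative, so the derivative has integral zero.  The equality of positive
  and negative parts is the form that Tonelli's theorem can integrate over all
  parallel lines.  The derivative is unspecified where it does not exist, whence
  the arbitrary measurable [D]. *)
Lemma lipschitz_derive_cancel (g D : R -> R) (L B : R) :
  (forall x y, `|g x - g y| <= L * `|x - y|) ->
  (forall x, B <= `|x| -> g x = 0) ->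
  measurable_fun [set: R] D ->
  (forall x, derivable g x 1 -> D x = derive1 g x) ->
  {ae mu, forall x, derivable g x 1} /\
  (\int[mu]_x ((EFin \o D)^\+ x) = \int[mu]_x ((EFin \o D)^\- x))%E.
Proof.
move=> gL gB mD DE.
have gL' x y : `|g x - g y| <= (`|L| + 1) * `|x - y|.
  rewrite (le_trans (gL x y))// ler_wpM2r// (le_trans (ler_norm L))//.
  by rewrite lerDl.
pose b := `|B| + 1.
have b0 : 0 < b by rewrite ltr_pwDr.
have Bb : B <= b by rewrite (le_trans (ler_norm B))// lerDl.
have [f [fi ae_f If]] := lipschitz_density (ltr_pwDr ltr01 (normr_ge0 L)) gL' b0.
have far (x : R) : B < `|x| -> is_derive x (1 : R) g 0.
  move=> Bx; apply: (@near_eq_is_derive _ _ _ (cst 0)).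
  near=> t; rewrite /cst gB//; apply: ltW; near: t.
  by move: Bx; apply: cvgr_gt; exact: norm_continuous.
have nfar (x : R) : x \notin `]-b, b[ -> B < `|x|.
  rewrite in_itv/= -ltr_norml -leNgt; apply: lt_le_trans.
  by rewrite (le_lt_trans (ler_norm B))// ltrDl.
have ae_d : {ae mu, forall x, derivable g x 1}.
  move: ae_f; apply: filterS; first exact: (ae_filter_ringOfSetsType mu).
  move=> x; have [xb /(_ isT)[]//|/nfar/far dg _] := boolP (x \in `]-b, b[).
  exact: ex_derive.
split => //.
pose e := f \_ `]-b, b].
have mI : measurable (`]-b, b]%classic : set R) by exact: measurable_itv.
have ei : mu.-integrable [set: R] (EFin \o e).
  by rewrite -restrict_EFin -integrable_mkcond.
have ae_e : {ae mu, forall x, D x = e x}.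
  have nb : {ae mu, forall x, x != b}.
    exists [set b]; split => //; first exact: lebesgue_measure_set1.
    by move=> x /= /negP; rewrite negbK => /eqP.
  move: ae_f nb; apply: filterS2; first exact: (ae_filter_ringOfSetsType mu).
  move=> x fx xb; rewrite /e patchE; case: ifPn => xI.
    have xI' : x \in `]-b, b[.
      move: xI; rewrite inE/= !in_itv/= => /andP[-> /=].
      by rewrite le_eqVlt (negbTE xb).
    by have [dg gx] := fx xI'; rewrite DE.
  have /far dg : B < `|x|.
    apply: nfar; apply: contra xI; rewrite inE/= !in_itv/= => /andP[-> /ltW].
    by [].
  by rewrite DE ?derive1E; [exact: derive_val|exact: ex_derive].
have eD (h : (R -> \bar R) -> R -> \bar R) :
    (forall u v x, u x = v x -> h u x = h v x) ->
    measurable_fun [set: R] (h (EFin \o D)) ->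
    measurable_fun [set: R] (h (EFin \o e)) ->
    (\int[mu]_x h (EFin \o D) x = \int[mu]_x h (EFin \o e) x)%E.
  move=> hE m1 m2.
  apply: ae_eq_integral => //.
  move: ae_e; apply: filterS; first exact: (ae_filter_ringOfSetsType mu).
  by move=> x ex _; apply: hE; rewrite /= ex.
have me : measurable_fun [set: R] (EFin \o e) by exact: measurable_int ei.
have mDe : measurable_fun [set: R] (EFin \o D) by exact/measurable_EFinP.
rewrite (eD (fun u => u^\+)%E); last 3 first.
  by move=> u v x uv; rewrite !funeposE uv.
  exact: measurable_funepos.
  exact: measurable_funepos.
rewrite (eD (fun u => u^\-)%E); last 3 first.
  by move=> u v x uv; rewrite !funenegE uv.
  exact: measurable_funeneg.
  exact: measurable_funeneg.
have I0 : (\int[mu]_x (EFin \o e) x = 0)%E.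
  rewrite -restrict_EFin -integral_mkcond.
  rewrite -[LHS]fineK ?(integrable_fin_num _ fi)//.
  rewrite -/(Rintegral _ _ _) If gB ?gB ?subrr// ?normrN ?(ger0_norm (ltW b0))//.
move: I0; rewrite integralE => /eqP.
rewrite sube_eq ?add0e; [by move/eqP| |].
- exact: integrable_pos_fin_num.
- by apply: fin_num_adde_defl; exact: integrable_neg_fin_num.
Unshelve. all: by end_near. Qed.

End lipschitz_line.

(** * Tonelli on coordinate lines; boxes and measurable sets of rows *)

Section line_tonelli.
Context {R : realType}.
Local Notation T := (measurableTypeR R).
Local Open Scope ereal_scope.

Definition line_tuple n (x : n.-tuple T) (i : 'I_n) (t : T) : n.-tuple T :=
  [tuple (if j == i then t else tnth x j) | j < n].

(** Equality of the integrals along all lines parallel to one axis implies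
  equality of the integrals.  The induction peels off the first coordinate, so
  that it needs no permutation of the factors of the product measure. *)
Lemma line_tonelli n (f h : n.-tuple T -> \bar R) (i : 'I_n) :
  measurable_fun setT f -> measurable_fun setT h ->
  (forall x, 0 <= f x) -> (forall x, 0 <= h x) ->
  (forall x, \int[lebesgue_measure]_t f (line_tuple x i t) =
             \int[lebesgue_measure]_t h (line_tuple x i t)) ->
  \int[tuple_lebesgue n]_x f x = \int[tuple_lebesgue n]_x h x.
Proof.
elim: n => [|n IH] in f h i *; first by case: i.
move=> mf mh f0 h0 fh.
have push (g : n.+1.-tuple T -> \bar R) : measurable_fun setT g ->
    (forall x, 0 <= g x) ->
    \int[tuple_lebesgue n.+1]_x g x =
    \int[(@lebesgue_measure R) \x tuple_lebesgue n]_z g (cons_pair z).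
  move=> mg g0.
  by rewrite (ge0_integral_pushforward (@measurable_cons_pair R n) _ measurableT mg).
rewrite !push//.
have mc (g : n.+1.-tuple T -> \bar R) : measurable_fun setT g ->
   measurable_fun [set: T * n.-tuple T] (g \o @cons_pair R n).
  by move=> mg; apply: measurableT_comp => //; exact: measurable_cons_pair.
case: (unliftP ord0 i) fh => [j ->|->] fh.
  rewrite [LHS](fubini_tonelli1 _ (mc f mf) (fun=> f0 _)) [RHS](fubini_tonelli1 _ (mc h mh) (fun=> h0 _)).
  apply: eq_integral => t _; rewrite /fubini_F/=.
  apply: (IH _ _ j) => //.
  - exact: (measurableT_comp (mc f mf) (measurable_pair1 t)).
  - exact: (measurableT_comp (mc h mh) (measurable_pair1 t)).
  move=> x; have := fh (cons_pair (t, x)).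
  have E s : line_tuple (cons_pair (t, x)) (lift ord0 j) s =
     cons_pair (t, line_tuple x j s).
    apply: eq_from_tnth => k; rewrite !tnth_mktuple.
    by case: (unliftP ord0 k) => [k' ->|->];
     rewrite ?(inj_eq lift_inj) ?tnthS ?tnth_mktuple ?tnth0.
  by under eq_integral do rewrite E; under [RHS]eq_integral do rewrite E.
rewrite [LHS](fubini_tonelli2 _ (mc f mf) (fun=> f0 _)) [RHS](fubini_tonelli2 _ (mc h mh) (fun=> h0 _)).
apply: eq_integral => x _; rewrite /fubini_G/=.
have := fh (cons_pair (point, x)).
have E s : line_tuple (cons_pair (point : T, x)) ord0 s = cons_pair (s, x).
  apply: eq_from_tnth => k; rewrite !tnth_mktuple.
  by case: (unliftP ord0 k) => [k' ->|->]; rewrite ?tnthS ?tnth0.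
by under eq_integral do rewrite E; under [RHS]eq_integral do rewrite E.
Qed.

End line_tonelli.

Section boxes.
Context {R : realType} {n : nat}.

Definition box (a b : 'rV[R]_n) : set 'rV[R]_n :=
  [set x | forall i, a 0 i < x 0 i < b 0 i].

Definition closed_box (a b : 'rV[R]_n) : set 'rV[R]_n :=
  [set x | forall i, a 0 i <= x 0 i <= b 0 i].

Definition rat_box (ab : 'rV[rat]_n * 'rV[rat]_n) : set 'rV[R]_n :=
  box (map_mx ratr ab.1) (map_mx ratr ab.2).

Definition closed_rat_box (ab : 'rV[rat]_n * 'rV[rat]_n) : set 'rV[R]_n :=
  closed_box (map_mx ratr ab.1) (map_mx ratr ab.2).

Lemma box_sub_closed a b : box a b `<=` closed_box a b.
Proof. by move=> x xab i; have /andP[/ltW -> /ltW ->] := xab i. Qed.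

Lemma ball_rowE (x y : 'rV[R]_n) e :
  ball x e y <-> 0 < e /\ forall i, `|x 0 i - y 0 i| < e.
Proof.
split => -[e0 h]; split => // i; first exact: h.
by move=> j; rewrite (ord1 i); exact: h.
Qed.

Lemma open_box a b : open (box a b).
Proof.
rewrite openE => x xab; rewrite /interior.
have H i : \forall y \near x, a 0 i < (y : 'rV[R]_n) 0 i < b 0 i.
  have /andP[ax xb] := xab i.
  have cx : (fun y : 'rV[R]_n => y 0 i) @ x --> x 0 i by exact: coord_continuous.
  near=> y; apply/andP; split; near: y.
    exact: (cvgr_gt _ cx _ ax).
  exact: (cvgr_lt _ cx _ xb).
exact: filter_forall H.
Unshelve. all: by end_near. Qed.

Lemma compact_closed_box a b : compact (closed_box a b).
Proof.
have := @rV_compact R n (fun i => `[a 0 i, b 0 i]%classic).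
by apply=> i; exact: segment_compact.
Qed.

(** The second half keeps the intersection inside any open set that contains
  the second box, which the pi-system arguments below require. *)
Lemma rat_boxI ab cd : exists ef, rat_box ab `&` rat_box cd = rat_box ef /\
  closed_rat_box ef `<=` closed_rat_box cd.
Proof.
exists (\row_i Num.max (ab.1 0 i) (cd.1 0 i), \row_i Num.min (ab.2 0 i) (cd.2 0 i)).
split; last first.
  move=> x xef i; move: (xef i); rewrite !mxE maxr_rat minr_rat ge_max le_min.
  by move=> /andP[/andP[_ ->] /andP[_ ->]].
apply/seteqP; split => [x [xab xcd] i|x xef]; rewrite ?mxE.
  move: (xab i) (xcd i); rewrite !mxE maxr_rat minr_rat gt_max lt_min.
  by move=> /andP[-> ->] /andP[-> ->].
split=> i; move: (xef i); rewrite !mxE maxr_rat minr_rat gt_max lt_min;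
by move=> /andP[/andP[? ?] /andP[? ?]]; apply/andP.
Qed.

Lemma rat_box_nbhs (U : set 'rV[R]_n) x : open U -> U x ->
  exists ab : 'rV[rat]_n * 'rV[rat]_n, rat_box ab x /\
   closed_rat_box ab `<=` U.
Proof.
move=> oU Ux; have /nbhs_ballP[e/= e0 eU] : nbhs x U by apply: open_nbhs_nbhs.
have lo i : exists q : rat, ratr q \in `]x 0 i - e, x 0 i[.
  by apply: rat_in_itvoo; rewrite ltrBlDr ltrDl.
have hi i : exists q : rat, ratr q \in `]x 0 i, x 0 i + e[.
  by apply: rat_in_itvoo; rewrite ltrDl.
have [lq lqE] := choice lo; have [hq hqE] := choice hi.
exists (\row_i lq i, \row_i hq i); split => [i|y yab].
  rewrite !mxE; move: (lqE i) (hqE i); rewrite !in_itv/=.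
  by move=> /andP[_ ->] /andP[->].
apply: eU; apply/ball_rowE; split => // i.
move: (yab i) (lqE i) (hqE i); rewrite !mxE !in_itv/= ltr_norml.
by move=> /andP[? ?] /andP[? ?] /andP[? ?]; apply/andP; split; lra.
Qed.

Lemma open_rat_boxes (U : set 'rV[R]_n) : open U ->
  U = \bigcup_(ab : 'rV[rat]_n * 'rV[rat]_n)
    (if `[< closed_rat_box ab `<=` U >]
     then rat_box ab else set0).
Proof.
move=> oU; apply/seteqP; split => [x Ux|x [ab _]].
  have [ab [xab abU]] := rat_box_nbhs oU Ux.
  by exists ab => //; case: asboolP.
by case: asboolP => // abU xab; apply: abU; exact: box_sub_closed.
Qed.

End boxes.

Section lebesgue_rows.
Context {R : realType} {n : nat}.
Local Notation T := (measurableTypeR R).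

Definition tuple_of_row (x : 'rV[R]_n) : n.-tuple T := [tuple x 0 i | i < n].

Lemma row_of_tupleK : cancel (@row_of_tuple R n) tuple_of_row.
Proof. by move=> t; apply: eq_from_tnth => i; rewrite tnth_mktuple mxE. Qed.

Lemma tuple_of_rowK : cancel tuple_of_row (@row_of_tuple R n).
Proof. by move=> x; apply/rowP => i; rewrite mxE tnth_mktuple. Qed.

Lemma measurable_tuple_of_row :
  measurable_fun [set: 'rV[R]_n] tuple_of_row.
Proof.
move=> _ B mB; rewrite setTI.
have BE A : @row_of_tuple R n @^-1` (tuple_of_row @^-1` A) = A.
  rewrite -comp_preimage (_ : _ \o _ = id) ?preimage_id//.
  by apply/funext => t; exact: row_of_tupleK.
have H X : lebesgue_outer X =
    (lebesgue_outer (X `&` tuple_of_row @^-1` B) +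
     lebesgue_outer (X `&` ~` (tuple_of_row @^-1` B)))%E.
  rewrite /lebesgue_outer !preimage_setI preimage_setC !BE.
  have : ((mu_ext (@tuple_lebesgue R n)).-cara.-measurable B).
    by apply: sub_caratheodory; exact: sub_sigma_algebra.
  by move=> H; exact: (H (@row_of_tuple R n @^-1` X)).
exact: H.
Qed.

Lemma leb_tuple_of_row (B : set (n.-tuple T)) : measurable B ->
  leb (tuple_of_row @^-1` B) = tuple_lebesgue n B.
Proof.
move=> mB; rewrite /leb /lebesgue_outer -comp_preimage.
have -> : tuple_of_row \o (@row_of_tuple R n) = id.
  by apply/funext => t; exact: row_of_tupleK.
by rewrite preimage_id measurable_mu_extE.
Qed.

Lemma ge0_integral_leb (f : n.-tuple T -> \bar R) :
  measurable_fun [set: n.-tuple T] f -> (forall x, 0 <= f x)%E ->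
  (\int[leb]_x f (tuple_of_row x) = \int[tuple_lebesgue n]_x f x)%E.
Proof.
move=> mf f0.
have := ge0_integral_pushforward measurable_tuple_of_row leb measurableT mf.
rewrite preimage_setT => <-; last by move=> x _; exact: f0.
apply: eq_measure_integral => [|mt A mA _].
  exact: measurable_tuple_of_row.
exact: leb_tuple_of_row.
Qed.

Lemma measurable_box_tuple (a b : 'rV[R]_n) :
  measurable (@row_of_tuple R n @^-1` box a b : set (n.-tuple T)).
Proof.
have -> : @row_of_tuple R n @^-1` box a b =
    \bigcap_(i in [set: 'I_n]) ((@tnth n T ^~ i) @^-1` `]a 0 i, b 0 i[%classic).
  apply/seteqP; split => [t tab i _|t tab i] /=.
    by have := tab i; rewrite mxE in_itv.
  by have := tab i Logic.I; rewrite mxE /= in_itv.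
apply: fin_bigcap_measurable => // i _.
by rewrite -[X in measurable X]setTI; apply: measurable_tnth.
Qed.

Lemma measurable_open_tuple (U : set 'rV[R]_n) : open U ->
  measurable (@row_of_tuple R n @^-1` U : set (n.-tuple T)).
Proof.
move=> /open_rat_boxes ->; rewrite preimage_bigcup.
apply: countable_bigcupT_measurable => //= ab.
by case: asboolP => _; [exact: measurable_box_tuple|rewrite preimage_set0].
Qed.

Lemma measurable_leb_tuple (A : set 'rV[R]_n) :
  measurable (@row_of_tuple R n @^-1` A : set (n.-tuple T)) -> measurable A.
Proof.
move=> mA.
have -> : A = tuple_of_row @^-1` (@row_of_tuple R n @^-1` A).
  rewrite -comp_preimage (_ : _ \o _ = id) ?preimage_id//.
  by apply/funext => x; exact: tuple_of_rowK.
by rewrite -[X in measurable X]setTI; exact: measurable_tuple_of_row.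
Qed.

Lemma open_measurable_row (U : set 'rV[R]_n) : open U -> measurable U.
Proof. by move=> oU; apply: measurable_leb_tuple; exact: measurable_open_tuple. Qed.

Lemma closed_measurable_row (F : set 'rV[R]_n) : closed F -> measurable F.
Proof.
by move=> cF; rewrite -(setCK F); apply: measurableC; apply: open_measurable_row; exact: closed_openC.
Qed.

End lebesgue_rows.

(** * Generation and approximation of Lebesgue measurable sets of rows *)

Section lebesgue_approximation.
Context {R : realType} {n : nat}.
Local Notation T := (measurableTypeR R).
Local Notation mu := (@leb R n).

Lemma row_coord_le (x : 'rV[R]_n) i : `|x 0 i| <= `|x|.
Proof.
rewrite [leRHS]/Num.norm /= mx_normrE.
by apply/bigmax_geP; right => /=; exists (0, i).
Qed.

Lemma row_norm_le (x : 'rV[R]_n) e : 0 <= e ->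
  (forall i, `|x 0 i| <= e) -> `|x| <= e.
Proof.
move=> e0 xe; rewrite [leLHS]/Num.norm /= mx_normrE.
by apply/bigmax_leP; split => // -[j i] _ /=; rewrite (ord1 j).
Qed.

Lemma tuple_lebesgue_cube k (M : R) :
  (tuple_lebesgue k [set t : k.-tuple T | forall i, (- M <= tnth t i <= M)%R] < +oo)%E.
Proof.
elim: k => [|k IH].
  rewrite [X in (X < _)%E](_ : _ = \d_([tuple] : 0.-tuple T) [set t : 0.-tuple T | forall i, - M <= tnth t i <= M])//.
  by rewrite diracE; case: (_ \in _); rewrite ltry.
set D := [set t | _].
have -> : tuple_lebesgue k.+1 D = ((@lebesgue_measure R) \x tuple_lebesgue k)%E (@cons_pair R k @^-1` D) by [].
have -> : @cons_pair R k @^-1` D = `[-M, M]%classic `*` [set t : k.-tuple T | forall i, - M <= tnth t i <= M].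
  apply/seteqP; split => [[x t] /= h|[x t] /= [hx ht] i].
    split => [|i]; first by have := h ord0; rewrite tnth0 in_itv.
    by have := h (lift ord0 i); rewrite tnthS.
  case: (unliftP ord0 i) => [j ->|->]; first by rewrite tnthS; exact: ht.
  by rewrite tnth0; move: hx; rewrite /= in_itv.
rewrite product_measure1E//=; last first.
  rewrite (_ : [set _ | _] = \bigcap_(i in [set: 'I_k]) ((@tnth k T ^~ i) @^-1` `[- M, M]%classic)).
    apply: fin_bigcap_measurable => // i _.
    by rewrite -[X in measurable X]setTI; apply: measurable_tnth.
  by apply/seteqP; split => [t h i _|t h i] /=; have := h i; rewrite /= in_itv//; apply.
rewrite lte_mul_pinfty//.
by rewrite lebesgue_measure_itv/= lte_fin; case: ifP.
Qed.

Lemma leb_bounded (A : set 'rV[R]_n) : measurable A -> bounded_set A ->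
  (mu A < +oo)%E.
Proof.
move=> mA [M [Mr AM]].
have [N [N0 AN]] : exists N, 0 < N /\ forall x, A x -> `|x| <= N.
  exists (Num.max 1 (M + 1)); split; first by rewrite lt_max ltr01.
  by move=> x Ax; apply: (AM (Num.max 1 (M + 1))) => //; rewrite lt_max ltrDl ltr01 orbT.
pose Q := [set t : n.-tuple T | forall i, - N <= tnth t i <= N].
have mQ : measurable Q.
  rewrite /Q (_ : [set _ | _] = \bigcap_(i in [set: 'I_n]) ((@tnth n T ^~ i) @^-1` `[- N, N]%classic)).
    apply: fin_bigcap_measurable => // i _.
    by rewrite -[X in measurable X]setTI; apply: measurable_tnth.
  by apply/seteqP; split => [t h i _|t h i] /=; have := h i; rewrite /= in_itv//; apply.
rewrite (le_lt_trans _ (tuple_lebesgue_cube n N))// -leb_tuple_of_row//.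
apply: le_outer_measure => x Ax i; rewrite tnth_mktuple -ler_norml.
by rewrite (le_trans (row_coord_le _ _))// AN.
Qed.

(** The measurable sets of rows are those of a Caratheodory completion.  An
  outer approximation by Borel sets lets properties pass from Borel sets to all
  measurable ones. *)
Lemma leb_borel_hull (A : set 'rV[R]_n) : measurable A -> (mu A < +oo)%E ->
  exists B : set (n.-tuple T), [/\ measurable B, A `<=` tuple_of_row @^-1` B &
    mu (tuple_of_row @^-1` B `\` A) = 0%E].
Proof.
move=> mA Aoo; pose A' : set (n.-tuple T) := @row_of_tuple R n @^-1` A.
have Afin : mu A \is a fin_num by rewrite ge0_fin_numE.
have H (k : nat) : exists B : set (n.-tuple T), [/\ measurable B, A' `<=` B &
    (tuple_lebesgue n B <= mu A + (k.+1%:R^-1)%:E)%E].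
  have k0 : (0 < (k.+1%:R^-1 : R)) by rewrite invr_gt0 ltr0n.
  have := lb_ereal_inf_adherent k0 Afin.
  case=> _ [F [mF AF] <-] Flt.
  exists (\bigcup_i F i); split => //; first exact: bigcupT_measurable.
  by rewrite (le_trans _ (ltW Flt))// measure_sigma_subadditive//; exact: bigcupT_measurable.
have [B /all_and3[mB AB muB]] := choice H.
exists (\bigcap_i B i).
have mcB : measurable (\bigcap_i B i) by exact: bigcapT_measurable.
have mpB : measurable (tuple_of_row @^-1` (\bigcap_i B i) : set 'rV[R]_n).
  by have := measurable_tuple_of_row measurableT mcB; rewrite setTI.
have AcB : A `<=` tuple_of_row @^-1` (\bigcap_i B i).
  by move=> x Ax k _; apply: AB; rewrite /A' /= tuple_of_rowK.
split => //.
have le : (mu (tuple_of_row @^-1` (\bigcap_i B i)) <= mu A)%E.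
  rewrite leb_tuple_of_row//; apply/lee_addgt0Pr => e e0.
  have [k ke] : exists k : nat, k.+1%:R^-1 < e.
    exists (Num.bound e^-1); rewrite invf_plt ?posrE//.
    by rewrite (lt_trans (archi_boundP _))// ?invr_ge0 ?ltW// ltr_nat.
  rewrite (le_trans (le_measure _ _ _ (_ : _ `<=` B k))) ?inE//.
    by move=> x; exact.
  by rewrite (le_trans (muB k))// leeD2l// lee_fin ltW.
have -> : mu (tuple_of_row @^-1` (\bigcap_i B i) `\` A) =
   (mu (tuple_of_row @^-1` (\bigcap_i B i)) - mu A)%E.
  by rewrite measureD ?(setIidr AcB)//; exact: (le_lt_trans le).
apply/eqP; rewrite eq_le; apply/andP; split.
  by rewrite sube_le0.
by rewrite sube_ge0 ?le_measure ?inE// Afin.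
Qed.

Lemma g_rat_box_tuple (B : set (n.-tuple T)) : measurable B ->
  <<s range (@rat_box R n) >> (tuple_of_row @^-1` B).
Proof.
pose S := g_sigma_algebraType (range (@rat_box R n)).
suff : measurable_fun [set: S] (tuple_of_row : S -> n.-tuple T).
  by move=> /(_ measurableT B) /[apply]; rewrite setTI.
apply/measurable_fun_tnthP => i.
rewrite (_ : _ \o _ = (fun x : S => (x : 'rV[R]_n) 0 i)); last first.
  by apply/funext => x; rewrite /= tnth_mktuple.
suff : measurable_fun [set: S] (fun x : S => (x : 'rV[R]_n) 0 i : R) by exact.
apply: (measurability _ (RGenOInfty.measurableE R)) => _ [_ [x ->] <-].
rewrite setTI.
have o : open [set y : 'rV[R]_n | x < y 0 i].
  apply: (@open_comp _ _ (fun y : 'rV[R]_n => y 0 i) [set t | x < t]).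
    by move=> y _; exact: coord_continuous.
  exact: open_gt.
rewrite (_ : _ @^-1` _ = [set y : 'rV[R]_n | x < y 0 i]); last first.
  by apply/seteqP; split => y /=; rewrite in_itv/= andbT.
rewrite (open_rat_boxes o).
apply: countable_bigcupT_measurable => //= ab.
case: asboolP => _; last exact: measurable0.
by apply: sub_sigma_algebra; exists ab.
Qed.

(** The pi-lambda theorem for Lebesgue measurable sets: Borel sets are
  generated by rational boxes, and every measurable set of finite measure
  differs from a Borel set by a null set. *)
Lemma leb_dynkin (P : set (set 'rV[R]_n)) :
  P setT ->
  (forall A, measurable A -> P A -> P (~` A)) ->
  (forall F : (set 'rV[R]_n)^nat, (forall k, measurable (F k)) ->
     trivIset setT F -> (forall k, P (F k)) -> P (\bigcup_k F k)) ->
  (forall ab, P (rat_box ab)) ->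
  (forall A B, measurable A -> measurable B -> A `<=` B -> mu (B `\` A) = 0%E ->
     P B -> P A) ->
  forall A, measurable A -> P A.
Proof.
move=> PT PC PU PG P0.
have PB (B : set (n.-tuple T)) : measurable B -> P (tuple_of_row @^-1` B).
  move=> mB.
  suff : <<s range (@rat_box R n) >> `<=` [set A | measurable A /\ P A].
    by move=> /(_ _ (g_rat_box_tuple mB))[].
  apply: lambda_system_subset => //.
  - move=> _ _ [ab _ <-] [cd _ <-]; have [ef [-> _]] := @rat_boxI R n ab cd.
    by exists ef.
  - apply/dynkin_lambda_system; split.
    + by split.
    + by move=> A [mA PA]; split; [exact: measurableC|exact: PC].
    + move=> F tF FP; split; first by apply: bigcupT_measurable => k; have [] := FP k.
      by apply: PU => // k; have [] := FP k.
  - by move=> _ [ab _ <-]; split => //; apply: open_measurable_row; exact: open_box.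
have Pfin A : measurable A -> (mu A < +oo)%E -> P A.
  move=> mA /(leb_borel_hull mA)[B [mB AB B0]].
  apply: (P0 _ (tuple_of_row @^-1` B)) => //; last exact: PB.
  by have := measurable_tuple_of_row measurableT mB; rewrite setTI.
move=> A mA.
pose Q k : set 'rV[R]_n := [set x | `|x| < k%:R].
have mQ k : measurable (Q k).
  apply: open_measurable_row; apply: (@open_comp _ _ (fun y : 'rV[R]_n => `|y|) [set t | t < k%:R]).
    by move=> y _; exact: norm_continuous.
  exact: open_lt.
have -> : A = \bigcup_k (A `&` seqDU Q k).
  rewrite -setI_bigcupr -seqDU_bigcup_eq.
  apply/seteqP; split => [x Ax|x []//]; split => //.
  by exists (Num.bound `|x|) => //; rewrite /Q /=; exact: archi_boundP.
have mAQ k : measurable (A `&` seqDU Q k).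
  by apply: measurableI => //; exact: seqDU_measurable.
apply: PU => //.
  by apply: trivIset_setIl; exact: trivIset_seqDU.
move=> k; apply: Pfin => //; apply: leb_bounded => //.
exists k%:R; split; first exact: num_real.
move=> M kM x [_ /(@subset_seqDU _ Q k)]; rewrite /Q /= => /ltW /le_trans; apply.
exact: ltW.
Qed.

Let sdiff (A B : set 'rV[R]_n) := (A `\` B) `|` (B `\` A).

(** A closed set is the intersection of its open neighbourhoods of radius
  1/(k+1); continuity from above on [D] gives the estimate. *)
Lemma closed_outer_approx (D F : set 'rV[R]_n) (e : R) : measurable D ->
  (mu D < +oo)%E -> closed F -> 0 < e ->
  exists V, [/\ open V, F `<=` V & (mu (D `&` (V `\` F)) < e%:E)%E].
Proof.
move=> mD Doo cF e0.
pose V k := \bigcup_(y in F) ball y (k.+1%:R^-1 : R).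
have oV k : open (V k) by apply: bigcup_open => y _; exact: ball_open.
have FV k : F `<=` V k.
  by move=> y Fy; exists y => //; apply: ballxx; rewrite invr_gt0 ltr0n.
have mV k : measurable (D `&` (V k `\` F)).
  apply: measurableI => //; apply: measurableD; first exact: open_measurable_row.
  exact: closed_measurable_row.
have V0 : \bigcap_k (D `&` (V k `\` F)) = set0.
  rewrite -subset0 => x Vx; have [_ [_ Fx]] := Vx 0%N Logic.I.
  apply: Fx; apply: cF => B /nbhs_ballP[r /= r0 rB].
  have [k ke] : exists k : nat, k.+1%:R^-1 < r.
    exists (Num.bound r^-1); rewrite invf_plt ?posrE//.
    by rewrite (lt_trans (archi_boundP _))// ?invr_ge0 ?ltW// ltr_nat.
  have [_ [[y Fy yx] _]] := Vx k Logic.I.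
  exists y; split => //; apply: rB; apply: ball_sym.
  by apply: le_ball yx; exact: ltW.
have := @nonincreasing_cvg_mu _ _ _ mu (fun k => D `&` (V k `\` F)).
rewrite V0 measure0 => H.
have {}H : (mu (D `&` (V k `\` F))) @[k --> \oo] --> 0%E.
  apply: H => //.
    by rewrite (le_lt_trans _ Doo)// le_measure ?inE.
  move=> i j ij; apply/subsetPset => x [Dx [[y Fy yx] nFx]]; split => //; split => //.
  exists y => //; apply: le_ball yx.
  by rewrite lef_pV2 ?posrE ?ltr0n// ler_nat ltnS.
have e0' : (0 < e%:E)%E by rewrite lte_fin.
have : nbhs 0%E [set x : \bar R | (x < e%:E)%E].
  by apply: open_nbhs_nbhs; split => //; exact: open_ereal_lt_ereal.
move=> /H[k _ kV].
by exists (V k); split => //; exact: (kV k (leqnn k)).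
Qed.

(** The sets that open sets approximate in measure inside [D] form a Dynkin
  system; the complement step is [closed_outer_approx]. *)
Lemma open_approx (D E : set 'rV[R]_n) (e : R) : open D -> (mu D < +oo)%E ->
  measurable E -> E `<=` D -> 0 < e ->
  exists U, [/\ open U, U `<=` D & (mu (sdiff E U) < e%:E)%E].
Proof.
move=> oD Doo mE ED e0.
have mD : measurable D by exact: open_measurable_row.
have msd A B : measurable A -> measurable B -> measurable (sdiff A B).
  by move=> mA mB; apply: measurableU; exact: measurableD.
suff : forall e, 0 < e -> exists U, open U /\ (mu (D `&` sdiff E U) < e%:E)%E.
  move=> /(_ e e0)[U [oU Ue]]; exists (U `&` D); split => //; first exact: openI.
  apply: le_lt_trans Ue; apply: le_outer_measure => x.
  by move=> [[Ex nUDx]|[[Ux Dx] nEx]]; split=> //; [exact: ED|left|right];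
    split => // Ux; apply: nUDx; split => //; exact: ED.
move: E mE {ED}; apply: leb_dynkin.
- move=> r r0; exists setT; split; first exact: openT.
  by rewrite /sdiff !setDv setU0 setI0 measure0 lte_fin.
- move=> A mA PA r r0.
  have r20 : 0 < r / 2 by rewrite divr_gt0.
  have [U [oU Ur]] := PA _ r20.
  have [V [oV UV Vr]] := closed_outer_approx mD Doo (open_closedC oU) r20.
  exists V; split => //.
  have mU := open_measurable_row oU; have mV := open_measurable_row oV.
  have mDV : measurable (D `&` (V `\` ~` U)).
    by apply: measurableI => //; apply: measurableD => //; exact: measurableC.
  have mDA : measurable (D `&` sdiff A U).
    by apply: measurableI => //; exact: msd.
  apply: (@le_lt_trans _ _ (mu ((D `&` sdiff A U) `|` (D `&` (V `\` ~` U))))).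
    apply: le_outer_measure => x [Dx] [[nAx nVx]|[Vx nnAx]].
      left; split => //; right; split => //; apply: contrapT => nUx.
      by apply: nVx; exact: UV.
    have Ax : A x by apply: contrapT.
    have [Ux|nUx] := pselect (U x); last by left; split => //; left.
    by right; split => //; split => // nUx; exact: nUx.
  apply: (@le_lt_trans _ _ (mu (D `&` sdiff A U) + mu (D `&` (V `\` ~` U)))%E).
    exact: measureU2.
  by rewrite (splitr r) EFinD lteD.
- move=> F mF _ PF r r0.
  have H k : exists U, open U /\ (mu (D `&` sdiff (F k) U) < (r / 2 / (2 ^ k.+1)%:R)%:E)%E.
    by apply: PF; rewrite !divr_gt0// ltr0n expn_gt0.
  have [U /all_and2[oU Ur]] := choice H.
  exists (\bigcup_k U k); split; first by apply: bigcup_open => k _; exact: oU.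
  have mU k := open_measurable_row (oU k).
  have mDF k : measurable (D `&` sdiff (F k) (U k)).
    by apply: measurableI => //; exact: msd.
  apply: (@le_lt_trans _ _ (mu (\bigcup_k (D `&` sdiff (F k) (U k))))).
    apply: le_outer_measure => x [Dx] [[[k _ Fx] nUx]|[[k _ Ux] nFx]].
      by exists k => //; split => //; left; split => // Ux; apply: nUx; exists k.
    by exists k => //; split => //; right; split => // Fx; apply: nFx; exists k.
  apply: (@le_lt_trans _ _ (\sum_(k <oo) mu (D `&` sdiff (F k) (U k)))%E).
    by apply: measure_sigma_subadditive => //; exact: bigcupT_measurable.
  apply: (@le_lt_trans _ _ (\sum_(k <oo) (0 + (r / 2 / (2 ^ k.+1)%:R)%:E))%E).
    by apply: lee_nneseries => // k _; rewrite add0e; exact: ltW.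
  apply: (@le_lt_trans _ _ (\sum_(k <oo) 0 + (r / 2)%:E)%E).
    apply: (@epsilon_trick R (fun=> 0%E)) => //.
    by rewrite divr_ge0// ltW.
  rewrite eseries0// add0e lte_fin; lra.
- move=> ab r r0; exists (rat_box ab); split; first exact: open_box.
  by rewrite /sdiff !setDv setU0 setI0 measure0 lte_fin.
- move=> A B mA mB AB BA0 PB r r0.
  have [U [oU Ur]] := PB r r0; exists U; split => //.
  have mU := open_measurable_row oU.
  have mDB : measurable (D `&` sdiff B U).
    by apply: measurableI => //; exact: msd.
  apply: (@le_lt_trans _ _ (mu ((B `\` A) `|` (D `&` sdiff B U)))).
    apply: le_outer_measure => x [Dx] [[Ax nUx]|[Ux nAx]].
      by right; split => //; left; split => //; exact: AB.
    have [Bx|nBx] := pselect (B x); first by left.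
    by right; split => //; right.
  apply: le_lt_trans Ur.
  have mBA : measurable (B `\` A) by exact: measurableD.
  by have := measureU2 mu mBA mDB; rewrite [X in (_ <= X + _)%E -> _]BA0 add0e.
Qed.

End lebesgue_approximation.

(** * Directional derivatives of Lipschitz functions *)

Section directional_derivative.
Context {R : realType} {n : nat}.
Local Notation T := (measurableTypeR R).
Local Notation mu := (@leb R n).
Variables (G : 'rV[R]_n -> R) (i : 'I_n) (L B : R).
Local Notation e := (delta_mx 0 i : 'rV[R]_n).
Hypothesis cG : continuous G.
Hypothesis GB : forall x, B <= `|x| -> G x = 0.
Hypothesis GL : forall x s t, `|G (x + s *: e) - G (x + t *: e)| <= L * `|s - t|.

Let quot (h : R) (x : 'rV[R]_n) : R := h^-1 * (G (h *: e + x) - G x).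

Let quotL h x : `|quot h x| <= `|L|.
Proof.
rewrite /quot normrM; have [->|h0] := eqVneq h 0.
  by rewrite invr0 normr0 mul0r.
have := GL x h 0; rewrite scale0r addr0 subr0 (addrC x) => Gh.
rewrite normfV ler_pdivrMl ?normr_gt0// mulrC (le_trans Gh)//.
by rewrite ler_wpM2r// ler_norm.
Qed.

Lemma shift_continuous (f : 'rV[R]_n -> R) (v : 'rV[R]_n) :
  continuous f -> continuous (fun x => f (v + x)).
Proof.
move=> cf x; have h : (fun y => v + y) @ nbhs x --> v + x.
  apply: (@cvgD _ _ _ (nbhs x)); first exact: cvg_cst.
  exact: cvg_id.
exact: (cvg_comp _ _ h (cf _)).
Qed.

Let quot_continuous h : continuous (quot h).
Proof.
move=> x; apply: (cvgMr (F := nbhs x)); apply: (cvgB (F := nbhs x)).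
  exact: (shift_continuous cG).
exact: cG.
Qed.

Let derivableE x : derivable G x e <-> cvg ((fun h => quot h x) @ 0^').
Proof. by []. Qed.

(** The Cauchy condition for the difference quotients; the set is closed because
  each quotient is continuous. *)
Let F j k := [set x | forall h h', h != 0 -> h' != 0 ->
  `|h| < k.+1%:R^-1 -> `|h'| < k.+1%:R^-1 -> `|quot h x - quot h' x| <= j.+1%:R^-1].

Let closed_F j k : closed (F j k).
Proof.
have -> : F j k = \bigcap_(hh in [set hh : R * R | [/\ hh.1 != 0, hh.2 != 0,
    `|hh.1| < k.+1%:R^-1 & `|hh.2| < k.+1%:R^-1]])
    [set x | `|quot hh.1 x - quot hh.2 x| <= j.+1%:R^-1].
  apply/seteqP; split => [x Fx [h h'] [h0 h'0 hk h'k]|x Fx h h' h0 h'0 hk h'k].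
    exact: Fx.
  by apply: (Fx (h, h')).
apply: closed_bigI => -[h h'] _ /=.
apply: (@closed_comp _ _ (fun x => `|quot h x - quot h' x|) [set t | t <= j.+1%:R^-1]).
  move=> x _; apply: (cvg_norm (F := nbhs x)).
  by apply: (cvgB (F := nbhs x)); exact: quot_continuous.
exact: closed_le.
Qed.

Let F_derivable : [set x | derivable G x e] = \bigcap_j \bigcup_k F j k.
Proof.
apply/seteqP; split => x.
  move=> /derivableE /cvg_ex[l xl] j _.
  have j0 : (0 : R) < j.+1%:R^-1 / 2 by rewrite divr_gt0// invr_gt0.
  have /cvgrPdist_lt /(_ _ j0) := xl.
  case => r /= r0 rl.
  exists (Num.bound r^-1) => // h h' h0 h'0 hk h'k.
  have rk : (Num.bound r^-1).+1%:R^-1 < r.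
    rewrite invf_plt ?posrE//.
    by rewrite (lt_trans (archi_boundP _))// ?invr_ge0 ?ltW// ltr_nat.
  have lh : `|l - quot h x| < j.+1%:R^-1 / 2.
    by apply: rl => //=; rewrite sub0r normrN (lt_trans hk).
  have lh' : `|l - quot h' x| < j.+1%:R^-1 / 2.
    by apply: rl => //=; rewrite sub0r normrN (lt_trans h'k).
  rewrite (_ : _ - _ = (l - quot h' x) - (l - quot h x)); last by ring.
  rewrite (le_trans (ler_normB _ _))// (splitr j.+1%:R^-1).
  by apply: lerD; exact: ltW.
move=> Fx; apply/derivableE; apply/cauchy_cvgP/cauchy_exP => r r0.
have [j jr] : exists j : nat, j.+1%:R^-1 < r.
  exists (Num.bound r^-1); rewrite invf_plt ?posrE//.
  by rewrite (lt_trans (archi_boundP _))// ?invr_ge0 ?ltW// ltr_nat.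
have [k _ Fk] := Fx j Logic.I.
have k0 : (0 : R) < k.+1%:R^-1 by rewrite invr_gt0.
(* Any fixed increment below 1/(k+1) serves as centre of the Cauchy ball. *)
pose h0 : R := k.+2%:R^-1.
have h00 : 0 < h0 by rewrite invr_gt0.
exists (quot h0 x).
suff : \forall h \near 0^', ball (quot h0 x) r (quot h x) by [].
near=> h; rewrite /ball/= (le_lt_trans _ jr)//=; apply: Fk.
- by rewrite gt_eqF.
- by near: h; exact: nbhs_dnbhs_neq.
- by rewrite gtr0_norm// ltf_pV2 ?posrE ?ltr0n// ltr_nat.
- by near: h; exact: dnbhs0_lt.
Unshelve. all: by end_near. Qed.

(** A measurable function that is equal to the directional derivative where
  the latter exists; the limit superior of difference quotients exists at every
  point. *)
Definition limsup_quotient (x : 'rV[R]_n) : R :=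
  fine (limn_esup (fun k => (quot k.+1%:R^-1 x)%:E)).

Let limsup_quotientE x : derivable G x e -> limsup_quotient x = 'D_e G x.
Proof.
move=> dx; rewrite /limsup_quotient.
have qx : (quot k.+1%:R^-1 x) @[k --> \oo] --> 'D_e G x.
  have /cvgr_dnbhsP := (dx : (quot h x) @[h --> 0^'] --> 'D_e G x).
  apply; split => [k|]; first by rewrite gt_eqF.
  exact: cvg_harmonic.
have qE : (quot k.+1%:R^-1 x)%:E @[k --> \oo] --> ('D_e G x)%:E.
  by apply/fine_cvgP; split; [exact: nearW|exact: qx].
rewrite is_cvg_limn_esupE; last by apply/cvg_ex; exists ('D_e G x)%:E.
by rewrite (cvg_lim _ qE).
Qed.

Let limsup_quotientL x : `|limsup_quotient x| <= `|L|.
Proof.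
have H c : (forall k, (-`|L|)%:E <= (c k : \bar R) <= (`|L|)%:E)%E ->
    `|fine (limn_esup c)| <= `|L|.
  move=> cL.
  have le1 : (limn_esup c <= (`|L|)%:E)%E.
    rewrite limn_esup_lim; apply: lime_le; first exact: is_cvg_esups.
    apply: nearW => k; apply: ge_ereal_sup => _ [j _ <-].
    by have /andP[] := cL j.
  have le2 : ((- `|L|)%:E <= limn_esup c)%E.
    rewrite limn_esup_lim; apply: lime_ge; first exact: is_cvg_esups.
    apply: nearW => k; apply: (@le_trans _ _ (c k)); first by have /andP[] := cL k.
    by apply: ereal_sup_ubound; exists k => //=.
  move: le1 le2; case: (limn_esup c) => // r.
  by rewrite !lee_fin /= ler_norml => -> ->.
apply: H => k; rewrite !lee_fin -ler_norml; exact: quotL.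
Qed.

Let far_quot x : B < `|x| -> limsup_quotient x = 0 /\ is_derive x e G 0.
Proof.
move=> Bx.
have dG : is_derive x e G 0.
  apply: (@near_eq_is_derive _ _ _ (cst 0)).
  have : nbhs x [set y | B < `|y|].
    by move: Bx; apply: (cvgr_gt (F := nbhs x)); exact: norm_continuous.
  by apply: filterS => y /ltW By; rewrite GB.
by split => //; rewrite limsup_quotientE; [exact: derive_val|exact: ex_derive].
Qed.

Lemma measurable_tuple_continuous (f : 'rV[R]_n -> R) : continuous f ->
  measurable_fun [set: n.-tuple T] (f \o @row_of_tuple R n).
Proof.
move=> cf; apply: (measurability _ (RGenOInfty.measurableE R)) => _ [_ [x ->] <-].
rewrite setTI comp_preimage; apply: measurable_open_tuple.
apply: open_comp; first by move=> y _; exact: cf.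
exact: interval_open.
Qed.

Let measurable_limsup : measurable_fun [set: n.-tuple T] (limsup_quotient \o @row_of_tuple R n).
Proof.
apply: (measurableT_comp (fine_measurable _)) => //.
apply: (measurable_fun_limn_esup (f := fun k t => (quot k.+1%:R^-1 (row_of_tuple t))%:E)).
move=> k; apply/measurable_EFinP.
exact: (@measurable_tuple_continuous (quot k.+1%:R^-1)).
Qed.

Let lineE (t : n.-tuple T) (s : R) :
  row_of_tuple (line_tuple t i s) = row_of_tuple (line_tuple t i 0) + s *: e.
Proof.
apply/rowP => k; rewrite !mxE !tnth_mktuple !eqxx /=.
by case: eqVneq => _; rewrite ?mulr1 ?mulr0 ?add0r ?addr0.
Qed.

Lemma line_derivable (y : 'rV[R]_n) (s : R) :
  derivable (fun t : R => G (y + t *: e)) s (1 : R) <-> derivable G (y + s *: e) e.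
Proof.
rewrite /derivable.
suff -> : (fun h : R => h^-1 *: (G (y + (h *: (1 : R) + s) *: e) - G (y + s *: e))) =
  (fun h : R => h^-1 *: (G (h *: e + (y + s *: e)) - G (y + s *: e))) by [].
apply/funext => h; congr (_ *: (G _ - _)).
by rewrite addrCA scalerDl -[_ *: 1]/(h * 1) mulr1.
Qed.

Lemma line_derive (y : 'rV[R]_n) (s : R) :
  derive1 (fun t : R => G (y + t *: e)) s = 'D_e G (y + s *: e).
Proof.
rewrite derive1E /derive.
suff -> : (fun h : R => h^-1 *: (G (y + (h *: (1 : R) + s) *: e) - G (y + s *: e))) =
  (fun h : R => h^-1 *: (G (h *: e + (y + s *: e)) - G (y + s *: e))) by [].
apply/funext => h; congr (_ *: (G _ - _)).
by rewrite addrCA scalerDl -[_ *: 1]/(h * 1) mulr1.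
Qed.

Let measurable_line_tuple (t : n.-tuple T) : measurable_fun [set: T] (line_tuple t i).
Proof.
apply/measurable_fun_tnthP => k.
rewrite (_ : _ \o _ = if k == i then id else cst (tnth t k)).
  by case: ifP => _; [apply: (@measurable_id _ T setT)|apply: measurable_cst].
by apply/funext => s /=; rewrite tnth_mktuple; case: ifP.
Qed.

Let line_cancel (t : n.-tuple T) :
  let y := row_of_tuple (line_tuple t i 0) in
  {ae (@lebesgue_measure R), forall s, derivable G (y + s *: e) e} /\
  (\int[lebesgue_measure]_s ((EFin \o (fun s : R => limsup_quotient (y + s *: e)))^\+ s) =
   \int[lebesgue_measure]_s ((EFin \o (fun s : R => limsup_quotient (y + s *: e)))^\- s))%E.
Proof.
move=> y.
have [] := @lipschitz_derive_cancel R (fun s => G (y + s *: e))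
    (fun s => limsup_quotient (y + s *: e)) L B.
- by move=> a b; exact: GL.
- move=> a aB; apply: GB; rewrite (le_trans aB)//.
  have := row_coord_le (y + a *: e) i.
  by rewrite !mxE tnth_mktuple !eqxx add0r mulr1.
- rewrite (_ : (fun _ => _) = (limsup_quotient \o @row_of_tuple R n) \o line_tuple t i).
    exact: measurableT_comp measurable_limsup (measurable_line_tuple t).
  by apply/funext => s /=; rewrite lineE.
- move=> s ds; rewrite limsup_quotientE; first by rewrite line_derive.
  exact: (proj1 (line_derivable y s) ds).
move=> H1 H2; split; last exact: H2.
move: H1; apply: filterS; first exact: (ae_filter_ringOfSetsType lebesgue_measure).
by move=> s ds; exact: (proj1 (line_derivable y s) ds).
Qed.

Let measurable_derivable : measurable (@row_of_tuple R n @^-1` [set x | derivable G x e] : set (n.-tuple T)).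
Proof.
rewrite F_derivable preimage_bigcap; apply: bigcapT_measurable => j.
rewrite preimage_bigcup; apply: bigcupT_measurable => k.
rewrite -(setCK (F j k)) -preimage_setC; apply: measurableC.
apply: measurable_open_tuple; exact: closed_openC.
Qed.

(** On every line parallel to the axis the set of points without derivative
  is null, by the one-dimensional theorem, so it is null by Tonelli.  It is
  measurable because existence of the derivative is a Cauchy condition on
  continuous difference quotients. *)
Lemma ae_derivable : {ae mu, forall x, derivable G x e}.
Proof.
pose N : set (n.-tuple T) := ~` (@row_of_tuple R n @^-1` [set x | derivable G x e]).
have mN : measurable N by exact: measurableC.
exists (tuple_of_row @^-1` N); split.
- by have := measurable_tuple_of_row measurableT mN; rewrite setTI.
- rewrite leb_tuple_of_row// -[LHS]mul1e -[LHS]integral_cst//.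
  rewrite integral_mkcond/=.
  rewrite (_ : _ \_ _ = EFin \o \1_N); last first.
    by apply/funext => t; rewrite patchE /= indicE; case: ifP.
  rewrite (@line_tonelli R n (EFin \o \1_N) (cst 0%E) i) ?integral0//.
  + by apply/measurable_EFinP; exact: measurable_indic.
  + by move=> t; rewrite lee_fin.
  + move=> t; rewrite integral0; have [[M [mM M0 subM]] _] := line_cancel t.
    rewrite (ae_eq_integral (cst 0%E)) ?integral0//.
    * apply: measurableT_comp; first exact/measurable_EFinP/measurable_indic.
      exact: measurable_line_tuple.
    * exists M; split => //; apply: subset_trans subM => s /= sN; apply: contra_not sN => ds _.
      by rewrite indicE memNset//; apply; rewrite /= lineE.
- move=> x /= nx; rewrite /N /= tuple_of_rowK; exact: nx.
Qed.

(** On every line the positive and negative parts of the derivative have the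
  same integral. *)
Lemma derive_line_integral :
  mu.-integrable [set: 'rV[R]_n] (EFin \o 'D_e G) /\
  (\int[mu]_x ('D_e G x)%:E = 0)%E.
Proof.
have mD : measurable_fun [set: 'rV[R]_n] (EFin \o limsup_quotient).
  rewrite (_ : _ \o _ = (EFin \o (limsup_quotient \o @row_of_tuple R n)) \o tuple_of_row).
    by apply: measurableT_comp measurable_tuple_of_row; exact/measurable_EFinP.
  by apply/funext => x; rewrite /= tuple_of_rowK.
have aeD : ae_eq mu setT (EFin \o limsup_quotient) (EFin \o 'D_e G).
  have [N [mN N0 subN]] := ae_derivable; exists N; split => //.
  apply: subset_trans subN => x /=; apply: contra_not => dx _.
  by rewrite limsup_quotientE.
have iD : mu.-integrable [set: 'rV[R]_n] (EFin \o limsup_quotient).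
  pose Q := [set x : 'rV[R]_n | `|x| <= `|B|].
  have mQ : measurable Q.
    apply: closed_measurable_row; apply: (@closed_comp _ _ (fun y : 'rV[R]_n => `|y|) [set t | t <= `|B|]).
      by move=> y _; exact: norm_continuous.
    exact: closed_le.
  have Qoo : (mu Q < +oo)%E.
    apply: (leb_bounded mQ); exists `|B|; split; first exact: num_real.
    by move=> r Br x Qx; exact: (le_trans Qx (ltW Br)).
  have iQ : mu.-integrable Q (EFin \o limsup_quotient).
    apply: (measurable_bounded_integrable mQ Qoo).
      by apply/measurable_EFinP; apply: measurable_funTS; exact: mD.
    exists `|L|; split; first exact: num_real.
    by move=> r Lr x Qx; exact: (le_trans (limsup_quotientL x) (ltW Lr)).
  have -> : EFin \o limsup_quotient = (EFin \o limsup_quotient) \_ Q.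
    apply/funext => x; rewrite patchE; case: ifPn => // /negP xQ.
    have Bx : `|B| < `|x| by rewrite ltNge; apply/negP => h; apply: xQ; rewrite inE.
    by have [+ _] := far_quot (le_lt_trans (ler_norm B) Bx) => /= ->.
  by rewrite -(integrable_mkcond _ mQ).
have mD' : measurable_fun [set: 'rV[R]_n] (EFin \o 'D_e G).
  apply: ae_measurable_fun aeD mD.
  exact: measure_is_complete_caratheodory.
split.
  exact: (ae_eq_integrable measurableT mD' aeD iD).
rewrite -(ae_eq_integral _ _ measurableT mD mD' aeD) integralE.
have mDt : measurable_fun [set: n.-tuple T] (EFin \o (limsup_quotient \o @row_of_tuple R n)).
  exact/measurable_EFinP.
have E1 : (\int[mu]_x ((EFin \o limsup_quotient)^\+ x) =
   \int[tuple_lebesgue n]_t ((EFin \o (limsup_quotient \o @row_of_tuple R n))^\+ t))%E.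
  rewrite -ge0_integral_leb//; last exact: measurable_funepos.
  by apply: eq_integral => x _; rewrite !funeposE /= tuple_of_rowK.
have E2 : (\int[mu]_x ((EFin \o limsup_quotient)^\- x) =
   \int[tuple_lebesgue n]_t ((EFin \o (limsup_quotient \o @row_of_tuple R n))^\- t))%E.
  rewrite -ge0_integral_leb//; last exact: measurable_funeneg.
  by apply: eq_integral => x _; rewrite !funenegE /= tuple_of_rowK.
have E3 : (\int[tuple_lebesgue n]_t ((EFin \o (limsup_quotient \o @row_of_tuple R n))^\+ t) =
   \int[tuple_lebesgue n]_t ((EFin \o (limsup_quotient \o @row_of_tuple R n))^\- t))%E.
  apply: (@line_tonelli R n _ _ i) => //.
  - exact: measurable_funepos.
  - exact: measurable_funeneg.
  - move=> t; have [_ H] := line_cancel t.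
    pose D0 (s : R) := limsup_quotient (row_of_tuple (line_tuple t i 0) + s *: e).
    have Ep (s : R) : ((EFin \o (limsup_quotient \o @row_of_tuple R n))^\+ (line_tuple t i s) =
      (EFin \o D0)^\+ s)%E by rewrite !funeposE /D0 /= lineE.
    have En (s : R) : ((EFin \o (limsup_quotient \o @row_of_tuple R n))^\- (line_tuple t i s) =
      (EFin \o D0)^\- s)%E by rewrite !funenegE /D0 /= lineE.
    under eq_integral do rewrite Ep.
    by under [RHS]eq_integral do rewrite En.
rewrite [X in (X - _)%E]E1 E3 -E2 subee//.
exact: integrable_neg_fin_num.
Qed.

End directional_derivative.

(** * Lipschitz functions that vanish outside a set *)

Section cutoff_lipschitz.
Context {R : realType} {n : nat}.
Local Notation mu := (@leb R n).
Local Notation e i := (delta_mx 0 i : 'rV[R]_n).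

(** The class of functions to which the integration by parts applies.  The
  Lipschitz condition is imposed along the axes only, which is what the
  one-dimensional argument uses and what passes to products. *)
Definition cutoff_lipschitz (A : set 'rV[R]_n) (f : 'rV[R]_n -> R) :=
  [/\ continuous f,
      exists L, forall i x s t, `|f (x + s *: e i) - f (x + t *: e i)| <= L * `|s - t|,
      exists M, forall x, `|f x| <= M &
      forall x, ~ A x -> f x = 0].

Lemma derive_lipschitz_le (f : 'rV[R]_n -> R) i L x :
  (forall s t, `|f (x + s *: e i) - f (x + t *: e i)| <= L * `|s - t|) ->
  derivable f x (e i) -> `|'D_(e i) f x| <= `|L|.
Proof.
move=> fL dx.
have cD : (h^-1 *: (f (h *: e i + x) - f x)) @[h --> 0^'] --> 'D_(e i) f x by exact: dx.
apply: (@closed_cvg _ _ _ _ _ (fun y : R => `|y| <= `|L|) _ _ _ cD).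
  apply: (@closed_comp _ _ (fun y : R => `|y|) [set t | t <= `|L|]).
    by move=> y _; exact: norm_continuous.
  exact: closed_le.
apply: nearW => h; rewrite normrZ; have [->|h0] := eqVneq h 0.
  by rewrite invr0 normr0 mul0r.
have := fL h 0; rewrite scale0r addr0 subr0 (addrC x) => fh.
rewrite normfV ler_pdivrMl ?normr_gt0// mulrC (le_trans fh)//.
by rewrite ler_wpM2r// ler_norm.
Qed.

Lemma cutoff_lipschitz_derive A f i : bounded_set A -> cutoff_lipschitz A f ->
  [/\ {ae mu, forall x, derivable f x (e i)},
      mu.-integrable [set: 'rV[R]_n] (EFin \o 'D_(e i) f) &
      (\int[mu]_x ('D_(e i) f x)%:E = 0)%E].
Proof.
move=> [N [Nr AN]] [cf [L fL] _ fA].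
have fB x : N + 1 <= `|x| -> f x = 0.
  move=> Nx; apply: fA => Ax.
  have : `|x| <= N + 2^-1.
    by apply: (AN (N + 2^-1)) => //; rewrite ltrDl.
  by move: Nx; lra.
have fL' := fL i.
split; first exact: (ae_derivable cf fB fL').
  by have [] := derive_line_integral cf fB fL'.
by have [] := derive_line_integral cf fB fL'.
Qed.

Lemma delta_norm_le i : `|e i| <= 1.
Proof.
apply: row_norm_le => // k; rewrite !mxE eqxx /=.
by case: eqP; rewrite ?normr1 ?normr0.
Qed.

Lemma cutoff_lipschitzD A f g : cutoff_lipschitz A f -> cutoff_lipschitz A g ->
  cutoff_lipschitz A (fun x => f x + g x).
Proof.
move=> [cf [L fL] [M fM] f0] [cg [L' gL] [M' gM] g0]; split.
- by move=> x; apply: (cvgD (F := nbhs x)); [exact: cf|exact: cg].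
- exists (L + L') => i x s t; rewrite opprD addrACA mulrDl.
  by rewrite (le_trans (ler_normD _ _))// lerD.
- by exists (M + M') => x; rewrite (le_trans (ler_normD _ _))// lerD.
- by move=> x nAx; rewrite f0// g0// addr0.
Qed.

Lemma cutoff_lipschitz0 A : cutoff_lipschitz A (fun=> 0).
Proof.
split.
- by move=> x; exact: cst_continuous.
- by exists 0 => i x s t; rewrite subrr normr0 mul0r.
- by exists 0 => x; rewrite normr0.
- by [].
Qed.

Lemma cutoff_lipschitz_sum A (I : Type) (r : seq I) (f : I -> 'rV[R]_n -> R) :
  (forall k, cutoff_lipschitz A (f k)) ->
  cutoff_lipschitz A (fun x => \sum_(k <- r) f k x).
Proof.
move=> fk; elim: r => [|k r IH].
  rewrite (_ : (fun _ => _) = fun=> 0); first exact: cutoff_lipschitz0.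
  by apply/funext => x; rewrite big_nil.
rewrite (_ : (fun _ => _) = fun x => f k x + \sum_(j <- r) f j x).
  exact: cutoff_lipschitzD.
by apply/funext => x; rewrite big_cons.
Qed.

(** The factor [c] is controlled on [A] only, like the coefficients of the
  vector fields; outside [A] the product vanishes.  When a segment leaves [A]
  the estimate uses that f vanishes at one of its ends. *)
Lemma cutoff_lipschitzM A f c K N : open A ->
  (forall a b, A a -> A b -> `|c a - c b| <= K * `|a - b|) ->
  (forall a, A a -> `|c a| <= N) ->
  cutoff_lipschitz A f -> cutoff_lipschitz A (fun x => f x * c x).
Proof.
move=> oA cK cN [cf [L fL] [M fM] f0].
have fcM x : `|f x * c x| <= `|N| * `|f x|.
  have [Ax|nAx] := pselect (A x); last by rewrite f0// mul0r normr0 mulr0.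
  by rewrite normrM mulrC ler_wpM2r// (le_trans (cN _ Ax))// ler_norm.
have M0 : 0 <= M by exact: le_trans (fM 0).
split.
- move=> x; have [Ax|nAx] := pselect (A x).
    apply: (cvgM (F := nbhs x)); first exact: cf.
    apply/(cvgrPdist_le (F := nbhs x)) => /= r r0.
    have K0 : 0 < `|K| + 1 by rewrite ltr_wpDl.
    have nA : \forall y \near x, A y by apply: open_nbhs_nbhs.
    have : \forall y \near x, `|x - y| <= r / (`|K| + 1).
      apply: (cvgr_dist_le (F := nbhs x)); first exact: cvg_id.
      by rewrite divr_gt0.
    move: nA; apply: filterS2 => y Ay xy; rewrite (le_trans (cK _ _ Ax Ay))//.
    rewrite (@le_trans _ _ ((`|K| + 1) * `|x - y|))//.
      by rewrite ler_wpM2r// (le_trans (ler_norm K))// lerDl.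
    by rewrite mulrC -ler_pdivlMr.
  apply/(cvgrPdist_le (F := nbhs x)) => /= r r0.
  have N0 : 0 < `|N| + 1 by rewrite ltr_wpDl.
  have : \forall y \near x, `|f x - f y| <= r / (`|N| + 1).
    apply: (cvgr_dist_le (F := nbhs x)); first exact: cf.
    by rewrite divr_gt0.
  apply: filterS => y; rewrite f0// mul0r !sub0r !normrN => fy.
  rewrite (le_trans (fcM y))// (@le_trans _ _ ((`|N| + 1) * `|f y|))//.
    by rewrite ler_wpM2r// lerDl.
  by rewrite mulrC -ler_pdivlMr.
- exists (`|L| * `|N| + `|M| * `|K|) => i x s t.
  set a := x + _; set b := x + _.
  have ab : `|a - b| <= `|s - t|.
    rewrite /a /b opprD addrACA subrr add0r -scalerBl normrZ.
    by rewrite ler_piMr// delta_norm_le.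
  have fab : `|f a - f b| <= `|L| * `|s - t|.
    by rewrite (le_trans (fL i x s t))// ler_wpM2r// ler_norm.
  have side a' b' : ~ A b' -> `|f a' - f b'| <= `|L| * `|s - t| ->
      `|f a' * c a' - f b' * c b'| <= (`|L| * `|N| + `|M| * `|K|) * `|s - t|.
    move=> nAb; rewrite (f0 b')// mul0r !subr0 => fa.
    rewrite (le_trans (fcM _))// mulrDl -[leLHS]addr0 lerD// ?mulr_ge0//.
    by rewrite mulrAC mulrC ler_wpM2r.
  have [Ab|nAb] := pselect (A b); last exact: side.
  have [Aa|nAa] := pselect (A a); last first.
    by rewrite distrC; apply: side => //; rewrite distrC.
  have -> : f a * c a - f b * c b = (f a - f b) * c a + f b * (c a - c b) by ring.
  rewrite (le_trans (ler_normD _ _))// [leRHS]mulrDl lerD// normrM.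
    rewrite mulrAC; apply: ler_pM => //.
    by rewrite (le_trans (cN _ Aa))// ler_norm.
  rewrite -mulrA; apply: ler_pM => //; first by rewrite (ger0_norm M0).
  rewrite (le_trans (cK _ _ Aa Ab))// (@le_trans _ _ (`|K| * `|a - b|))//.
    by rewrite ler_wpM2r// ler_norm.
  by rewrite ler_wpM2l.
- by exists (`|N| * M) => x; rewrite (le_trans (fcM x))// ler_wpM2l.
- by move=> x nAx; rewrite f0// mul0r.
Qed.

Lemma lipschitz_on_bounds A (f : 'rV[R]_n -> R) : bounded_set A ->
  [lipschitz f x | x in A] ->
  exists K N, (forall a b, A a -> A b -> `|f a - f b| <= K * `|a - b|) /\
    (forall a, A a -> `|f a| <= N).
Proof.
move=> [B [Br AB]] [K0 [K0r fK]].
pose K := `|K0| + 1.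
have K0K : K0 < K by rewrite (le_lt_trans (ler_norm K0))// ltrDl.
have fKK a b : A a -> A b -> `|f a - f b| <= K * `|a - b|.
  by move=> Aa Ab; apply: (fK K K0K (a, b)).
have [[x0 Ax0]|nA] := pselect (exists x, A x); last first.
  exists K, 0; split => // a Aa; exfalso; apply: nA; exists a; exact: Aa.
have B1 a : A a -> `|a| <= B + 1 by apply: AB; rewrite ltrDl.
exists K, (`|f x0| + K * (2 * (B + 1))); split => // a Aa.
rewrite -[f a](subrK (f x0)) addrC (le_trans (ler_normD _ _))// lerD2l.
rewrite (le_trans (fKK _ _ Aa Ax0))// ler_wpM2l ?addr_ge0//.
rewrite (le_trans (ler_normB _ _))// mulr_natl mulr2n.
by rewrite lerD ?B1.
Qed.

End cutoff_lipschitz.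

(** * Test functions and test fields *)

Section test_fields.
Context {R : realType} {m n : nat}.
Local Notation mu := (@leb R n).
Local Notation e i := (delta_mx 0 i : 'rV[R]_n).

Lemma compact_bounded_image (K : set 'rV[R]_n) (f : 'rV[R]_n -> R) :
  compact K -> continuous f -> exists M, forall x, K x -> `|f x| <= M.
Proof.
move=> cK cf.
have : compact (f @` K).
  by apply: continuous_compact => //; apply: continuous_subspaceT; exact: cf.
move=> /compact_bounded [M [Mr fM]]; exists (M + 1) => x Kx.
by apply: (fM (M + 1)); [rewrite ltrDl|exists x].
Qed.

Lemma compact_closed_row (K : set 'rV[R]_n) : compact K -> closed K.
Proof. by move=> cK; apply: compact_closed => //; exact: norm_hausdorff. Qed.

(** The derivatives are continuous with compact support, hence bounded; the
  mean value theorem on lines gives the Lipschitz bound. *)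
Lemma C1_cutoff_lipschitz A K (f : 'rV[R]_n -> R) : compact K -> K `<=` A ->
  (forall x, ~ K x -> f x = 0) -> continuous f ->
  (forall i x, derivable f x (e i)) -> (forall i, continuous ('D_(e i) f)) ->
  cutoff_lipschitz A f.
Proof.
move=> cK KA f0 cf df cDf.
have oK : open (~` K) by apply: closed_openC; exact: compact_closed_row.
have D0 i x : ~ K x -> 'D_(e i) f x = 0.
  move=> nKx; have : is_derive x (e i) f 0.
    apply: (@near_eq_is_derive _ _ _ (cst 0)).
    have : nbhs x (~` K) by apply: open_nbhs_nbhs.
    by apply: filterS => y nKy; rewrite f0.
  by move=> dx; rewrite derive_val.
have [M fM] := compact_bounded_image cK cf.
have HD i := compact_bounded_image cK (cDf i).
have [N DN] := choice HD.
pose L := \sum_i `|N i|.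
have L0 : 0 <= L by apply: sumr_ge0.
have DL i x : `|'D_(e i) f x| <= L.
  have [Kx|nKx] := pselect (K x); last by rewrite D0// normr0.
  rewrite (le_trans (DN i x Kx))// (le_trans (ler_norm _))//.
  by rewrite /L (bigD1 i)//= lerDl sumr_ge0.
split => //.
- exists L => i x.
  have H s t : s <= t -> `|f (x + s *: e i) - f (x + t *: e i)| <= L * `|s - t|.
    move=> st; rewrite distrC (distrC s).
    have dg r : is_derive r (1 : R) (fun u : R => f (x + u *: e i)) ('D_(e i) f (x + r *: e i)).
      apply: DeriveDef; first exact: (proj2 (line_derivable f i x r) (df i _)).
      by rewrite -derive1E; exact: line_derive.
    have [|c _] := @MVT_segment R (fun u : R => f (x + u *: e i))
       (fun u : R => 'D_(e i) f (x + u *: e i)) s t st (fun r _ => dg r).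
      apply: continuous_subspaceT => r.
      by apply: differentiable_continuous; apply/derivable1_diffP; exact: (@ex_derive _ _ _ _ _ _ _ (dg r)).
    by move=> ->; rewrite normrM ler_wpM2r.
  move=> s t; have [st|ts] := leP s t; first exact: H.
  by rewrite distrC (distrC s); apply: H; exact: ltW.
- exists `|M| => x; have [Kx|nKx] := pselect (K x); last by rewrite f0// normr0.
  by rewrite (le_trans (fM x Kx))// ler_norm.
- by move=> x nAx; apply: f0 => Kx; apply: nAx; exact: KA.
Qed.

Lemma coord_comp_continuous (g : 'rV[R]_n -> 'rV[R]_m) j :
  continuous g -> continuous (fun x => g x 0 j).
Proof.
move=> cg x; apply: (@continuous_comp _ _ _ g (fun v : 'rV[R]_m => v 0 j)); first exact: cg.
exact: coord_continuous.
Qed.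

Lemma test_fun_cutoff Omega (phi : 'rV[R]_n -> 'rV[R]_m) j :
  test_fun Omega phi -> cutoff_lipschitz Omega (fun x => phi x 0 j).
Proof.
move=> [/(_ 1%N)[cphi dphi] [K [cK KO phi0]]].
apply: (C1_cutoff_lipschitz cK KO).
- by move=> x nKx; rewrite phi0// mxE.
- exact: coord_comp_continuous.
- by move=> i x; have [/(_ x)/derivable_mxP/(_ 0 j)] := dphi i.
- move=> i x; have [dp [cdp _]] := dphi i.
  rewrite (_ : 'D_(e i) (fun x => phi x 0 j) = (fun x => ('D_(e i) phi x) 0 j)).
    exact: (coord_comp_continuous cdp).
  by apply/funext => y; rewrite derive_mx// mxE.
Qed.

(** The reason for the class of functions above: phi C has merely
  Lipschitz coefficients. *)
Lemma test_field_cutoff Omega (C : 'rV[R]_n -> 'M[R]_(m, n)) phi i :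
  open Omega -> bounded_set Omega ->
  (forall j i, [lipschitz C x j i | x in Omega]) -> test_fun Omega phi ->
  cutoff_lipschitz Omega (fun y => (phi y *m C y) 0 i).
Proof.
move=> oO bO lC tphi.
rewrite (_ : (fun _ => _) = fun y => \sum_j (phi y 0 j * C y j i)); last first.
  by apply/funext => y; rewrite mxE.
apply: cutoff_lipschitz_sum => j.
have [K [N [CK CN]]] := lipschitz_on_bounds bO (lC j i).
apply: (@cutoff_lipschitzM _ _ _ (fun y => phi y 0 j) _ _ _ oO CK CN).
exact: test_fun_cutoff.
Qed.

End test_fields.

(** * The X-gradient of affine functions *)

Section rows_measurability.
Context {R : realType} {n : nat}.
Local Notation mu := (@leb R n).

Lemma open_continuous_measurable_row (D : set 'rV[R]_n) (f : 'rV[R]_n -> R) :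
  open D -> (forall x, D x -> {for x, continuous f}) -> measurable_fun D f.
Proof.
move=> oD cf mD; apply: (measurability _ (RGenOInfty.measurableE R)) => // _ [_ [x ->] <-].
apply: open_measurable_row; rewrite openE => y [Dy fy].
have H1 : \forall z \near y, D z by apply: open_nbhs_nbhs.
have H2 : \forall z \near y, `]x, +oo[%classic (f z).
  by apply: (cf y Dy); apply: open_nbhs_nbhs; split => //; exact: interval_open.
by move: H1 H2; apply: filterS2 => z.
Qed.

Lemma continuous_measurable_row (f : 'rV[R]_n -> R) :
  continuous f -> measurable_fun [set: 'rV[R]_n] f.
Proof.
by move=> cf; apply: open_continuous_measurable_row => [|x _];
  [exact: openT|exact: cf].
Qed.

Lemma lipschitz_on_continuous (A : set 'rV[R]_n) (f : 'rV[R]_n -> R) K x :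
  open A -> (forall a b, A a -> A b -> `|f a - f b| <= K * `|a - b|) ->
  A x -> {for x, continuous f}.
Proof.
move=> oA fK Ax; apply/(cvgrPdist_le (F := nbhs x)) => /= r r0.
have K0 : 0 < `|K| + 1 by rewrite ltr_wpDl.
have nA : \forall y \near x, A y by apply: open_nbhs_nbhs.
have : \forall y \near x, `|x - y| <= r / (`|K| + 1).
  apply: (cvgr_dist_le (F := nbhs x)); first exact: cvg_id.
  by rewrite divr_gt0.
move: nA; apply: filterS2 => y Ay xy; rewrite (le_trans (fK _ _ Ax Ay))//.
rewrite (@le_trans _ _ ((`|K| + 1) * `|x - y|))//.
  by rewrite ler_wpM2r// (le_trans (ler_norm K))// lerDl.
by rewrite mulrC -ler_pdivlMr.
Qed.

Lemma ae_measurable_row (D : set 'rV[R]_n) (f g : 'rV[R]_n -> R) :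
  {ae mu, forall x, D x -> f x = g x} -> measurable_fun D f -> measurable_fun D g.
Proof.
move=> fg mf; apply/measurable_EFinP.
apply: (@ae_measurable_fun _ _ _ mu _ D (EFin \o f)).
- exact: measure_is_complete_caratheodory.
- by move: fg; apply: ae_imp => x fg Dx; rewrite /= fg.
- exact/measurable_EFinP.
Qed.

Lemma integrable_support (D K : set 'rV[R]_n) (f : 'rV[R]_n -> R) :
  measurable D -> measurable K -> K `<=` D ->
  (forall x, D x -> ~ K x -> f x = 0) ->
  mu.-integrable K (EFin \o f) <-> mu.-integrable D (EFin \o f).
Proof.
move=> mD mK KD f0.
have E : (EFin \o f) \_ D = (EFin \o f) \_ K.
  apply/funext => x; rewrite !patchE; case: ifPn => [|/negP xD]; rewrite ?inE => //.
    move=> Dx; case: ifPn => // /negP xK; rewrite /= f0//.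
    by move=> Kx; apply: xK; rewrite inE.
  by case: ifPn => //; rewrite inE => /KD Dx; exfalso; apply: xD; rewrite inE.
by rewrite (integrable_mkcond _ mD) (integrable_mkcond _ mK) E.
Qed.

Lemma integral_support (D K : set 'rV[R]_n) (f : 'rV[R]_n -> R) :
  K `<=` D -> (forall x, D x -> ~ K x -> f x = 0) ->
  (\int[mu]_(x in K) (f x)%:E = \int[mu]_(x in D) (f x)%:E)%E.
Proof.
move=> KD f0; rewrite integral_mkcond [RHS]integral_mkcond; congr integral.
apply/funext => x; rewrite !patchE; case: ifPn => [|/negP xK]; rewrite ?inE.
  by move=> Kx; rewrite mem_set//; exact: KD.
case: ifPn => //; rewrite inE => Dx.
by rewrite f0// => Kx; apply: xK; rewrite inE.
Qed.

End rows_measurability.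

Section divergence.
Context {R : realType} {m n : nat}.
Local Notation mu := (@leb R n).
Local Notation e i := (delta_mx 0 i : 'rV[R]_n).
Variables (Omega : set 'rV[R]_n) (C : 'rV[R]_n -> 'M[R]_(m, n)).
Hypotheses (oO : open Omega) (bO : bounded_set Omega).
Hypothesis lC : forall j i, [lipschitz C x j i | x in Omega].

Let field (phi : 'rV[R]_n -> 'rV[R]_m) y := phi y *m C y.

(** At the null set of points where phi C is not differentiable the value
  of the derivative is unspecified, so the bound holds almost everywhere. *)
Lemma divergence_bounded phi : test_fun Omega phi ->
  [/\ measurable_fun [set: 'rV[R]_n] (divergence (field phi)),
      exists M : R, {ae mu, forall x, `|divergence (field phi) x| <= M} &
      exists K, [/\ compact K, K `<=` Omega & forall x, ~ K x -> divergence (field phi) x = 0]].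
Proof.
move=> tphi.
have cH i := test_field_cutoff i oO bO lC tphi.
have dH i := cutoff_lipschitz_derive i bO (cH i).
split.
- apply: (@measurable_sum _ 'rV[R]_n R setT 'I_n (index_enum _)
    (fun i => 'D_(e i) (fun y => field phi y 0 i))) => i.
  have [_ /measurable_int/measurable_EFinP mi _] := dH i.
  exact: mi.
- have HL i : exists L : R, {ae mu, forall x, `|'D_(e i) (fun y => field phi y 0 i) x| <= `|L|}.
    have [_ [L HL] _ _] := cH i; exists L.
    have [+ _ _] := dH i; apply: ae_imp => x.
    by apply: derive_lipschitz_le => s t; exact: HL.
  have [L HL'] := choice HL.
  exists (\sum_i `|L i|).
  have /ae_forall_countable := HL'; apply: ae_imp => x Hx.
  by rewrite (le_trans (ler_norm_sum _ _ _))// ler_sum.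
- have [_ [K [cK KO phi0]]] := tphi; exists K; split => // x nKx.
  rewrite /divergence big1// => i _.
  have dx : is_derive x (e i) (fun y => field phi y 0 i) 0.
    apply: (@near_eq_is_derive _ _ _ (cst 0)).
    have : nbhs x (~` K).
      apply: open_nbhs_nbhs; split => //.
      by apply: closed_openC; exact: compact_closed_row.
    by apply: filterS => y nKy; rewrite /field phi0// mul0mx mxE.
  by rewrite derive_val.
Qed.

Lemma mul_divergence_integrable phi u : test_fun Omega phi -> L1loc Omega u ->
  mu.-integrable Omega (EFin \o (fun x => u x * divergence (field phi) x)).
Proof.
move=> tphi u1; have [mdiv [M divM] [K [cK KO div0]]] := divergence_bounded tphi.
set dv := divergence _ in mdiv divM div0 *.
have mO : measurable Omega by exact: open_measurable_row.
have mK : measurable K by apply: closed_measurable_row; exact: compact_closed_row.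
apply/(integrable_support mO mK KO).
  by move=> x _ nKx; rewrite div0// mulr0.
have uK := u1 K cK KO.
have mu' : measurable_fun K u by have /measurable_int/measurable_EFinP := uK.
pose cl x := if `|dv x| <= `|M| then dv x else 0.
have aecl : {ae mu, forall x, cl x = dv x}.
  by move: divM; apply: ae_imp => x dM; rewrite /cl (le_trans dM)// ler_norm.
have mcl : measurable_fun [set: 'rV[R]_n] cl.
  apply: (@ae_measurable_row _ _ _ dv) => //.
  by move: aecl; apply: ae_imp => x -> _.
have mdK : measurable_fun K dv by exact: measurable_funTS.
apply: (@ae_eq_integrable _ _ _ mu K (EFin \o (fun x => u x * cl x))) => //.
- by apply/measurable_EFinP; exact: measurable_funM.
- by move: aecl; apply: ae_imp => x clx _; rewrite /= clx.
apply: (le_integrable mK _ _ (integrableZl mK `|M| uK)).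
- by apply/measurable_EFinP; apply: measurable_funM => //; exact: measurable_funTS.
- move=> x Kx /=; rewrite lee_fin !normrM normr_id mulrC ler_wpM2r//.
  by rewrite /cl; case: ifP => //; rewrite normr0.
Qed.

Definition affine (c : R) (xi : 'rV[R]_n) (x : 'rV[R]_n) : R :=
  c + \sum_k xi 0 k * x 0 k.

Lemma affineB c xi x y : affine c xi x - affine c xi y = \sum_k xi 0 k * (x - y) 0 k.
Proof.
rewrite /affine opprD addrACA subrr add0r -sumrB.
by apply: eq_bigr => k _; rewrite !mxE mulrBr.
Qed.

Lemma affine_lipschitz c xi x y :
  `|affine c xi x - affine c xi y| <= (\sum_k `|xi 0 k|) * `|x - y|.
Proof.
rewrite affineB (le_trans (ler_norm_sum _ _ _))// mulr_suml ler_sum// => k _.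
by rewrite normrM ler_wpM2l// row_coord_le.
Qed.

Lemma affine_derive c xi x i : is_derive x (e i) (affine c xi) (xi 0 i).
Proof.
have H : (h^-1 *: (affine c xi (h *: e i + x) - affine c xi x)) @[h --> 0^'] --> xi 0 i.
  apply: (@cvg_trans _ ((fun=> xi 0 i) @ 0^')); last exact: cvg_cst.
  apply: near_eq_cvg; near=> h; rewrite affineB addrK.
  rewrite (bigD1 i)//= big1 ?addr0 => [|k ki].
    rewrite !mxE !eqxx mulr1 -[_ *: _]/(h^-1 * _) mulrCA mulVf ?mulr1//.
    by near: h; exact: nbhs_dnbhs_neq.
  by rewrite !mxE eqxx (negbTE ki) !mulr0.
by apply: DeriveDef; [apply/cvg_ex; exists (xi 0 i)|apply/cvg_lim].
Unshelve. all: by end_near. Qed.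

Lemma bounded_L1loc (u : 'rV[R]_n -> R) N : measurable_fun Omega u ->
  (forall x, Omega x -> `|u x| <= N) -> L1loc Omega u.
Proof.
move=> mu_ uN K cK KO.
have mK : measurable K by apply: closed_measurable_row; exact: compact_closed_row.
apply: (measurable_bounded_integrable mK).
- by apply: leb_bounded => //; exact: compact_bounded.
- by apply: measurable_funS mu_ => //; exact: open_measurable_row.
- exists N; split; first exact: num_real.
  by move=> r Nr x Kx; exact: (le_trans (uN x (KO x Kx)) (ltW Nr)).
Qed.

Lemma coef_measurable j i : measurable_fun Omega (fun x => C x j i).
Proof.
have [K [N [CK _]]] := lipschitz_on_bounds bO (lC j i).
apply: open_continuous_measurable_row => // x Ox.
exact: (lipschitz_on_continuous oO CK).
Qed.

Lemma affine_Xgrad_L1loc (xi : 'rV[R]_n) (j : 'I_m) :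
  exists N : R, measurable_fun Omega (fun x => (xi *m (C x)^T) 0 j) /\
   forall x, Omega x -> `|(xi *m (C x)^T) 0 j| <= N.
Proof.
have HN i : exists N, forall x, Omega x -> `|C x j i| <= N.
  by have [K [N [_ CN]]] := lipschitz_on_bounds bO (lC j i); exists N.
have [N CN] := choice HN.
exists (\sum_i `|xi 0 i| * N i); split.
  rewrite (_ : (fun _ => _) = fun x => \sum_i xi 0 i * C x j i).
    apply: measurable_sum => i; apply: measurable_funM; first exact: measurable_cst.
    exact: coef_measurable.
  by apply/funext => x; rewrite mxE; apply: eq_bigr => i _; rewrite mxE.
move=> x Ox; rewrite mxE (le_trans (ler_norm_sum _ _ _))// ler_sum// => i _.
by rewrite mxE normrM ler_wpM2l// CN.
Qed.

Lemma affine_bounded c xi : exists N : R, forall x, Omega x -> `|affine c xi x| <= N.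
Proof.
have [B [Br OB]] := bO.
exists (`|c| + (\sum_k `|xi 0 k|) * (B + 1)) => x Ox.
rewrite (le_trans (ler_normD _ _))// lerD2l (le_trans (ler_norm_sum _ _ _))//.
rewrite mulr_suml ler_sum// => k _; rewrite normrM ler_wpM2l//.
by rewrite (le_trans (row_coord_le _ _))// (OB (B + 1))// ltrDl.
Qed.

Lemma affine_measurable c xi : measurable_fun [set: 'rV[R]_n] (affine c xi).
Proof.
apply: continuous_measurable_row => x.
apply: (@lipschitz_on_continuous _ _ setT _ (\sum_k `|xi 0 k|)) => //.
  exact: openT.
by move=> a b _ _; exact: affine_lipschitz.
Qed.

(** Integration by parts: the derivatives of the Lipschitz functions
  (phi C)_i u have integral zero, and the product rule holds almost
  everywhere. *)
Lemma is_Xgrad_affine c xi : is_Xgrad Omega C (affine c xi) (fun x => xi *m (C x)^T).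
Proof.
have mO : measurable Omega by exact: open_measurable_row.
split=> [j|phi tphi].
  have [N [mg gN]] := affine_Xgrad_L1loc xi j; exact: bounded_L1loc gN.
have [N uN] := affine_bounded c xi.
have uL1 : L1loc Omega (affine c xi).
  by apply: bounded_L1loc uN; apply: measurable_funTS; exact: affine_measurable.
have i2 := mul_divergence_integrable tphi uL1.
have cH i := test_field_cutoff i oO bO lC tphi.
have dH i := cutoff_lipschitz_derive i bO (cH i).
have cHu i : cutoff_lipschitz Omega (fun x => field phi x 0 i * affine c xi x).
  apply: (cutoff_lipschitzM oO _ uN (cH i)) => a b _ _.
  exact: affine_lipschitz.
have dHu i := cutoff_lipschitz_derive i bO (cHu i).
pose P x := \sum_i xi 0 i * field phi x 0 i.
have PE x : \sum_(j < m) (xi *m (C x)^T) 0 j * phi x 0 j = P x.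
  rewrite /P /field; under eq_bigr do rewrite mxE mulr_suml.
  rewrite exchange_big /=; apply: eq_bigr => i _; rewrite mxE mulr_sumr.
  by apply: eq_bigr => j _; rewrite !mxE; ring.
have P0 x : ~ Omega x -> P x = 0.
  move=> nOx; rewrite /P big1// => i _; have [_ _ _ ->] := cH i => //.
  by rewrite mulr0.
have mP : measurable_fun [set: 'rV[R]_n] P.
  apply: measurable_sum => i; apply: measurable_funM; first exact: measurable_cst.
  by have [cf _ _ _] := cH i; exact: continuous_measurable_row.
have iP : mu.-integrable Omega (EFin \o P).
  apply: (measurable_bounded_integrable mO); first exact: leb_bounded.
    exact: measurable_funTS.
  have HM i : exists M, forall x, `|field phi x 0 i| <= M by have [] := cH i.
  have [M HM'] := choice HM.
  exists (\sum_i `|xi 0 i| * M i); split; first exact: num_real.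
  move=> r Mr x _ /=; rewrite (le_trans _ (ltW Mr))// (le_trans (ler_norm_sum _ _ _))//.
  by rewrite ler_sum// => i _; rewrite normrM ler_wpM2l.
rewrite [LHS](_ : _ = \int[mu]_(x in Omega) P x); last first.
  by apply: eq_Rintegral => x _; rewrite PE.
apply/eqP; rewrite -subr_eq0 opprK -RintegralD//.
rewrite /Rintegral (integral_support (D := setT))//; last first.
  move=> x _ nOx; rewrite P0// add0r.
  have [_ _ [K [_ KO div0]]] := divergence_bounded tphi.
  by rewrite div0 ?mulr0// => /KO.
rewrite (_ : (\int[mu]_(x in setT) _)%E = (\int[mu]_x (\sum_i 'D_(e i) (fun y => field phi y 0 i * affine c xi y) x)%:E)%E).
  under eq_integral do rewrite -sumEFin.
  rewrite integral_sum//; last by move=> i; have [] := dHu i.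
  by rewrite big1// => i _; have [_ _ ->] := dHu i.
have mdiv : measurable_fun [set: 'rV[R]_n] (divergence (field phi)) by have [] := divergence_bounded tphi.
apply: ae_eq_integral; first exact: measurableT.
- apply/measurable_EFinP; apply: (measurable_funD mP).
  exact: (measurable_funM (affine_measurable c xi) mdiv).
- apply/measurable_EFinP; apply: measurable_sum => i.
  by have [_ /measurable_int/measurable_EFinP] := dHu i.
- have aeH : {ae mu, forall x, forall i, derivable (fun y => field phi y 0 i) x (e i)}.
    by apply: ae_forall_countable => i; have [] := dH i.
  move: aeH; apply: ae_imp => x Hx _; congr EFin.
  rewrite /divergence mulr_sumr /P -big_split/=; apply: eq_bigr => i _.
  have dHi : is_derive x (e i) (fun y => field phi y 0 i) ('D_(e i) (fun y => field phi y 0 i) x).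
    by apply: DeriveDef; [exact: Hx|].
  have dui := affine_derive c xi x i.
  have := is_deriveM dHi dui => dM.
  rewrite [RHS](@derive_val _ _ _ _ _ _ _ dM).
  by rewrite -![_ *: _]/(_ * _) addrC (mulrC (xi 0 i)) addrC.
Qed.

End divergence.

(** * The flat exponential *)

Section flat_exponential.
Context {R : realType}.

(** p(1/t) exp(-1/t), extended by zero: with polynomials p this family is closed
  under differentiation, which makes smoothness an induction. *)
Definition flat (p : {poly R}) (t : R) : R :=
  if 0 < t then p.[t^-1] * expR (- t^-1) else 0.

(** exp(s) dominates s^(d+2)/(d+2)!, where d bounds the degree of p. *)
Lemma flat_small (p : {poly R}) : exists c, forall t, 0 < t -> t <= 1 ->
  `|flat p t| <= c * t ^+ 2.
Proof.
pose d := size p; pose S := \sum_(i < d) `|p`_i|.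
exists (S * d.+2`!%:R) => t t0 t1; rewrite /flat t0.
have s1 : 1 <= t^-1 by rewrite invf_ge1.
have s0 : 0 <= t^-1 by rewrite (le_trans ler01).
have pS : `|p.[t^-1]| <= S * t^-1 ^+ d.
  rewrite horner_coef (le_trans (ler_norm_sum _ _ _))// mulr_suml ler_sum// => i _.
  rewrite normrM ler_wpM2l// normrX ger0_norm//.
  by apply: ler_weXn2l => //; exact: ltnW.
have S0 : 0 <= S by apply: sumr_ge0.
have es : expR (- t^-1) <= d.+2`!%:R * (t^-1 ^+ d.+2)^-1.
  rewrite expRN -[leRHS]invrK lef_pV2 ?posrE ?expR_gt0 ?invr_gt0//; last first.
    by rewrite mulr_gt0 ?ltr0n ?fact_gt0// invr_gt0 exprn_gt0// invr_gt0.
  rewrite invfM invrK mulrC (le_trans _ (expR_ge1Dxn d.+1 s0))//.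
  by rewrite lerDr.
rewrite normrM (ger0_norm (expR_ge0 _)).
apply: (@le_trans _ _ (S * t^-1 ^+ d * (d.+2`!%:R * (t^-1 ^+ d.+2)^-1))).
  by apply: ler_pM => //; exact: expR_ge0.
rewrite le_eqVlt; apply/orP; left; apply/eqP.
rewrite -addn2 exprD !exprVn; field.
by rewrite gt_eqF//= expf_neq0// gt_eqF.
Qed.

(** At t > 0 the derivative of p(1/t) exp(-1/t) is (p - p')(1/t) t^-2
  exp(-1/t); at 0 it is zero by the quadratic bound. *)
Lemma flat_derive (p : {poly R}) (t : R) :
  is_derive t (1 : R) (flat p) (flat ((p - deriv p) * 'X^2) t).
Proof.
case: (ltgtP t 0) => [t0|t0|->].
- have -> : flat ((p - deriv p) * 'X^2) t = 0 by rewrite /flat ltNge (ltW t0).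
  apply: (@near_eq_is_derive _ _ _ (cst 0)).
  near=> s; rewrite /flat /cst ltNge ifF//; apply/negbF/ltW; near: s.
  exact: lt_nbhsl.
- have H : is_derive t (1 : R) ((horner p \o (fun s => s^-1)) * (expR \o (fun s => - s^-1)))
       (flat ((p - deriv p) * 'X^2) t).
    have tn0 : t != 0 by rewrite gt_eqF.
    have dV : is_derive t (1 : R) (fun s : R => s^-1) (- t ^- 2 *: 1).
      exact: (is_deriveV tn0 (is_derive_id t 1)).
    have dNV : is_derive t (1 : R) (fun s : R => - s^-1) (- (- t ^- 2 *: 1)).
      exact: (is_deriveN dV).
    have d1 := @is_derive1_comp R (horner p) _ t _ _ (is_derive_poly p (t^-1)) dV.
    have d2 := @is_derive1_comp R expR _ t _ _ (is_derive_expR (- t^-1)) dNV.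
    have dM := is_deriveM d1 d2.
    apply: (@is_derive_eq _ _ _ _ _ _ _ _ dM).
    rewrite /flat t0 !hornerE /= -![_ *: _]/(_ * _).
    by field.
  apply: (@near_eq_is_derive _ _ _ ((horner p \o (fun s => s^-1)) * (expR \o (fun s => - s^-1)))).
  near=> s; rewrite /flat ifT//; near: s; exact: lt_nbhsr.
- have -> : flat ((p - deriv p) * 'X^2) 0 = 0 by rewrite /flat ltxx.
  have [c cp] := flat_small p.
  have H : (h^-1 *: (flat p (h *: 1 + 0) - flat p 0)) @[h --> 0^'] --> (0 : R).
    apply/cvgrPdist_le => /= r r0; near=> h.
    rewrite addr0 -[_ *: 1]/(h * 1) mulr1 {2}/flat ltxx subr0 sub0r normrN.
    have [h0|h0] := leP h 0.
      by rewrite /flat ltNge h0 scaler0 normr0 ltW.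
    have h1 : h <= 1.
      by rewrite -(ger0_norm (ltW h0)); near: h; apply: dnbhs0_le.
    rewrite normrZ normfV (gtr0_norm h0) ler_pdivrMl// (le_trans (cp h h0 h1))//.
    rewrite expr2 mulrA mulrC ler_wpM2l ?(ltW h0)//.
    rewrite (@le_trans _ _ ((`|c| + 1) * h))//.
      by rewrite ler_wpM2r ?(ltW h0)// (le_trans (ler_norm c))// lerDl.
    rewrite mulrC -ler_pdivlMr ?ltr_wpDl// -(ger0_norm (ltW h0)); near: h.
    by apply: dnbhs0_le; rewrite divr_gt0// ltr_wpDl.
  by apply: DeriveDef; [apply/cvg_ex; exists 0|apply/cvg_lim].
Unshelve. all: by end_near. Qed.

Lemma flat1_ge0 t : 0 <= flat 1 t.
Proof. by rewrite /flat; case: ifP => // _; rewrite hornerC mul1r expR_ge0. Qed.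

Lemma flat1_le1 t : flat 1 t <= 1.
Proof.
rewrite /flat; case: ifP => // t0; rewrite hornerC mul1r expR_le1.
by rewrite oppr_le0 invr_ge0 ltW.
Qed.

Lemma flat1_cvg t : 0 < t -> flat 1 (k.+1%:R * t) @[k --> \oo] --> (1 : R).
Proof.
move=> t0.
have -> : (fun k : nat => flat 1 (k.+1%:R * t)) = (fun k : nat => expR (- (k.+1%:R^-1 * t^-1))).
  by apply/funext => k; rewrite /flat mulr_gt0// hornerC mul1r invfM.
rewrite -[X in _ --> X]expR0.
apply: (cvg_comp (fun k : nat => - (k.+1%:R^-1 * t^-1)) expR); last exact: continuous_expR.
rewrite -oppr0 -(mul0r t^-1); apply: cvgN; apply: cvgMl; exact: cvg_harmonic.
Qed.

End flat_exponential.

(** * Smooth bumps on boxes *)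

Section smooth_bumps.
Context {R : realType} {m n : nat}.
Local Notation mu := (@leb R n).
Local Notation e i := (delta_mx 0 i : 'rV[R]_n).

(** The closure of one-variable flat functions under sums and products.  It is
  stable under partial derivatives, so all its members are smooth. *)
Inductive flat_algebra : ('rV[R]_n -> R) -> Prop :=
| flat_algebra_atom i p a b : flat_algebra (fun x => flat p (a * x 0 i + b))
| flat_algebra_cst c : flat_algebra (fun=> c)
| flat_algebraD f g : flat_algebra f -> flat_algebra g ->
    flat_algebra (fun x => f x + g x)
| flat_algebraM f g : flat_algebra f -> flat_algebra g ->
    flat_algebra (fun x => f x * g x).

Lemma flat_continuous p : continuous (@flat R p).
Proof.
move=> t; apply: differentiable_continuous; apply/derivable1_diffP.
exact: (@ex_derive _ _ _ _ _ _ _ (flat_derive p t)).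
Qed.

Lemma flat_algebra_continuous f : flat_algebra f -> continuous f.
Proof.
elim=> [i p a b|c|{}f g _ cf _ cg|{}f g _ cf _ cg] x.
- apply: (@continuous_comp _ _ _ (fun x : 'rV[R]_n => a * x 0 i + b) (flat p)).
    apply: (cvgD (F := nbhs x)); last exact: cst_continuous.
    apply: (cvgMr (F := nbhs x)); exact: coord_continuous.
  exact: flat_continuous.
- exact: cst_continuous.
- by apply: (cvgD (F := nbhs x)); [exact: cf|exact: cg].
- by apply: (cvgM (F := nbhs x)); [exact: cf|exact: cg].
Qed.

Lemma flat_algebra_derive f k : flat_algebra f ->
  exists df, flat_algebra df /\ forall x, is_derive x (e k) f (df x).
Proof.
elim=> [i p a b|c|{}f g _ [df [Hf dfE]] Hg' [dg [Hg dgE]]|{}f g Hff [df [Hf dfE]] Hgg [dg [Hg dgE]]].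
- exists (fun x => (a * (i == k)%:R) * flat ((p - deriv p) * 'X^2) (a * x 0 i + b)); split.
    by apply: flat_algebraM; [exact: flat_algebra_cst|exact: flat_algebra_atom].
  move=> x; pose G (x : 'rV[R]_n) := flat p (a * x 0 i + b).
  have E0 : x + 0 *: e k = x by rewrite scale0r addr0.
  have E : (fun t : R => G (x + t *: e k)) = (fun t : R => flat p (a * (x 0 i + (i == k)%:R * t) + b)).
    by apply/funext => t; rewrite /G !mxE eqxx /= [t * _]mulrC.
  have dt : is_derive (0 : R) (1 : R) (fun t : R => G (x + t *: e k))
     (a * (i == k)%:R * flat ((p - deriv p) * 'X^2) (a * x 0 i + b)).
    rewrite E.
    have d1 : is_derive (0 : R) (1 : R) (fun t : R => a * (x 0 i + (i == k)%:R * t) + b) (a * (i == k)%:R).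
      have := is_deriveD (is_deriveZ a (is_deriveD (is_derive_cst (x 0 i) (0:R) 1) (is_deriveZ (i == k)%:R (is_derive_id (0 : R) 1)))) (is_derive_cst b (0 : R) 1).
      move=> dd; apply: (is_derive_eq dd).
      by rewrite add0r addr0 -![_ *: _]/(_ * _) mulr1.
    have d2 := @is_derive1_comp R (flat p) _ 0 _ _ (flat_derive p _) d1.
    apply: (is_derive_eq d2).
    by rewrite mulr0 addr0 mulrC.
  apply: DeriveDef.
    by rewrite -E0; apply: (proj1 (line_derivable G k x 0)); exact: ex_derive.
  have := line_derive G k x 0; rewrite E0 => <-; rewrite derive1E.
  exact: derive_val.
- exists (fun=> 0); split; first exact: flat_algebra_cst.
  by move=> x; exact: is_derive_cst.
- exists (fun x => df x + dg x); split; first exact: flat_algebraD.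
  by move=> x; exact: (is_deriveD (dfE x) (dgE x)).
- exists (fun x => f x * dg x + g x * df x); split.
    by apply: flat_algebraD; exact: flat_algebraM.
  by move=> x; exact: (is_deriveM (dfE x) (dgE x)).
Qed.

Lemma flat_algebra_smooth f (j : 'I_m) : flat_algebra f ->
  smooth (fun x => f x *: (delta_mx 0 j : 'rV[R]_m)).
Proof.
have cont g : flat_algebra g -> continuous (fun x => g x *: (delta_mx 0 j : 'rV[R]_m)).
  move=> Hg x; apply: (cvgZr_tmp (F := nbhs x)).
  exact: (flat_algebra_continuous Hg).
move=> Hf k; elim: k f Hf => [|k IH] f Hf; first by split => //; exact: cont.
split; first exact: cont.
move=> i; have [df [Hdf dfE]] := flat_algebra_derive i Hf.
have dd x i' j' : is_derive x (e i) (fun y => (f y *: (delta_mx 0 j : 'rV[R]_m)) i' j')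
    (df x * (delta_mx 0 j : 'rV[R]_m) i' j').
  have E : (fun y => (f y *: (delta_mx 0 j : 'rV[R]_m)) i' j') = (fun y => f y * (delta_mx 0 j : 'rV[R]_m) i' j').
    by apply/funext => y; rewrite mxE.
  rewrite E.
  have dM := is_deriveM (dfE x) (is_derive_cst ((delta_mx 0 j : 'rV[R]_m) i' j') x (e i)).
  by apply: (is_derive_eq dM); rewrite scaler0 add0r -[_ *: _]/(_ * _) mulrC.
have dv x : derivable (fun y => f y *: (delta_mx 0 j : 'rV[R]_m)) x (e i).
  by apply/derivable_mxP => i' j'; exact: (@ex_derive _ _ _ _ _ _ _ (dd x i' j')).
split=> //.
rewrite (_ : 'D_(e i) _ = (fun x => df x *: (delta_mx 0 j : 'rV[R]_m))); first exact: IH.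
apply/funext => x; rewrite derive_mx//; apply/matrixP => i' j'.
rewrite mxE [RHS]mxE; exact: (@derive_val _ _ _ _ _ _ _ (dd x i' j')).
Qed.

Lemma flat_algebra_prod (I : Type) (r : seq I) (f : I -> 'rV[R]_n -> R) :
  (forall k, flat_algebra (f k)) -> flat_algebra (fun x => \prod_(k <- r) f k x).
Proof.
move=> fk; elim: r => [|k r IH].
  rewrite (_ : (fun _ => _) = fun=> 1); first exact: flat_algebra_cst.
  by apply/funext => x; rewrite big_nil.
rewrite (_ : (fun _ => _) = fun x => f k x * \prod_(j <- r) f j x).
  exact: flat_algebraM.
by apply/funext => x; rewrite big_cons.
Qed.

(** The scaling by k+1 sends each factor to 1 inside the box and keeps it zero
  outside, so that these functions converge to the indicator of the box. *)
Definition box_bump (a b : 'rV[R]_n) (k : nat) (x : 'rV[R]_n) : R :=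
  \prod_i (flat 1 (k.+1%:R * (x 0 i - a 0 i)) * flat 1 (k.+1%:R * (b 0 i - x 0 i))).

Lemma flat_algebra_box_bump a b k : flat_algebra (box_bump a b k).
Proof.
apply: flat_algebra_prod => i; apply: flat_algebraM.
  rewrite (_ : (fun _ => _) = fun x : 'rV[R]_n => flat 1 (k.+1%:R * x 0 i + - (k.+1%:R * a 0 i))).
    exact: flat_algebra_atom.
  by apply/funext => x; rewrite mulrBr.
rewrite (_ : (fun _ => _) = fun x : 'rV[R]_n => flat 1 (- k.+1%:R * x 0 i + (k.+1%:R * b 0 i))).
  exact: flat_algebra_atom.
by apply/funext => x; rewrite mulrBr addrC mulNr.
Qed.

Lemma box_bump01 a b k x : 0 <= box_bump a b k x <= 1.
Proof.
rewrite prodr_ge0/= => [|i _]; last by rewrite mulr_ge0// flat1_ge0.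
apply: prodr_ile1 => i _; rewrite mulr_ge0 ?flat1_ge0//=.
by rewrite mulr_ile1 ?flat1_ge0 ?flat1_le1.
Qed.

Lemma box_bump0 a b k x : ~ box a b x -> box_bump a b k x = 0.
Proof.
move=> /existsNP[i /negP]; rewrite negb_and -!leNgt => /orP xi.
rewrite /box_bump (bigD1 i)//= /flat !pmulr_rgt0 ?ltr0Sn// !subr_gt0.
case: xi => xi; first by rewrite [X in if X then _ else _]ltNge xi !mul0r.
by rewrite [X in _ * (if X then _ else _) * _]ltNge xi mulr0 mul0r.
Qed.

Lemma box_bump_cvg a b x : box_bump a b k x @[k --> \oo] --> (\1_(box a b) x : R).
Proof.
have [xab|nxab] := pselect (box a b x); last first.
  rewrite indicE memNset// (_ : (fun _ => _) = fun=> 0); first exact: cvg_cst.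
  by apply/funext => k; rewrite box_bump0.
rewrite indicE mem_set//= -[X in _ --> X](_ : \prod_(i < n) (1 * 1) = 1); last first.
  by rewrite big1// => i _; rewrite mulr1.
apply: cvg_big => [|i _]; first exact: mul_continuous.
 have /andP[ax xb] := xab i.
by apply: cvgM; apply: flat1_cvg; rewrite subr_gt0.
Qed.

Lemma box_bump_test_fun (Omega : set 'rV[R]_n) a b k (j : 'I_m) :
  closed_box a b `<=` Omega ->
  test_fun Omega (fun x => box_bump a b k x *: (delta_mx 0 j : 'rV[R]_m)).
Proof.
move=> abO; split; first by apply: flat_algebra_smooth; exact: flat_algebra_box_bump.
exists (closed_box a b); split => //; first exact: compact_closed_box.
by move=> x nx; rewrite box_bump0 ?scale0r// => /box_sub_closed.
Qed.

End smooth_bumps.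

(** * Integrals over boxes determine a function *)

Section box_integrals.
Context {R : realType} {n : nat}.
Local Notation mu := (@leb R n).
Variables (Omega : set 'rV[R]_n).
Hypothesis (oO : open Omega).

Lemma closed_box_measurable (a b : 'rV[R]_n) : measurable (closed_box a b).
Proof. by apply: closed_measurable_row; apply: compact_closed_row; exact: compact_closed_box. Qed.

Lemma bump_integral_cvg (g : 'rV[R]_n -> R) a b : closed_box a b `<=` Omega ->
  L1loc Omega g ->
  (\int[mu]_(x in Omega) (g x * box_bump a b k x)%:E)%E @[k --> \oo] -->
  (\int[mu]_(x in box a b) (g x)%:E)%E.
Proof.
move=> abO gL1; have gK := gL1 _ (@compact_closed_box _ _ a b) abO.
have mK := closed_box_measurable a b.
have mg : measurable_fun (closed_box a b) g by have /measurable_int/measurable_EFinP := gK.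
have -> : (fun k => \int[mu]_(x in Omega) (g x * box_bump a b k x)%:E)%E =
    (fun k => \int[mu]_(x in closed_box a b) (g x * box_bump a b k x)%:E)%E.
  apply/funext => k; apply/esym/(integral_support abO) => x _ nx.
  by rewrite box_bump0 ?mulr0// => /box_sub_closed.
have -> : (\int[mu]_(x in box a b) (g x)%:E = \int[mu]_(x in closed_box a b) (g x * \1_(box a b) x)%:E)%E.
  rewrite -(integral_support (@box_sub_closed _ _ a b)).
    by apply: eq_integral => x xab; rewrite indicE xab mulr1.
  by move=> x _ nx; rewrite indicE memNset// mulr0.
have mb k : measurable_fun (closed_box a b) (box_bump a b k).
  apply: measurable_funTS; apply: continuous_measurable_row.
  by apply: flat_algebra_continuous; exact: flat_algebra_box_bump.
apply: (dominated_cvg mK _ _ _ (integrable_norm gK)).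
- by move=> k; apply/measurable_EFinP; exact: measurable_funM.
- move=> x _; apply: cvg_EFin; first by apply: nearW.
  by apply: cvgMr; exact: box_bump_cvg.
- by [].
- move=> k x _ /=; rewrite lee_fin normrM ler_piMr//.
  by have /andP[b0 b1] := box_bump01 a b k x; rewrite ger0_norm.
Qed.

(** Countably many rational boxes with closure in Omega cover Omega, so local
  almost everywhere statements are global ones. *)
Lemma ae_rat_boxes (P : 'rV[R]_n -> Prop) :
  (forall ab, closed_rat_box ab `<=` Omega -> {ae mu, forall x, rat_box ab x -> P x}) ->
  {ae mu, forall x, Omega x -> P x}.
Proof.
move=> H.
have : forall ab, {ae mu, forall x, closed_rat_box ab `<=` Omega -> rat_box ab x -> P x}.
  move=> ab; have [abO|nabO] := pselect (closed_rat_box ab `<=` Omega).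
    by have := H ab abO; apply: ae_imp => x Px _.
  by exists set0; split => // x /= nP; apply: nP.
move=> /ae_forall_countable; apply: ae_imp => x Px Ox.
by have [ab [xab abO]] := rat_box_nbhs oO Ox; exact: Px abO xab.
Qed.

Lemma integral_null_diff (A B : set 'rV[R]_n) (f : 'rV[R]_n -> \bar R) :
  measurable A -> measurable B -> A `<=` B -> mu (B `\` A) = 0%E ->
  measurable_fun B f -> (\int[mu]_(x in A) f x = \int[mu]_(x in B) f x)%E.
Proof.
move=> mA mB AB BA0 mf; rewrite [LHS]integral_mkcond [RHS]integral_mkcond.
have mf1 : measurable_fun [set: 'rV[R]_n] (f \_ A).
  by apply/(measurable_restrictT _ mA); exact: measurable_funS mf.
have mf2 : measurable_fun [set: 'rV[R]_n] (f \_ B).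
  by apply/(measurable_restrictT _ mB).
apply: (ae_eq_integral _ _ measurableT mf1 mf2).
exists (B `\` A); split => //; first exact: measurableD.
move=> x /= H; apply: contrapT => nBA; apply: H => _; rewrite !patchE.
case: ifPn => [|/negP xA]; rewrite ?inE.
  by move=> Ax; rewrite mem_set//; exact: AB.
case: ifPn => //; rewrite inE => Bx; exfalso; apply: nBA; split => // Ax.
by apply: xA; rewrite inE.
Qed.

(** Within a fixed box the sets on which the two integrals agree form a Dynkin
  system that contains all smaller rational boxes. *)
Lemma ae_eq_box_integrals (g h : 'rV[R]_n -> R) :
  L1loc Omega g -> L1loc Omega h ->
  (forall ab, closed_rat_box ab `<=` Omega ->
     (\int[mu]_(x in rat_box ab) (g x)%:E = \int[mu]_(x in rat_box ab) (h x)%:E)%E) ->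
  {ae mu, forall x, Omega x -> g x = h x}.
Proof.
move=> gL1 hL1 gh; apply: ae_rat_boxes => ab abO.
have mB : measurable (rat_box ab : set 'rV[R]_n).
  by apply: open_measurable_row; exact: open_box.
have int_box f : L1loc Omega f -> mu.-integrable (rat_box ab) (EFin \o f).
  move=> fL1; have := fL1 _ (@compact_closed_box _ _ _ _) abO.
  by apply: integrableS => //; [exact: closed_box_measurable|exact: box_sub_closed].
have gi := int_box g gL1; have hi := int_box h hL1.
have mgi := measurable_int _ gi; have mhi := measurable_int _ hi.
have E (A : set 'rV[R]_n) : measurable A ->
    (\int[mu]_(x in A `&` rat_box ab) (g x)%:E = \int[mu]_(x in A `&` rat_box ab) (h x)%:E)%E.
  move: A; apply: leb_dynkin.
  - by rewrite setTI gh.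
  - move=> A mA IA.
    have split_int f : mu.-integrable (rat_box ab) (EFin \o f) ->
      (\int[mu]_(x in ~` A `&` rat_box ab) (f x)%:E =
       \int[mu]_(x in rat_box ab) (f x)%:E - \int[mu]_(x in A `&` rat_box ab) (f x)%:E)%E.
      move=> fi.
      have mAB : measurable (A `&` rat_box ab) by exact: measurableI.
      have mCB : measurable (~` A `&` rat_box ab) by apply: measurableI => //; exact: measurableC.
      have E0 : rat_box ab = (~` A `&` rat_box ab) `|` (A `&` rat_box ab).
        by rewrite -setIUl setUC setUv setTI.
      rewrite [X in (_ = \int[mu]_(x in X) _ - _)%E]E0 integral_setU//.
      + rewrite addeK//; apply: integrable_fin_num => //.
        by apply: integrableS fi => //; exact: subIsetr.
      + by rewrite -E0; exact: measurable_int fi.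
      + by apply/disj_set2P; rewrite setIACA setICl set0I.
    by rewrite !split_int// gh// IA.
  - move=> F mF tF IF.
    rewrite setI_bigcupl.
    rewrite !integral_bigcup//.
    + by apply: eq_eseriesr => k _; exact: IF.
    + exact: trivIset_setIr.
    + by move=> k; exact: measurableI.
    + by apply: integrableS hi => //; [apply: bigcupT_measurable => k; exact: measurableI|exact: bigcup_sub].
    + exact: trivIset_setIr.
    + by move=> k; exact: measurableI.
    + by apply: integrableS gi => //; [apply: bigcupT_measurable => k; exact: measurableI|exact: bigcup_sub].
  - move=> cd; have [ef [-> efab]] := @rat_boxI R n cd ab.
    by apply: gh; exact: subset_trans efab abO.
  - move=> A B mA mB' AB BA0 IB.
    have null f : measurable_fun (rat_box ab) f ->
      (\int[mu]_(x in A `&` rat_box ab) f x = \int[mu]_(x in B `&` rat_box ab) f x)%E.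
      move=> mf; apply: integral_null_diff.
      + exact: measurableI.
      + exact: measurableI.
      + exact: setSI.
      + apply/eqP; rewrite -measure_le0 -BA0 le_measure ?inE//.
        * by apply: measurableD; exact: measurableI.
        * exact: measurableD.
        * by move=> x [[Bx xab] nA]; split => // Ax; exact: nA.
      + by apply: measurable_funS mf => //; exact: subIsetr.
    by rewrite (null _ mgi) (null _ mhi).
have := integral_ae_eq mB gi mhi.
have HE : (forall E0 : set 'rV[R]_n, E0 `<=` rat_box ab -> measurable E0 ->
   (\int[mu]_(x in E0) (EFin \o g) x = \int[mu]_(x in E0) (EFin \o h) x)%E).
  by move=> E0 E0ab mE0; have := E E0 mE0; rewrite setIidl.
by move=> /(_ HE); apply: ae_imp => x ghx xab; have [] := ghx xab.
Qed.

End box_integrals.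

(** * Uniqueness of the X-gradient *)

Section Xgradient.
Context {R : realType} {m n : nat}.
Local Notation mu := (@leb R n).
Variables (Omega : set 'rV[R]_n) (C : 'rV[R]_n -> 'M[R]_(m, n)).
Hypotheses (oO : open Omega) (bO : bounded_set Omega).
Hypothesis lC : forall j i, [lipschitz C x j i | x in Omega].

Let mO : measurable Omega. Proof. exact: open_measurable_row. Qed.

Lemma L1loc_mul_integrable (g f : 'rV[R]_n -> R) K M : L1loc Omega g ->
  measurable_fun [set: 'rV[R]_n] f -> (forall x, `|f x| <= M) ->
  compact K -> K `<=` Omega -> (forall x, ~ K x -> f x = 0) ->
  mu.-integrable Omega (EFin \o (fun x => g x * f x)).
Proof.
move=> gL1 mf fM cK KO f0.
have mK : measurable K by apply: closed_measurable_row; exact: compact_closed_row.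
apply/(integrable_support mO mK KO).
  by move=> x _ nKx; rewrite f0// mulr0.
have gK := gL1 K cK KO.
have mg : measurable_fun K g by have /measurable_int/measurable_EFinP := gK.
apply: (le_integrable mK _ _ (integrableZl mK `|M| gK)).
- by apply/measurable_EFinP; apply: measurable_funM mg _; exact: measurable_funTS.
- move=> x Kx /=; rewrite lee_fin !normrM normr_id mulrC ler_wpM2r//.
  by rewrite (le_trans (fM x))// ler_norm.
Qed.

Lemma test_mul_integrable phi (g : 'rV[R]_n -> 'rV[R]_m) : test_fun Omega phi ->
  (forall j, L1loc Omega (fun x => g x 0 j)) ->
  mu.-integrable Omega (EFin \o (fun x => \sum_(j < m) g x 0 j * phi x 0 j)).
Proof.
move=> tphi gL1.
have [_ [K [cK KO phi0]]] := tphi.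
pose G j (x : 'rV[R]_n) : R := g x 0 j * phi x 0 j.
rewrite (_ : _ \o _ = (fun x => \sum_(j < m) (EFin \o G j) x)%E); last first.
  by apply/funext => x; rewrite /= sumEFin.
apply: (integrable_sum mO) => j _.
have [cf _ [M fM] _] := test_fun_cutoff j tphi.
apply: (L1loc_mul_integrable (gL1 j) _ fM cK KO).
  exact: continuous_measurable_row.
by move=> x nKx; rewrite phi0// mxE.
Qed.

(** Bumps on a box are admissible test functions, and in the limit they give
  the integrals over that box. *)
Lemma is_Xgrad_uniq u g h : is_Xgrad Omega C u g -> is_Xgrad Omega C u h ->
  {ae mu, forall x, Omega x -> g x = h x}.
Proof.
move=> [gL1 gu] [hL1 hu].
have H j : {ae mu, forall x, Omega x -> g x 0 j = h x 0 j}.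
  apply: (ae_eq_box_integrals oO (gL1 j) (hL1 j)) => ab abO.
  have cg := bump_integral_cvg abO (gL1 j).
  have ch := bump_integral_cvg abO (hL1 j).
  suff E : (fun k => \int[mu]_(x in Omega) (g x 0%R j *
        box_bump (map_mx ratr ab.1) (map_mx ratr ab.2) k x)%:E)%E =
      (fun k => \int[mu]_(x in Omega) (h x 0%R j *
        box_bump (map_mx ratr ab.1) (map_mx ratr ab.2) k x)%:E)%E.
    by rewrite E in cg; exact: (cvg_unique (@ereal_hausdorff R) cg ch).
  apply/funext => k.
  pose phi (x : 'rV[R]_n) := box_bump (map_mx ratr ab.1) (map_mx ratr ab.2) k x *: (delta_mx 0 j : 'rV[R]_m).
  have tphi : test_fun Omega phi by exact: box_bump_test_fun.
  have red (w : 'rV[R]_n -> 'rV[R]_m) : (forall j, L1loc Omega (fun x => w x 0 j)) ->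
     (\int[mu]_(x in Omega) (w x 0%R j * box_bump (map_mx ratr ab.1) (map_mx ratr ab.2) k x)%:E)%E =
     (\int[mu]_(x in Omega) (\sum_(j < m) w x 0 j * phi x 0 j))%:E.
    move=> wL1; rewrite fineK; last first.
      exact: integrable_fin_num (test_mul_integrable tphi wL1).
    apply: eq_integral => x _; congr EFin.
    rewrite (bigD1 j)//= big1 ?addr0 => [|l lj]; rewrite !mxE eqxx /=.
      by rewrite eqxx mulr1.
    by rewrite (negbTE lj) !mulr0.
  by rewrite (red g gL1) (red h hL1) (gu phi tphi) (hu phi tphi).
have := ae_forall_countable H; apply: ae_imp => x Hx Ox.
by apply/rowP => j; exact: Hx.
Qed.

Lemma Xgrad_ae u g : is_Xgrad Omega C u g ->
  {ae mu, forall x, Omega x -> Xgrad Omega C u x = g x}.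
Proof.
move=> ug; apply: is_Xgrad_uniq (ug).
by rewrite /Xgrad; case: xgetP => [y -> //|]; move=> /(_ g) /=.
Qed.

Lemma is_XgradB u v g h : L1loc Omega u -> L1loc Omega v ->
  is_Xgrad Omega C u g -> is_Xgrad Omega C v h ->
  is_Xgrad Omega C (u \- v) (fun x => g x - h x).
Proof.
move=> uL1 vL1 [gL1 gu] [hL1 hu]; split.
  move=> j K cK KO.
  have mK : measurable K by apply: closed_measurable_row; exact: compact_closed_row.
  have := integrableB mK (gL1 j K cK KO) (hL1 j K cK KO).
  by apply: eq_integrable => // x _; rewrite /= !mxE.
move=> phi tphi.
have i1 := test_mul_integrable tphi gL1; have i2 := test_mul_integrable tphi hL1.
have j1 := mul_divergence_integrable oO bO lC tphi uL1.
have j2 := mul_divergence_integrable oO bO lC tphi vL1.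
rewrite [LHS](_ : _ = \int[mu]_(x in Omega) ((\sum_(j < m) g x 0 j * phi x 0 j) -
   (\sum_(j < m) h x 0 j * phi x 0 j))); last first.
  apply: eq_Rintegral => x _; rewrite -sumrB; apply: eq_bigr => j _.
  by rewrite !mxE mulrBl.
rewrite [X in - X](_ : _ = \int[mu]_(x in Omega) (u x * divergence (fun y => phi y *m C y) x
   - v x * divergence (fun y => phi y *m C y) x)); last first.
  by apply: eq_Rintegral => x _; rewrite mulrBl.
by rewrite (RintegralB mO i1 i2) (RintegralB mO j1 j2) (gu phi tphi) (hu phi tphi) opprD.
Qed.

Variable p : R.
Hypothesis p1 : 1 <= p.

Lemma Lp_measurable u : Lp Omega p u -> measurable_fun Omega u.
Proof.
by move=> /sub_Lfun_mfun; rewrite inE/= => mu_; apply/(measurable_restrictT _ mO).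
Qed.

Lemma Lp_integrable u : Lp Omega p u ->
  mu.-integrable Omega (fun x => (`|u x| `^ p)%:E).
Proof.
move=> uL; have := Lfun_integrable p1 uL => i1.
rewrite (integrable_mkcond _ mO).
rewrite (_ : _ \_ _ = (fun x => (`|(u \_ Omega) x| `^ p)%:E)); first exact: i1.
apply/funext => x; rewrite !patchE; case: ifP => // _.
by rewrite normr0 powR0// gt_eqF// (lt_le_trans ltr01).
Qed.

Lemma powR_ge1D (t : R) : 0 <= t -> t <= 1 + t `^ p.
Proof.
move=> t0; have [t1|t1] := leP t 1; first by rewrite ler_wpDr// powR_ge0.
by rewrite ler_wpDl// -[leLHS]powRr1// ler_powR// ltW.
Qed.

Lemma Lp_L1loc u : Lp Omega p u -> L1loc Omega u.
Proof.
move=> uL K cK KO; have uI := Lp_integrable uL.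
have mu_ := Lp_measurable uL.
have mK : measurable K by apply: closed_measurable_row; exact: compact_closed_row.
have cI : mu.-integrable K (cst 1%E).
  apply: (measurable_bounded_integrable (f := cst 1) mK).
  - by apply: leb_bounded => //; exact: compact_bounded.
  - exact: measurable_cst.
  - by exists 1; split => // r /ltW r1 x _; rewrite /= normr1.
have uK : mu.-integrable K (fun x => (`|u x| `^ p)%:E) by apply: integrableS uI.
apply: (le_integrable mK _ _ (integrableD mK cI uK)).
  by apply/measurable_EFinP; apply: measurable_funS mu_.
move=> x Kx /=; rewrite lee_fin [leRHS]ger0_norm ?powR_ge1D//.
Qed.

Lemma WX_is_Xgrad u : WX Omega C p u -> is_Xgrad Omega C u (Xgrad Omega C u).
Proof.
move=> [_ [g ug _]]; rewrite /Xgrad; case: xgetP => [y -> //|].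
by move=> /(_ g) /=.
Qed.

Lemma WX_Xgrad_integrable u j : WX Omega C p u ->
  measurable_fun Omega (fun x => Xgrad Omega C u x 0 j) /\
  mu.-integrable Omega (fun x => (`|Xgrad Omega C u x 0 j| `^ p)%:E).
Proof.
move=> [_ [g ug gL]].
have mg := Lp_measurable (gL j); have gI := Lp_integrable (gL j).
have aeg : {ae mu, forall x, Omega x -> Xgrad Omega C u x = g x} by exact: Xgrad_ae.
have mX : measurable_fun Omega (fun x => Xgrad Omega C u x 0 j).
  by apply: (ae_measurable_row _ mg); move: aeg; apply: ae_imp => x gx Ox; rewrite gx.
split => //; apply: (ae_eq_integrable mO _ _ gI).
  apply/measurable_EFinP; apply: (measurableT_comp (measurable_powR p)).
  exact: measurableT_comp.
by move: aeg; apply: ae_imp => x gx Ox; rewrite gx.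
Qed.

Lemma XgradB_ae u v : WX Omega C p u -> WX Omega C p v ->
  {ae mu, forall x, Omega x ->
    Xgrad Omega C (u \- v) x = Xgrad Omega C u x - Xgrad Omega C v x}.
Proof.
move=> Wu Wv; apply: Xgrad_ae; apply: is_XgradB.
- by apply: Lp_L1loc; case: Wu.
- by apply: Lp_L1loc; case: Wv.
- exact: WX_is_Xgrad.
- exact: WX_is_Xgrad.
Qed.

Lemma affine_WX c xi : WX Omega C p (affine c xi).
Proof.
have Lp_bounded (u : 'rV[R]_n -> R) N : measurable_fun Omega u ->
    (forall x, Omega x -> `|u x| <= N) -> Lp Omega p u.
  move=> mu_ uN; rewrite /Lp inE; apply/andP; split.
    by rewrite inE/=; apply/(measurable_restrictT _ mO).
  rewrite inE /= /finite_norm unlock /=; apply: poweR_lty.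
  have uI : mu.-integrable Omega (EFin \o (fun x => `|u x| `^ p)).
    apply: (measurable_bounded_integrable mO).
    - exact: leb_bounded.
    - apply: (measurableT_comp (measurable_powR p)).
      exact: measurableT_comp.
    - exists (`|N| `^ p); split; first exact: num_real.
      move=> r Nr x Ox /=; rewrite (le_trans _ (ltW Nr))// ger0_norm ?powR_ge0//.
      apply: ge0_ler_powR; [exact: le_trans p1|by rewrite nnegrE|by rewrite nnegrE|].
      by rewrite (le_trans (uN x Ox))// ler_norm.
  have := uI; rewrite (integrable_mkcond _ mO) => /integrableP[_].
  apply: le_lt_trans; rewrite le_eqVlt; apply/orP; left; apply/eqP.
  apply: eq_integral => x _; rewrite /= !patchE; case: ifP => _ /=.
    by rewrite (ger0_norm (powR_ge0 _ _)).
  by rewrite [in RHS]normr0 [X in X `^ p](_ : _ = 0) ?powR0 ?gt_eqF ?(lt_le_trans ltr01)//; exact: normr0.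
split.
  have [N uN] := affine_bounded bO c xi.
  by apply: Lp_bounded uN; apply: measurable_funTS; exact: affine_measurable.
exists (fun x => xi *m (C x)^T); first exact: is_Xgrad_affine.
by move=> j; have [N [mg gN]] := affine_Xgrad_L1loc oO bO lC xi j; exact: Lp_bounded gN.
Qed.

End Xgradient.

(** * Subsequences and dominated integrals *)

Section subsequences.
Context {R : realType}.

Lemma homo_ltn_ge_id (f : nat -> nat) : {homo f : i j / (i < j)%N} -> forall n, (n <= f n)%N.
Proof.
move=> fh; elim=> [//|n IH]; apply: (leq_ltn_trans IH); exact: fh.
Qed.

Lemma cvgn_reindex (u : nat -> R) (r : nat -> nat) (l : R) :
  (\forall n \near \oo, (n <= r n)%N) -> u @ \oo --> l -> (u \o r) @ \oo --> l.
Proof.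
move=> [N _ Nr] ul A /ul[M _ MA]; exists (maxn N M) => // n /= nNM.
apply: MA => /=; apply: (leq_trans _ (Nr n _)) => /=.
  exact: leq_trans (leq_maxr _ _) nNM.
exact: leq_trans (leq_maxl _ _) nNM.
Qed.

(** The diagonal of successive Bolzano-Weierstrass extractions. *)
Lemma diagonal_subsequence (a : nat -> nat -> R) (M : nat -> R) :
  (forall i h, `|a i h| <= M i) ->
  exists k : nat -> nat, {homo k : i j / (i < j)%N} /\
    forall i, cvgn (a i \o k).
Proof.
move=> aM.
have BW (i : nat) (s : nat -> nat) : exists t : nat -> nat,
    {homo t : i j / (i < j)%N} /\ cvgn (a i \o (s \o t)).
  have [|t ti ta] := @bolzano_weierstrass R (a i \o s).
    exists (M i); split; first exact: num_real.
    by move=> r /ltW Mr h _; rewrite /= (le_trans (aM _ _)).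
  exists t; split => // x y xy.
  rewrite ltnNge; apply/negP => tyx; have : (y <= x)%N.
    by rewrite -(ti y x); exact: tyx.
  by rewrite leqNgt xy.
have [t tE] := choice (fun is_ : nat * (nat -> nat) => BW is_.1 is_.2).
(* S n composes the first n extractions, so that the diagonal S n n is,
   from rank i on, a subsequence of S i. *)
pose S := fix S n := if n is n'.+1 then S n' \o t (n', S n') else id.
have tH n : {homo t (n, S n) : i j / (i < j)%N} by have [] := tE (n, S n).
have SH n : {homo S n : i j / (i < j)%N}.
  by elim: n => [//|n IH] x y xy /=; apply: IH; exact: tH.
have SD n m : exists r, {homo r : i j / (i < j)%N} /\ S (n + m)%N = S n \o r.
  elim: m => [|m [r [rH rE]]]; first by exists id; split => //; rewrite addn0.
  exists (r \o t ((n + m)%N, S (n + m)%N)); split.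
    by move=> x y xy /=; apply: rH; exact: tH.
  by rewrite addnS /= rE.
exists (fun n => S n n); split.
  apply: homo_ltn => [x y z|n]; first exact: ltn_trans.
  by rewrite /=; apply: SH; apply: (leq_trans _ (homo_ltn_ge_id (tH n) _)).
move=> i; have [_ ai] := tE (i, S i).
have SiE : S i.+1 = S i \o t (i, S i) by [].
have /cvg_ex[l al] := ai.
have H n : exists r, (n <= r)%N /\ ((i < n)%N -> S n n = S i.+1 r).
  have [ni|ni] := ltnP i n; last by exists n.
  have [r [rH rE]] := SD i.+1 (n - i.+1)%N.
  exists (r n); split; first exact: homo_ltn_ge_id.
  by rewrite subnKC in rE => // _; rewrite rE.
have [r rE] := choice H.
apply/cvg_ex; exists l.
have : (a i \o S i.+1) \o r @ \oo --> l.
  by apply: cvgn_reindex al; apply: nearW => n; have [] := rE n.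
apply: cvg_trans; apply: near_eq_cvg; near=> n.
rewrite /=; have [_ ->] := rE n => //.
by near: n; exact: nbhs_infty_gt.
Unshelve. all: by end_near. Qed.

(** A sequence that is uniformly close to convergent ones converges, and its
  limit is the limit of their limits. *)
Lemma cvgn_uniform_approx (u : nat -> R) (v : nat -> nat -> R) (l : nat -> R) (d : nat -> R) :
  (forall N, v N @ \oo --> l N) -> (forall N h, `|u h - v N h| <= d N) ->
  d @ \oo --> (0 : R) -> exists L : R, u @ \oo --> L /\ l @ \oo --> L.
Proof.
move=> vl uv d0.
have cu : cvgn u.
  apply/cauchy_cvgP/cauchy_exP => e e0.
  have e4 : 0 < e / 4 by rewrite divr_gt0.
  have /cvgrPdist_lt /(_ _ e4)[N _ dN] := d0.
  have {}dN : d N < e / 4.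
    by have := dN N (leqnn N); rewrite sub0r normrN => /(le_lt_trans (ler_norm _)).
  have /cvgrPdist_lt /(_ _ e4)[M _ vM] := vl N.
  exists (u M).
  suff : \forall h \near \oo, ball (u M) e (u h) by [].
  exists M => // h /= Mh; rewrite /ball /=.
  have := uv N h; have := uv N M; have := vM h Mh; have := vM M (leqnn M).
  rewrite !ltr_norml !ler_norml.
  by move=> /andP[? ?] /andP[? ?] /andP[? ?] /andP[? ?]; apply/andP; split; lra.
have /cvg_ex[L uL] := cu; exists L; split => //.
have lL N : `|L - l N| <= d N.
  have c : (fun h => `|u h - v N h|) @ \oo --> `|L - l N|.
    by apply: cvg_norm; apply: cvgB => //; exact: vl.
  rewrite -(cvg_lim _ c)//; apply: limr_le; first by apply/cvg_ex; exists `|L - l N|.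
  by apply: nearW => h; exact: uv.
apply/cvgrPdist_le => e e0.
have /cvgrPdist_lt /(_ _ e0) := d0; apply: filterS => N.
rewrite sub0r normrN => dN; rewrite (le_trans (lL N))// ltW//.
exact: le_lt_trans (ler_norm _) dN.
Qed.

End subsequences.

Section dominated_sets.
Context d (T : measurableType d) (R : realType).
Variable mu : {measure set T -> \bar R}.

Lemma Rintegral_disjoint_union (E F : set T) (f : T -> R) :
  measurable E -> measurable F -> E `&` F = set0 ->
  mu.-integrable (E `|` F) (EFin \o f) ->
  \int[mu]_(x in E `|` F) f x = \int[mu]_(x in E) f x + \int[mu]_(x in F) f x.
Proof.
move=> mE mF EF fi; rewrite Rintegral_setU//.
exact/disj_set2P.
Qed.

Lemma dominated_integrable (u B : T -> R) (E : set T) : measurable E ->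
  measurable_fun [set: T] u -> (forall x, `|u x| <= B x) ->
  mu.-integrable [set: T] (EFin \o B) -> mu.-integrable E (EFin \o u).
Proof.
move=> mE mu_ uB Bi.
apply: (integrableS measurableT mE (@subsetT _ _)).
apply: (le_integrable measurableT _ _ Bi); first exact/measurable_EFinP.
by move=> x _ /=; rewrite lee_fin (le_trans (uB x))// ler_norm.
Qed.

Lemma tail_integral_cvg (B : T -> R) (U : nat -> set T) (E : set T) :
  mu.-integrable [set: T] (EFin \o B) -> (forall N, measurable (U N)) -> measurable E ->
  (forall N, U N `<=` E) ->
  (forall x, E x -> \forall N \near \oo, U N x) ->
  (fun N => \int[mu]_(x in E `\` U N) `|B x|) @ \oo --> (0 : R).
Proof.
move=> Bi mU mE UE EU.
have mB : measurable_fun [set: T] B by have /measurable_int/measurable_EFinP := Bi.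
have mnB : measurable_fun [set: T] (fun x => `|B x|) by exact: measurableT_comp.
have E1 N : \int[mu]_(x in E `\` U N) `|B x| = fine (\int[mu]_x (`|B x| * \1_(E `\` U N) x)%:E)%E.
  rewrite /Rintegral integral_mkcond; congr fine; apply: eq_integral => x _.
  by rewrite patchE indicE; case: ifP => _; rewrite ?mulr1 ?mulr0.
under eq_fun do rewrite E1.
apply: fine_cvg.
rewrite -[X in _ --> X](integral0 mu [set: T]).
apply: (dominated_cvg measurableT _ _ _ (integrable_norm Bi)).
- move=> N; apply/measurable_EFinP; apply: measurable_funM => //.
  by apply: measurable_indic; exact: measurableD.
- move=> x _; apply: cvg_EFin; first exact: nearW.
  apply: (@cvg_trans _ ((fun=> 0) @ \oo)); last exact: cvg_cst.
  apply: near_eq_cvg; have [Ex|nEx] := pselect (E x).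
    have := EU x Ex; apply: filterS => N UNx.
    by rewrite /= indicE memNset ?mulr0// => -[].
  by apply: nearW => N; rewrite /= indicE memNset ?mulr0// => -[].
- by [].
- move=> N x _ /=; rewrite lee_fin normrM normr_id ler_piMr//.
  by rewrite indicE; case: (_ \in _); rewrite ?normr1 ?normr0.
Qed.

(** The common bound makes the tails of the union uniformly small, so that
  convergence on the pieces suffices. *)
Lemma disjoint_union_cvg (u : nat -> T -> R) (B : T -> R) (F : (set T)^nat) (l : nat -> R) :
  (forall h, measurable_fun [set: T] (u h)) -> (forall h x, `|u h x| <= B x) ->
  mu.-integrable [set: T] (EFin \o B) ->
  (forall k, measurable (F k)) -> trivIset setT F ->
  (forall k, (fun h => \int[mu]_(x in F k) u h x) @ \oo --> l k) ->
  exists L : R, (fun h => \int[mu]_(x in \bigcup_k F k) u h x) @ \oo --> L /\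
    (fun N => \sum_(k < N) l k) @ \oo --> L.
Proof.
move=> mu_ uB Bi mF tF Fl.
pose U N := \big[setU/set0]_(k < N) F k.
have mU N : measurable (U N) by exact: bigsetU_measurable.
have mcF : measurable (\bigcup_k F k) by exact: bigcupT_measurable.
have ui h E : measurable E -> mu.-integrable E (EFin \o u h).
  by move=> mE; exact: (dominated_integrable mE (mu_ h) (uB h)).
have UF N : U N `<=` \bigcup_k F k.
  by rewrite /U => x; rewrite -bigcup_mkord => -[k _ Fkx]; exists k.
apply: (@cvgn_uniform_approx _ _ (fun N h => \int[mu]_(x in U N) u h x) _
   (fun N => \int[mu]_(x in \bigcup_k F k `\` U N) `|B x|)).
- elim=> [|N IH].
    rewrite big_ord0 /U; under eq_fun do rewrite big_ord0 Rintegral_set0.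
    exact: cvg_cst.
  rewrite big_ord_recr/= (_ : (fun h => _) =
     (fun h => \int[mu]_(x in U N) u h x + \int[mu]_(x in F N) u h x)).
    exact: cvgD.
  apply/funext => h; rewrite /U big_ord_recr/= -/(U N).
  apply: Rintegral_disjoint_union => //; last by apply: ui; exact: measurableU.
  rewrite -subset0 => x [] ; rewrite /U -bigcup_mkord => -[k /= kN Fkx] FNx.
  by have := tF k N Logic.I Logic.I (ex_intro _ x (conj Fkx FNx)) => kE; rewrite kE ltnn in kN.
- move=> N h; have mD : measurable (\bigcup_k F k `\` U N) by exact: measurableD.
  have E0 : \bigcup_k F k = U N `|` (\bigcup_k F k `\` U N).
    by rewrite setDUK.
  rewrite {1}E0 Rintegral_disjoint_union//; last 2 first.
    by rewrite setDIK.
    by apply: ui; exact: measurableU.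
  rewrite addrAC subrr add0r.
  apply: (le_trans (le_normr_Rintegral mD (ui h _ mD))).
  apply: le_Rintegral => //.
  + exact: integrable_norm (ui h _ mD).
  + exact: (integrableS measurableT mD (@subsetT _ _) (integrable_norm Bi)).
  + by move=> x _; rewrite (le_trans (uB h x))// ler_norm.
- apply: (tail_integral_cvg Bi mU mcF UF) => x [k _ Fkx].
  near=> N; rewrite /U -bigcup_mkord; exists k => //=.
  by near: N; exact: nbhs_infty_gt.
Unshelve. all: by end_near. Qed.

End dominated_sets.

(** * Weak limits of dominated sequences *)

Section weak_limits.
Context d (T : measurableType d) (R : realType).
Variable mu : {finite_measure set T -> \bar R}.

(** A sequence of sets that generates the measurable sets up to null sets,
  stated as the induction principle that is used. *)
Definition dynkin_generated (G : nat -> set T) := forall P : set (set T),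
  P setT -> (forall A, measurable A -> P A -> P (~` A)) ->
  (forall F : (set T)^nat, (forall k, measurable (F k)) -> trivIset setT F ->
     (forall k, P (F k)) -> P (\bigcup_k F k)) ->
  (forall i, P (G i)) ->
  (forall A B, measurable A -> measurable B -> A `<=` B -> mu (B `\` A) = 0%E ->
     P B -> P A) ->
  forall A, measurable A -> P A.

Section one_sequence.
Variables (psi : nat -> T -> R) (B : T -> R).
Hypothesis mpsi : forall h, measurable_fun [set: T] (psi h).
Hypothesis psi0 : forall h x, 0 <= psi h x.
Hypothesis psiB : forall h x, psi h x <= B x.
Hypothesis Bi : mu.-integrable [set: T] (EFin \o B).

Let psiB' h x : `|psi h x| <= B x.
Proof. by rewrite ger0_norm. Qed.

Lemma dominated_integrable_seq h E : measurable E -> mu.-integrable E (EFin \o psi h).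
Proof. by move=> mE; exact: (dominated_integrable mE (mpsi h) (psiB' h)). Qed.

Lemma Rintegral_null (f : T -> R) E : measurable E -> mu E = 0%E ->
  measurable_fun E f -> \int[mu]_(x in E) f x = 0.
Proof.
move=> mE E0 mf; rewrite /Rintegral (ae_eq_integral (cst 0%E)) ?integral0//.
- exact/measurable_EFinP.
- by exists E; split => // x /= /not_implyP[].
Qed.

(** The sets over which the integrals converge form a Dynkin system. *)
Lemma dynkin_cvgn (G : nat -> set T) : dynkin_generated G ->
  cvgn (fun h => \int[mu]_(x in setT) psi h x) ->
  (forall i, cvgn (fun h => \int[mu]_(x in G i) psi h x)) ->
  forall E, measurable E -> cvgn (fun h => \int[mu]_(x in E) psi h x).
Proof.
move=> Ggen cT cG; apply: Ggen; [exact: cT| | |exact: cG|].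
- move=> A mA cA.
  have mCA : measurable (~` A) by exact: measurableC.
  rewrite (_ : (fun h => _) = (fun h => \int[mu]_(x in setT) psi h x - \int[mu]_(x in A) psi h x)).
    exact: is_cvgB.
  apply/funext => h; rewrite -(setUv A) Rintegral_disjoint_union//.
  + by rewrite addrAC subrr add0r.
  + by rewrite setICr.
  + by apply: dominated_integrable_seq; exact: measurableU.
- move=> F mF tF cF.
  have [L [uL _]] := disjoint_union_cvg mpsi psiB' Bi mF tF cF.
  by apply/cvg_ex; exists L.
- move=> A A' mA mA' AA' A'A0 cA'.
  rewrite (_ : (fun h => _) = (fun h => \int[mu]_(x in A') psi h x))//.
  apply/funext => h.
  have mD : measurable (A' `\` A) by exact: measurableD.
  rewrite -[in RHS](setDUK AA') Rintegral_disjoint_union//.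
  + rewrite (Rintegral_null mD A'A0) ?addr0//; exact: measurable_funTS.
  + by rewrite setDIK.
  + by apply: dominated_integrable_seq; exact: measurableU.
Qed.

(** The limits of the integrals define a finite measure (countably additive by
  [disjoint_union_cvg]) that vanishes on null sets, so it has a density. *)
Lemma weak_limit : (forall E, measurable E -> cvgn (fun h => \int[mu]_(x in E) psi h x)) ->
  exists g : T -> R, [/\ measurable_fun [set: T] g, forall x, 0 <= g x,
    mu.-integrable [set: T] (EFin \o g) &
    forall E, measurable E ->
      (fun h => \int[mu]_(x in E) psi h x) @ \oo --> \int[mu]_(x in E) g x].
Proof.
move=> cE.
pose l E := lim ((fun h => \int[mu]_(x in E) psi h x) @ \oo).
pose nu (E : set T) : \bar R := if `[< measurable E >] then (l E)%:E else 0%E.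
have nuE E : measurable E -> nu E = (l E)%:E by move=> mE; rewrite /nu; case: asboolP.
have nu0 : nu set0 = 0%E.
  rewrite nuE// /l (_ : (fun h => _) = fun=> 0) ?lim_cst//.
  by apply/funext => h; rewrite Rintegral_set0.
have nu_ge0 E : (0 <= nu E)%E.
  rewrite /nu; case: asboolP => // mE; rewrite lee_fin.
  apply: limr_ge; first exact: cE.
  by apply: nearW => h; apply: Rintegral_ge0 => x _; exact: psi0.
have nu_add : semi_sigma_additive nu.
  move=> F mF tF mUF.
  have [L [uL lL]] := disjoint_union_cvg mpsi psiB' Bi mF tF (fun k => cE (F k) (mF k)).
  rewrite nuE// (_ : l (\bigcup_k F k) = L); last exact: cvg_lim uL.
  rewrite (_ : (fun n => _) = (fun N => (\sum_(k < N) l (F k))%:E)).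
    by apply: cvg_EFin => //; exact: nearW.
  apply/funext => N; rewrite big_mkord -sumEFin; apply: eq_bigr => k _.
  by rewrite nuE.
pose m1 := isMeasure.Build d T R nu nu0 nu_ge0 nu_add.
pose nu1 : {measure set T -> \bar R} := HB.pack nu m1.
have nu1T : (nu1 setT < +oo)%E by have -> : nu1 setT = (l setT)%:E by [exact: nuE]; exact: ltry.
pose nu2 : {finite_measure set T -> \bar R} := mfrestr measurableT nu1T.
have nu2E E : measurable E -> nu2 E = (l E)%:E.
  by move=> mE; rewrite /nu2 /= /mfrestr /mrestr setIT; exact: nuE.
have dom : nu2 `<< mu.
  apply/null_content_dominatesP => A mA A0; rewrite (nu2E _ mA) /l.
  rewrite (_ : (fun h => _) = fun=> 0) ?lim_cst//.
  by apply/funext => h; rewrite Rintegral_null//; exact: measurable_funTS.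
have [f [f0 ffin fi fE]] := radon_nikodym_sigma_finite dom.
exists (fine \o f); split.
- by apply: (measurableT_comp (fine_measurable _)) => //; exact: measurable_int fi.
- by move=> x; exact: fine_ge0.
- by apply: eq_integrable fi => // x _; rewrite /= fineK.
- move=> E mE; rewrite /Rintegral.
  under eq_integral do rewrite /= fineK//.
  rewrite -fE// nu2E//; exact: cE.
Qed.

End one_sequence.

(** The set where the inequality fails carries a negative integral unless it
  is null. *)
Lemma ae_le_integral (f g : T -> R) :
  mu.-integrable [set: T] (EFin \o f) -> mu.-integrable [set: T] (EFin \o g) ->
  (forall E, measurable E -> \int[mu]_(x in E) f x <= \int[mu]_(x in E) g x) ->
  {ae mu, forall x, f x <= g x}.
Proof.
move=> fi gi fg.
pose E := [set x | g x < f x].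
have mf : measurable_fun [set: T] f by have /measurable_int/measurable_EFinP := fi.
have mg : measurable_fun [set: T] g by have /measurable_int/measurable_EFinP := gi.
have mE : measurable E.
  have := measurable_fun_ltr mg mf measurableT => /(_ [set true]).
  by rewrite setTI => H; apply: H.
have fE : mu.-integrable E (EFin \o f) by exact: integrableS fi.
have gE : mu.-integrable E (EFin \o g) by exact: integrableS gi.
have I0 : (\int[mu]_(x in E) `|(f x - g x)%:E| = 0)%E.
  rewrite (_ : (\int[mu]_(x in E) `|(f x - g x)%:E|)%E = (\int[mu]_(x in E) (f x - g x)%:E)%E); last first.
    apply: eq_integral => x; rewrite inE /E/= => gf.
    by rewrite gtr0_norm// subr_gt0.
  have fgi : mu.-integrable E (EFin \o (fun x => f x - g x)).
    by have := integrableB mE fE gE; apply: eq_integrable.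
  rewrite -[LHS]fineK ?(integrable_fin_num mE fgi)//; congr EFin.
  rewrite -/(Rintegral mu E (fun x => f x - g x)) RintegralB//.
  apply/eqP; rewrite eq_le subr_le0 fg//= subr_ge0 le_Rintegral//.
  by move=> x /ltW.
have mfg : measurable_fun E (fun x => (f x - g x)%:E).
  by apply/measurable_EFinP; apply: measurable_funTS; exact: measurable_funB.
have := (ae_eq_integral_abs mu mE mfg).1 I0.
apply: ae_imp => x Hx; rewrite leNgt; apply/negP => gf.
by have [/eqP] := Hx gf; rewrite subr_eq0 gt_eqF.
Qed.

End weak_limits.

(** * Weak compactness of countable dominated families *)

Section countable_composition.
Context d (T : measurableType d) (R : realType) (I : countType).

(** A function with countably many values needs no measurable structure on
  its codomain: its level sets suffice. *)
Lemma measurable_countable_comp (j : T -> I) (F : I -> T -> R) :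
  (forall i, measurable [set x | j x = i]) ->
  (forall i, measurable_fun [set: T] (F i)) ->
  measurable_fun [set: T] (fun x => F (j x) x).
Proof.
move=> mj mF _ Y mY; rewrite setTI.
have -> : (fun x => F (j x) x) @^-1` Y =
    \bigcup_k (if unpickle k is Some i then [set x | j x = i] `&` F i @^-1` Y
               else set0).
  apply/seteqP; split => [x Yx|x [k _]].
    by exists (pickle (j x)) => //; rewrite pickleK.
  by case: unpickle => // i [/= <-].
apply: bigcupT_measurable => k; case: unpickle => // i.
apply: measurableI; first exact: mj.
by have := mF i measurableT Y mY; rewrite setTI.
Qed.

End countable_composition.

Section weak_compactness.
Context d (T : measurableType d) (R : realType) (Q : countType).
Variable mu : {finite_measure set T -> \bar R}.
Variables (psi : Q -> nat -> T -> R) (B : Q -> T -> R).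
Hypothesis mpsi : forall q h, measurable_fun [set: T] (psi q h).
Hypothesis psi0 : forall q h x, 0 <= psi q h x.
Hypothesis psiB : forall q h x, psi q h x <= B q x.
Hypothesis Bi : forall q, mu.-integrable [set: T] (EFin \o B q).

(** Boundedness of the integrals over countably many sets and countably many
  indices allows one diagonal extraction for all of them. *)
Lemma weak_compactness (G : nat -> set T) : (forall i, measurable (G i)) ->
  dynkin_generated mu G ->
  exists k : nat -> nat, {homo k : i j / (i < j)%N} /\
  exists g : Q -> T -> R, forall q,
    [/\ measurable_fun [set: T] (g q), forall x, 0 <= g q x,
      mu.-integrable [set: T] (EFin \o g q) &
      forall E, measurable E ->
        (fun h => \int[mu]_(x in E) psi q (k h) x) @ \oo --> \int[mu]_(x in E) g q x].
Proof.
move=> mG dG.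
pose GT i := if i is i'.+1 then G i' else setT.
have mGT i : measurable (GT i) by case: i => [|i] /=; [exact: measurableT|exact: mG].
pose a (i h : nat) : R := if unpickle i is Some (q, l)
  then \int[mu]_(x in GT l) psi q h x else 0.
pose M (i : nat) : R := if unpickle i is Some (q, l)
  then \int[mu]_(x in GT l) B q x else 0.
have psiB' q h x : `|psi q h x| <= B q x by rewrite ger0_norm.
have aM i h : `|a i h| <= M i.
  rewrite /a /M; case: unpickle => [[q l]|]; last by rewrite normr0.
  have pint : mu.-integrable (GT l) (EFin \o psi q h).
    exact: dominated_integrable (mGT l) (mpsi q h) (psiB' q h) (Bi q).
  rewrite ger0_norm; last by apply: Rintegral_ge0 => x _; exact: psi0.
  apply: le_Rintegral; [by []|exact: pint| |by move=> x _; exact: psiB].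
  exact: (integrableS measurableT (mGT l) (@subsetT _ _) (Bi q)).
have [k [kH ka]] := diagonal_subsequence aM.
exists k; split => //.
have kq q l : cvgn (fun h => \int[mu]_(x in GT l) psi q (k h) x).
  by have := ka (pickle (q, l)); rewrite /a/= /comp pickleK.
have lim1 q : exists g : T -> R, [/\ measurable_fun [set: T] g, forall x, 0 <= g x,
      mu.-integrable [set: T] (EFin \o g) &
      forall E, measurable E ->
        (fun h => \int[mu]_(x in E) psi q (k h) x) @ \oo --> \int[mu]_(x in E) g x].
  apply: (weak_limit (fun h => mpsi q (k h)) (fun h x => psi0 q (k h) x)
    (fun h x => psiB q (k h) x) (Bi q)).
  apply: (dynkin_cvgn (fun h => mpsi q (k h)) (fun h x => psi0 q (k h) x)
    (fun h x => psiB q (k h) x) (Bi q) dG); first exact: (kq q 0%N).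
  by move=> i; exact: (kq q i.+1).
by have [g gE] := choice lim1; exists g.
Qed.

(** Pointwise inequalities between dominated sequences give inequalities
  between the integrals over every set, and these pass to the limit.  Truncating
  D by the bound of the sequence makes it integrable. *)
Lemma weak_limit_le (q q' : Q) (k : nat -> nat) (D g g' : T -> R) :
  measurable_fun [set: T] D -> (forall x, 0 <= D x) ->
  (forall h x, psi q h x <= psi q' h x + D x) ->
  mu.-integrable [set: T] (EFin \o g) -> mu.-integrable [set: T] (EFin \o g') ->
  (forall E, measurable E ->
    (fun h => \int[mu]_(x in E) psi q (k h) x) @ \oo --> \int[mu]_(x in E) g x) ->
  (forall E, measurable E ->
    (fun h => \int[mu]_(x in E) psi q' (k h) x) @ \oo --> \int[mu]_(x in E) g' x) ->
  {ae mu, forall x, g x <= g' x + D x}.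
Proof.
move=> mD D0 pD gi g'i lg lg'.
pose D' x := Num.min (D x) (B q x).
have mB : measurable_fun [set: T] (B q).
  by have /measurable_int/measurable_EFinP := Bi q.
have B0 x : 0 <= B q x by apply: le_trans (psi0 q 0 x) (psiB q 0 x).
have mD' : measurable_fun [set: T] D' by exact: measurable_minr.
have D'i : mu.-integrable [set: T] (EFin \o D').
  apply: (le_integrable measurableT _ _ (Bi q)); first exact/measurable_EFinP.
  move=> x _ /=; rewrite lee_fin ger0_norm ?le_min ?D0 ?B0//.
  by rewrite ger0_norm ?B0// ge_min lexx orbT.
have pi_ r h : mu.-integrable [set: T] (EFin \o psi r h).
  apply: (dominated_integrable measurableT (mpsi r h) _ (Bi r)) => x.
  by rewrite ger0_norm.
have gD'i : mu.-integrable [set: T] (EFin \o (fun x => g' x + D' x)).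
  by have := integrableD measurableT g'i D'i; apply: eq_integrable.
have : {ae mu, forall x, g x <= g' x + D' x}.
  apply: (ae_le_integral gi gD'i) => E mE.
  have iE (f : T -> R) : mu.-integrable [set: T] (EFin \o f) -> mu.-integrable E (EFin \o f).
    by move=> fi; exact: (integrableS measurableT mE (@subsetT _ _) fi).
  rewrite (RintegralD mE (iE _ g'i) (iE _ D'i)).
  have c : (fun h => \int[mu]_(x in E) psi q' (k h) x + \int[mu]_(x in E) D' x) @ \oo -->
      \int[mu]_(x in E) g' x + \int[mu]_(x in E) D' x.
    by apply: cvgD; [exact: lg'|exact: cvg_cst].
  have c1 := lg E mE.
  rewrite -(cvg_lim _ c)// -(cvg_lim _ c1)//.
  apply: ler_lim; [by apply/cvg_ex; eexists; exact: c1|by apply/cvg_ex; eexists; exact: c|].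
  apply: nearW => h; rewrite -(RintegralD mE (iE _ (pi_ q' (k h))) (iE _ D'i)).
  apply: le_Rintegral => //; first by apply: iE; exact: pi_.
    have := integrableD mE (iE _ (pi_ q' (k h))) (iE _ D'i); exact: eq_integrable.
  move=> x _; rewrite /D'; rewrite minEle; case: ifP => _; first exact: pD.
  by rewrite (le_trans (psiB _ _ _))// ler_wpDl// psi0.
by apply: ae_imp => x /le_trans; apply; rewrite lerD2l ge_min lexx.
Qed.

Lemma weak_limit_le_bound (q : Q) (k : nat -> nat) (g : T -> R) :
  mu.-integrable [set: T] (EFin \o g) ->
  (forall E, measurable E ->
    (fun h => \int[mu]_(x in E) psi q (k h) x) @ \oo --> \int[mu]_(x in E) g x) ->
  {ae mu, forall x, g x <= B q x}.
Proof.
move=> gi lg; apply: (ae_le_integral gi (Bi q)) => E mE.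
have c1 := lg E mE.
rewrite -(cvg_lim _ c1)//; apply: limr_le; first by apply/cvg_ex; eexists; exact: c1.
apply: nearW => h; apply: le_Rintegral => //.
- by apply: (dominated_integrable mE (mpsi q (k h)) _ (Bi q)) => x; rewrite ger0_norm.
- exact: (integrableS measurableT mE (@subsetT _ _) (Bi q)).
Qed.

End weak_compactness.

(** * Compactness of equicontinuous integrands *)

Section integrands.
Context d (T : measurableType d) (R : realType) (I : countType).
Variable mu : {finite_measure set T -> \bar R}.
Variable V : normedModType R.
Variables (code : nat -> V -> I) (pt : nat * I -> V).
Hypothesis codeP : forall k z, `|pt (k, code k z) - z| < k.+1%:R^-1.
Variables (beta : T -> V -> R) (W : nat -> nat -> T -> R).
Hypothesis beta_int : forall z, mu.-integrable [set: T] (EFin \o beta^~ z).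
Hypothesis beta_cont : forall x, continuous (beta x).
Hypothesis mW : forall s k, measurable_fun [set: T] (W s k).
Hypothesis W0 : forall s k x, 0 <= W s k x.
Hypothesis Wcvg : forall s x, (fun k => W s k x) @ \oo --> (0 : R).

(** The modulus is indexed by a radius s and a mesh 1/(k+1) instead of reals, so
  that only countably many functions of x occur. *)
Definition has_modulus (phi : T -> V -> R) := forall s k x z z',
  `|z| < s%:R -> `|z'| < s%:R -> `|z - z'| < k.+1%:R^-1 ->
  `|phi x z - phi x z'| <= W s k x.

Definition integrand (phi : T -> V -> R) :=
  [/\ forall z, measurable_fun [set: T] (phi^~ z),
      forall x z, 0 <= phi x z, forall x z, phi x z <= beta x z &
      has_modulus phi].

Let grid z j := pt (j, code j z).

(** An integer that exceeds the norm of every point at distance less than 1. *)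
Definition norm_bound (z : V) := (Num.trunc `|z|).+2.

Lemma lt_norm_bound z z' : `|z' - z| < 1 -> `|z'| < (norm_bound z)%:R.
Proof.
move=> zz'; have -> : z' = z' - z + z by rewrite subrK.
rewrite (le_lt_trans (ler_normD _ _))// /norm_bound -addn1 natrD addrC ltrD//.
by rewrite truncnS_gt.
Qed.

Lemma near_grid z z' : `|z' - z| < 1 -> \forall j \near \oo, `|grid z' j| < (norm_bound z)%:R.
Proof.
move=> zz'.
have e0 : 0 < 1 - `|z' - z| by rewrite subr_gt0.
have := near_infty_natSinv_lt (PosNum e0); apply: filterS => j /= je.
apply: lt_norm_bound.
have -> : grid z' j - z = grid z' j - z' + (z' - z) by rewrite addrA subrK.
rewrite (le_lt_trans (ler_normD _ _))// -ltrBrDr.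
by apply: lt_trans je; exact: codeP.
Qed.

Lemma grid_cvg z : grid z @ \oo --> z.
Proof.
apply/cvgrPdist_lt => e e0.
have := near_infty_natSinv_lt (PosNum e0); apply: filterS => j /= je.
by rewrite distrC; apply: lt_trans je; exact: codeP.
Qed.

Lemma modulus_continuous phi x : has_modulus phi -> continuous (phi x).
Proof.
move=> phiW z; apply/cvgrPdist_le => e e0.
have /cvgrPdist_lt /(_ _ e0)[k _ Wk] := Wcvg (norm_bound z) x.
have {}Wk : W (norm_bound z) k x < e.
  by have := Wk k (leqnn k); rewrite sub0r normrN ger0_norm.
have k0 : 0 < k.+1%:R^-1 :> R by rewrite invr_gt0.
apply: filterS (nbhsx_ballx z _ k0) => z'.
rewrite -ball_normE /ball_ /= => zz'; apply: (le_trans _ (ltW Wk)).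
apply: phiW => //; apply: lt_norm_bound; rewrite ?subrr ?normr0//.
rewrite distrC (lt_le_trans zz')// invf_le1// ler1n//.
Qed.

(** Each bound fails on a null set and there are countably many of them, so one
  null set serves for all.  The densities are put equal to zero on it, which
  makes the bounds hold at every point. *)
Lemma grid_integrands_limit (phi : nat -> T -> V -> R) (G : nat -> set T) :
  (forall h, integrand (phi h)) -> (forall i, measurable (G i)) ->
  dynkin_generated mu G ->
  exists k : nat -> nat, {homo k : i j / (i < j)%N} /\
  exists g : nat * I -> T -> R,
    [/\ forall q, measurable_fun [set: T] (g q),
      forall q x, 0 <= g q x, forall q x, g q x <= beta x (pt q),
      forall q q' s l x, `|pt q| < s%:R -> `|pt q'| < s%:R ->
        `|pt q - pt q'| < l.+1%:R^-1 -> `|g q x - g q' x| <= W s l x &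
      forall q E, measurable E ->
        (fun h => \int[mu]_(x in E) phi (k h) x (pt q)) @ \oo -->
        \int[mu]_(x in E) g q x].
Proof.
move=> phiI mG dG.
have mphi q h : measurable_fun [set: T] (fun x => phi h x (pt q)) by have [+ _ _ _] := phiI h; exact.
have phi0 q h x : 0 <= phi h x (pt q) by have [_ + _ _] := phiI h; exact.
have phiB q h x : phi h x (pt q) <= beta x (pt q) by have [_ _ + _] := phiI h; exact.
have phiW h : has_modulus (phi h) by have [_ _ _ +] := phiI h.
have [k [kH [g gE]]] := weak_compactness mphi phi0 phiB (fun q => beta_int (pt q)) mG dG.
exists k; split => //.
have mg q : measurable_fun [set: T] (g q) by have [] := gE q.
have g0 q x : 0 <= g q x by have [_ ] := gE q.
have gi q : mu.-integrable [set: T] (EFin \o g q) by have [] := gE q.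
have gl q E : measurable E -> (fun h => \int[mu]_(x in E) phi (k h) x (pt q)) @ \oo -->
        \int[mu]_(x in E) g q x by have [_ _ _ +] := gE q; exact.
have ae1 : {ae mu, forall x, forall q, g q x <= beta x (pt q)}.
  apply/ae_forall_countable => q.
  exact: (weak_limit_le_bound mphi phi0 phiB (fun q => beta_int (pt q)) (gi q) (gl q)).
have ae2 : {ae mu, forall x, forall r : (nat * I) * (nat * I) * (nat * nat),
    `|pt r.1.1| < r.2.1%:R -> `|pt r.1.2| < r.2.1%:R ->
        `|pt r.1.1 - pt r.1.2| < r.2.2.+1%:R^-1 -> g r.1.1 x <= g r.1.2 x + W r.2.1 r.2.2 x}.
  apply/ae_forall_countable => -[[q q'] [s l]] /=.
  have [qs|?] := boolP (`|pt q| < s%:R); last by apply: aeW.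
  have [q's|?] := boolP (`|pt q'| < s%:R); last by apply: aeW.
  have [qq'|?] := boolP (`|pt q - pt q'| < l.+1%:R^-1); last by apply: aeW.
  have := weak_limit_le mphi phi0 phiB (fun q => beta_int (pt q)) (mW s l) (W0 s l) _
    (gi q) (gi q') (gl q) (gl q').
  move=> H; apply: ae_imp (H _) => //.
  move=> h x; have := phiW h s l x _ _ qs q's qq'.
  by rewrite ler_norml => /andP[_]; rewrite lerBlDl addrC.
have [N [mN N0 NH]] := ae_and ae1 ae2.
pose g' q := g q \_ (~` N).
have mg' q : measurable_fun [set: T] (g' q).
  by apply/(measurable_restrictT _ (measurableC mN)); exact: measurable_funTS.
have gN x : x \in ~` N -> (forall q, g q x <= beta x (pt q)) /\
   (forall r : (nat * I) * (nat * I) * (nat * nat),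
    `|pt r.1.1| < r.2.1%:R -> `|pt r.1.2| < r.2.1%:R ->
        `|pt r.1.1 - pt r.1.2| < r.2.2.+1%:R^-1 -> g r.1.1 x <= g r.1.2 x + W r.2.1 r.2.2 x).
  by rewrite inE => xN; apply: contrapT => Hx; apply: xN; apply: NH.
exists g'; split.
- by [].
- by move=> q x; rewrite /g' patchE; case: ifP.
- move=> q x; rewrite /g' patchE; case: ifPn => [/gN[+ _]|_]; first exact.
  exact: (le_trans (phi0 q 0%N x) (phiB q 0%N x)).
- move=> q q' s l x qs q's qq'; rewrite /g' !patchE; case: ifPn => [/gN[_ H]|_]; last first.
    by rewrite subrr normr0.
  rewrite ler_norml; apply/andP; split.
    have := H (q', q, (s, l)) q's qs; rewrite distrC => /(_ qq') /=; lra.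
  have := H (q, q', (s, l)) qs q's qq' => /=; lra.
- move=> q E mE.
  rewrite (_ : \int[mu]_(x in E) g' q x = \int[mu]_(x in E) g q x); first exact: gl.
  rewrite /Rintegral; congr fine; apply: ae_eq_integral.
  + exact: mE.
  + by apply/measurable_EFinP; apply: measurable_funTS.
  + by apply/measurable_EFinP; exact: measurable_funTS.
  + exists N; split => // x /= /not_implyP[_]; rewrite /g' patchE.
    by case: ifPn => //; rewrite notin_setE => /contrapT.
Qed.

(** The limit integrand at z is the limit of the densities at the grid points
  that approximate z; it exists because the densities inherit the modulus. *)
Theorem integrand_compactness (phi : nat -> T -> V -> R) (G : nat -> set T) :
  (forall h, integrand (phi h)) -> (forall i, measurable (G i)) ->
  dynkin_generated mu G ->
  exists k : nat -> nat, {homo k : i j / (i < j)%N} /\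
  exists phi_oo, integrand phi_oo /\
    forall q E, measurable E ->
        (fun h => \int[mu]_(x in E) phi (k h) x (pt q)) @ \oo -->
        \int[mu]_(x in E) phi_oo x (pt q).
Proof.
move=> phiI mG dG.
have [k [kH [g [mg g0 gB gW gl]]]] := grid_integrands_limit phiI mG dG.
exists k; split => //.
have gc x z : cvgn (fun j => g (j, code j z) x).
  apply/cauchy_cvgP/cauchy_exP => e e0.
  have /cvgrPdist_lt /(_ _ e0)[l _ Wl] := Wcvg (norm_bound z) x.
  have {}Wl : W (norm_bound z) l x < e.
    by have := Wl l (leqnn l); rewrite sub0r normrN ger0_norm.
  have l0 : 0 < l.+1%:R^-1 / 2 :> R by rewrite divr_gt0// invr_gt0.
  have [M _ MH] := near_infty_natSinv_lt (PosNum l0).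
  have [M' _ M'H] := near_grid (ltac:(by rewrite subrr normr0) : `|z - z| < 1).
  pose M2 := maxn M M'.
  have H j : (M2 <= j)%N -> `|grid z j| < (norm_bound z)%:R /\ `|grid z j - z| < l.+1%:R^-1 / 2.
    rewrite geq_max => /andP[Mj M'j]; split; first exact: M'H.
    exact: lt_trans (codeP j z) (MH j Mj).
  exists (g (M2, code M2 z) x).
  suff : \forall h \near \oo, ball (g (M2, code M2 z) x) e (g (h, code h z) x) by [].
  exists M2 => // h /= Mh; rewrite /ball /=; apply: le_lt_trans Wl.
  have [H1 H2] := H _ (leqnn M2); have [H3 H4] := H _ Mh.
  apply: gW => //.
  have -> : pt (M2, code M2 z) - pt (h, code h z) = (grid z M2 - z) - (grid z h - z).
    by rewrite opprB addrA subrK.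
  by rewrite (le_lt_trans (ler_normB _ _))// (splitr l.+1%:R^-1) ltrD.
pose phi_oo x z := lim ((fun j => g (j, code j z) x) @ \oo).
have pW : has_modulus phi_oo.
  move=> s l x z z' zs z's zz'.
  have c : (fun j => `|g (j, code j z) x - g (j, code j z') x|) @ \oo --> `|phi_oo x z - phi_oo x z'|.
    by apply: cvg_norm; apply: cvgB; exact: gc.
  rewrite -(cvg_lim _ c); last exact: Rhausdorff.
  apply: limr_le; first by apply/cvg_ex; eexists; exact: c.
  have near_lt (y : V) (r : R) : `|y| < r -> forall u : nat -> V, u @ \oo --> y ->
      \forall j \near \oo, `|u j| < r.
    by move=> yr u /cvg_norm uy; exact: (cvgr_lt _ uy _ yr).
  have N1 := near_lt _ _ zs _ (@grid_cvg z).
  have N2 := near_lt _ _ z's _ (@grid_cvg z').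
  have N3 := near_lt _ _ zz' _ (cvgB (@grid_cvg z) (@grid_cvg z')).
  near=> j; apply: gW; near: j; [exact: N1|exact: N2|exact: N3].
have pgrid q x : phi_oo x (pt q) = g q x.
  have c : (fun j => g (j, code j (pt q)) x) @ \oo --> g q x.
    apply/cvgrPdist_le => e e0.
    have /cvgrPdist_lt /(_ _ e0)[l _ Wl] := Wcvg (norm_bound (pt q)) x.
    have {}Wl : W (norm_bound (pt q)) l x < e.
      by have := Wl l (leqnn l); rewrite sub0r normrN ger0_norm.
    have l0 : 0 < l.+1%:R^-1 :> R by rewrite invr_gt0.
    have N1 := near_infty_natSinv_lt (PosNum l0).
    have N2 := near_grid (ltac:(by rewrite subrr normr0) : `|pt q - pt q| < 1).
    near=> j; apply: (le_trans _ (ltW Wl)); apply: gW.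
    - by apply: lt_norm_bound; rewrite subrr normr0.
    - by near: j; exact: N2.
    - rewrite distrC; apply: lt_trans (codeP j _) _; near: j; exact: N1.
  exact: cvg_lim c.
exists phi_oo; split; last first.
  move=> q E mE; rewrite (_ : (fun x => phi_oo x (pt q)) = g q); first exact: gl.
  by apply/funext => x.
split => //.
- move=> z; apply: (measurable_fun_cvg (h := fun j x => g (j, code j z) x)).
    by move=> j; exact: mg.
  by move=> x _; exact: gc.
- by move=> x z; apply: limr_ge; [exact: gc|exact: nearW].
- move=> x z; have c : (fun j => beta x (grid z j)) @ \oo --> beta x z.
    exact: continuous_cvg (@beta_cont x z) (@grid_cvg z).
  rewrite -(cvg_lim _ c)//; apply: ler_lim; [exact: gc|by apply/cvg_ex; eexists; exact: c|].
  by apply: nearW => j; exact: gB.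
Unshelve. all: by end_near. Qed.

End integrands.

(** * Convergence of superpositions *)

Section superposition.
Context d (T : measurableType d) (R : realType) (I : countType).
Variable mu : {finite_measure set T -> \bar R}.
Variable V : normedModType R.
Variables (code : nat -> V -> I) (pt : nat * I -> V).
Hypothesis codeP : forall k z, `|pt (k, code k z) - z| < k.+1%:R^-1.
Variables (beta : T -> V -> R) (W : nat -> nat -> T -> R).
Hypothesis mW : forall s k, measurable_fun [set: T] (W s k).
Hypothesis W0 : forall s k x, 0 <= W s k x.
Hypothesis Wcvg : forall s x, (fun k => W s k x) @ \oo --> (0 : R).
Variables (p : R) (b : T -> R) (c : R).
Hypothesis p0 : 0 <= p.
Hypothesis c0 : 0 <= c.
Hypothesis b_int : mu.-integrable [set: T] (EFin \o b).
Hypothesis beta_le : forall x z, beta x z <= b x + c * `|z| `^ p.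

(** Measurability of a map into a normed space, expressed by the level sets
  of its grid codes; it avoids a sigma-algebra on the codomain. *)
Definition grid_measurable (w : T -> V) := forall k i, measurable [set x | code k (w x) = i].

Definition p_integrable (w : T -> V) :=
  mu.-integrable [set: T] (fun x => (`|w x| `^ p)%:E).

Let grid (w : T -> V) j x := pt (j, code j (w x)).

(** A Caratheodory function of x and w(x) is the pointwise limit of the
  functions obtained by rounding w to the grid. *)
Lemma measurable_superposition (phi : T -> V -> R) w : grid_measurable w ->
  (forall z, measurable_fun [set: T] (phi^~ z)) -> (forall x, continuous (phi x)) ->
  measurable_fun [set: T] (fun x => phi x (w x)).
Proof.
move=> nw mphi cphi.
apply: (measurable_fun_cvg (h := fun j x => phi x (grid w j x))).
  move=> j; apply: (measurable_countable_comp (j := code j \o w)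
    (F := fun i x => phi x (pt (j, i)))); [exact: nw|by move=> i; exact: mphi].
move=> x _; apply: continuous_cvg; first exact: cphi.
exact: (grid_cvg codeP).
Qed.

Lemma grid_measurable_grid w j : grid_measurable w -> grid_measurable (grid w j).
Proof.
move=> nw k i.
rewrite (_ : [set x | _] = \bigcup_l (if unpickle l is Some i' then
    (if code k (pt (j, i')) == i then [set x | code j (w x) = i'] else set0) else set0)).
  apply: bigcupT_measurable => l; case: unpickle => // i'; case: ifP => // _.
apply/seteqP; split => [x /= <-|x [l _]].
  by exists (pickle (code j (w x))) => //; rewrite pickleK eqxx.
by case: unpickle => // i'; case: ifP => // /eqP <- /= <-.
Qed.

Lemma measurable_norm_sub w w' : grid_measurable w -> grid_measurable w' -> measurable_fun [set: T] (fun x => `|w x - w' x|).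
Proof.
move=> nw nw'; apply: (measurable_superposition (phi := fun x z => `|z - w' x|) nw).
  move=> z; apply: (measurable_superposition (phi := fun x z' => `|z - z'|) nw').
    by move=> z'; exact: measurable_cst.
  move=> x z'; apply: cvg_norm; apply: cvgB; [exact: cvg_cst|exact: cvg_id].
move=> x z'; apply: cvg_norm; apply: cvgB; [exact: cvg_id|exact: cvg_cst].
Qed.

Lemma measurable_grid_norm w : grid_measurable w -> measurable_fun [set: T] (fun x => `|w x|).
Proof.
move=> nw; apply: (measurable_superposition (phi := fun x z => `|z|) nw).
  by move=> z; exact: measurable_cst.
by move=> x z; exact: norm_continuous.
Qed.

Lemma powR_add_le (s t : R) : 0 <= s -> 0 <= t ->
  (s + t) `^ p <= 2 `^ p * (s `^ p + t `^ p).
Proof.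
move=> s0 t0; rewrite mulrDr -!powRM//.
have [st|/ltW ts] := leP s t.
  rewrite (@le_trans _ _ ((2 * t) `^ p))//; last by rewrite lerDr powR_ge0.
  by apply: ge0_ler_powR => //; rewrite ?nnegrE ?addr_ge0 ?mulr_ge0//; lra.
rewrite (@le_trans _ _ ((2 * s) `^ p))//; last by rewrite lerDl powR_ge0.
by apply: ge0_ler_powR => //; rewrite ?nnegrE ?addr_ge0 ?mulr_ge0//; lra.
Qed.

(** Bounds the growth function at all points within distance 1 of w(x). *)
Definition local_bound (w : T -> V) x := `|b x| + c * (2 `^ p * (`|w x| `^ p + 1)).

Lemma local_boundP w x z : `|z - w x| <= 1 -> beta x z <= local_bound w x.
Proof.
move=> zw; apply: (le_trans (beta_le x z)); apply: lerD; first exact: ler_norm.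
apply: ler_wpM2l => //.
have zw1 : `|z| <= `|w x| + 1.
  by have -> : z = w x + (z - w x) by [rewrite addrC subrK]; rewrite (le_trans (ler_normD _ _))// lerD2l.
apply: (@le_trans _ _ ((`|w x| + 1) `^ p)).
  by apply: ge0_ler_powR => //; rewrite ?nnegrE ?addr_ge0.
by rewrite (le_trans (powR_add_le _ _))// powR1.
Qed.

Lemma local_bound_ge0 w x : 0 <= local_bound w x.
Proof. by rewrite /local_bound addr_ge0// !mulr_ge0// ?powR_ge0// addr_ge0// powR_ge0. Qed.

Lemma local_bound_integrable w : p_integrable w ->
  mu.-integrable [set: T] (EFin \o local_bound w).
Proof.
move=> wi.
have ci (r : R) : mu.-integrable [set: T] (EFin \o cst r) by exact: finite_measure_integrable_cst.
have := integrableD measurableT (integrable_norm b_int)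
  (integrableZl measurableT c (integrableZl measurableT (2 `^ p)
    (integrableD measurableT wi (ci 1)))).
by apply: eq_integrable.
Qed.

(** Bounds the oscillation of any integrand of the class on the ball of radius
  1/(j+1) around w(x).  The minimum with the growth bound makes it integrable,
  since the modulus itself is evaluated at a radius that depends on x. *)
Definition oscillation (w : T -> V) j x := Num.min (W (norm_bound (w x)) j x) (local_bound w x).

Lemma oscillationP phi w j x z : integrand beta W phi ->
  `|z - w x| < j.+1%:R^-1 -> `|phi x z - phi x (w x)| <= oscillation w j x.
Proof.
move=> [_ phi0 phib phiW] zw.
have j1 : j.+1%:R^-1 <= 1 :> R by rewrite invf_le1// ler1n.
rewrite le_min; apply/andP; split.
  apply: phiW => //; apply: lt_norm_bound; first exact: lt_le_trans zw j1.
  by rewrite subrr normr0.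
have h1 := le_trans (phib x z) (local_boundP (le_trans (ltW zw) j1)).
have h2 : phi x (w x) <= local_bound w x.
  by apply: (le_trans (phib _ _)); apply: local_boundP; rewrite subrr normr0.
by rewrite ler_norml; have := phi0 x z; have := phi0 x (w x); lra.
Qed.

Lemma oscillation_ge0 w j x : 0 <= oscillation w j x.
Proof. by rewrite le_min W0 local_bound_ge0. Qed.

Lemma measurable_oscillation w j : grid_measurable w -> measurable_fun [set: T] (oscillation w j).
Proof.
move=> nw; apply: measurable_minr.
  apply: (measurable_countable_comp (j := fun x => norm_bound (w x)) (F := fun s x => W s j x)) => //.
  case=> [|[|s]]; [rewrite (_ : [set x | _] = set0) -?subset0//..|].
  rewrite (_ : [set x | _] = (fun x => `|w x|) @^-1` `[s%:R, s.+1%:R[).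
    rewrite -[X in measurable X]setTI; apply: (measurable_grid_norm nw) => //.
  apply/seteqP; split => x /=; rewrite in_itv/= /norm_bound.
    by move=> [<-]; exact: truncn_itv.
  by move=> /truncn_def ->.
apply: measurable_funD; first by apply: measurableT_comp => //; have /measurable_int/measurable_EFinP := b_int.
apply: measurable_funM => //; apply: measurable_funM => //; apply: measurable_funD => //.
exact: (measurableT_comp (measurable_powR p) (measurable_grid_norm nw)).
Qed.

Lemma oscillation_integrable w j : grid_measurable w -> p_integrable w ->
  mu.-integrable [set: T] (EFin \o oscillation w j).
Proof.
move=> nw wi; apply: (dominated_integrable measurableT (measurable_oscillation j nw) _ (local_bound_integrable wi)).
by move=> x; rewrite ger0_norm ?oscillation_ge0// ge_min lexx orbT.
Qed.

Lemma oscillation_cvg w : grid_measurable w -> p_integrable w ->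
  (fun j => \int[mu]_x oscillation w j x) @ \oo --> (0 : R).
Proof.
move=> nw wi; rewrite /Rintegral.
apply: fine_cvg.
rewrite -[X in _ --> X](integral0 mu [set: T]).
apply: (dominated_cvg measurableT _ _ _ (local_bound_integrable wi)).
- by move=> j; apply/measurable_EFinP; exact: measurable_oscillation.
- move=> x _; apply: cvg_EFin; first exact: nearW.
  apply: (@squeeze_cvgr _ _ _ _ (cst 0) (fun j => W (norm_bound (w x)) j x)).
  + by apply: nearW => j; rewrite oscillation_ge0 ge_min lexx.
  + exact: cvg_cst.
  + exact: Wcvg.
- by [].
- by move=> j x _ /=; rewrite lee_fin ger0_norm ?oscillation_ge0// ge_min lexx orbT.
Qed.

Lemma integrand_measurable phi w : integrand beta W phi -> grid_measurable w ->
  measurable_fun [set: T] (fun x => phi x (w x)).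
Proof.
move=> [mphi _ _ phiW] nw; apply: measurable_superposition => //.
by move=> x; exact: (modulus_continuous W0 Wcvg phiW).
Qed.

Lemma integrand_norm_le phi w x z : integrand beta W phi -> `|z - w x| <= 1 ->
  `|phi x z| <= local_bound w x.
Proof.
move=> [_ phi0 phib _] zw; rewrite ger0_norm//.
exact: le_trans (phib _ _) (local_boundP zw).
Qed.

Lemma integrand_integrable phi w E : integrand beta W phi -> grid_measurable w -> p_integrable w ->
  measurable E -> mu.-integrable E (EFin \o (fun x => phi x (w x))).
Proof.
move=> phiI nw wi mE.
apply: (dominated_integrable mE (integrand_measurable phiI nw) _ (local_bound_integrable wi)).
by move=> x; apply: integrand_norm_le => //; rewrite subrr normr0.
Qed.

Lemma Rintegral_dist_le (u v B : T -> R) (E : set T) : measurable E ->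
  mu.-integrable E (EFin \o u) -> mu.-integrable E (EFin \o v) ->
  mu.-integrable [set: T] (EFin \o B) -> (forall x, `|u x - v x| <= B x) ->
  `|\int[mu]_(x in E) u x - \int[mu]_(x in E) v x| <= \int[mu]_(x in setT) B x.
Proof.
move=> mE ui vi Bi uvB.
have uvi : mu.-integrable E (EFin \o (fun x => u x - v x)).
  by have := integrableB mE ui vi; apply: eq_integrable.
have mB : measurable_fun [set: T] B by have /measurable_int/measurable_EFinP := Bi.
have B0 x : 0 <= B x by apply: le_trans (uvB x).
have BE : mu.-integrable E (EFin \o B).
  exact: (integrableS measurableT mE (@subsetT _ _) Bi).
rewrite -RintegralB//.
apply: (le_trans (le_normr_Rintegral mE uvi)).
apply: (@le_trans _ _ (\int[mu]_(x in E) B x)).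
  by apply: le_Rintegral; [exact: mE|exact: integrable_norm uvi|exact: BE|move=> x _; exact: uvB].
rewrite /Rintegral; apply: fine_le.
- exact: integrable_fin_num BE.
- exact: integrable_fin_num Bi.
- apply: ge0_subset_integral; [exact: mE|exact: measurableT| |by move=> x _; rewrite lee_fin|exact: subsetT].
  exact/measurable_EFinP.
Qed.

(** On each of the countably many level sets of the rounded map the integrand
  is evaluated at a fixed grid point. *)
Lemma superposition_grid_cvg (phi : nat -> T -> V -> R) phi_oo w j E :
  (forall h, integrand beta W (phi h)) -> integrand beta W phi_oo ->
  (forall q E, measurable E ->
    (fun h => \int[mu]_(x in E) phi h x (pt q)) @ \oo -->
    \int[mu]_(x in E) phi_oo x (pt q)) ->
  grid_measurable w -> p_integrable w -> measurable E ->
  (fun h => \int[mu]_(x in E) phi h x (grid w j x)) @ \oo -->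
  \int[mu]_(x in E) phi_oo x (grid w j x).
Proof.
move=> phiI phi_ooI phil nw wi mE.
pose F k := if @pickle_inv I k is Some i then E `&` [set x | code j (w x) = i] else set0.
have mF k : measurable (F k).
  by rewrite /F; case: (@pickle_inv I k) => // i; apply: measurableI => //; exact: nw.
have FE : \bigcup_k F k = E.
  apply/seteqP; split => [x [k _]|x Ex].
    by rewrite /F; case: (@pickle_inv I k) => // i [].
  by exists (pickle (code j (w x))) => //; rewrite /F pickleK_inv.
have tF : trivIset setT F.
  apply/trivIsetP => k l _ _ kl; rewrite -subset0 => x [].
  rewrite /F; case k_i: (@pickle_inv I k) => [i|//]; case l_i': (@pickle_inv I l) => [i'|//].
  move=> [_ /= ji] [_ /= ji']; move/eqP: kl; apply.
  have := @pickle_invK I l; have := @pickle_invK I k.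
  by rewrite k_i l_i' /= -ji -ji' => -> ->.
have ng := grid_measurable_grid j nw.
have j1 x : `|grid w j x - w x| <= 1.
  by apply: (le_trans (ltW (codeP j (w x)))); rewrite invf_le1// ler1n.
have mg psi : integrand beta W psi -> measurable_fun [set: T] (fun x => psi x (grid w j x)).
  by move=> psiI; exact: integrand_measurable.
have Bg psi x : integrand beta W psi -> `|psi x (grid w j x)| <= local_bound w x.
  by move=> psiI; apply: integrand_norm_le.
have FI psi k : \int[mu]_(x in F k) psi x (grid w j x) =
    if @pickle_inv I k is Some i then \int[mu]_(x in F k) psi x (pt (j, i)) else 0.
  rewrite /F; case: (@pickle_inv I k) => [i|]; last by rewrite Rintegral_set0.
  by apply: eq_Rintegral => x; rewrite inE => -[_ /= <-].
have Fl k : (fun h => \int[mu]_(x in F k) phi h x (grid w j x)) @ \oo -->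
    \int[mu]_(x in F k) phi_oo x (grid w j x).
  rewrite FI; under eq_fun do rewrite FI.
  by case: (@pickle_inv I k) => [i|]; [exact: phil|exact: cvg_cst].
have [L [uL lL]] := disjoint_union_cvg (fun h => mg _ (phiI h)) (fun h x => Bg _ x (phiI h))
  (local_bound_integrable wi) mF tF Fl.
have [L' [uL' lL']] := disjoint_union_cvg (u := fun _ x => phi_oo x (grid w j x)) (fun h => mg _ phi_ooI) (fun h x => Bg _ x phi_ooI)
  (local_bound_integrable wi) mF tF (fun k => cvg_cst _).
rewrite FE in uL uL'.
have -> : \int[mu]_(x in E) phi_oo x (grid w j x) = L'.
  apply: (cvg_unique _ _ uL'); last exact: cvg_cst.
  exact: norm_hausdorff.
have <- // : L = L'.
by apply: (cvg_unique _ lL lL'); exact: norm_hausdorff.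
Qed.

(** Rounding w to the grid changes all the integrals by at most the integral
  of the oscillation, uniformly along the sequence. *)
Lemma superposition_cvg (phi : nat -> T -> V -> R) phi_oo w E :
  (forall h, integrand beta W (phi h)) -> integrand beta W phi_oo ->
  (forall q E, measurable E ->
    (fun h => \int[mu]_(x in E) phi h x (pt q)) @ \oo -->
    \int[mu]_(x in E) phi_oo x (pt q)) ->
  grid_measurable w -> p_integrable w -> measurable E ->
  (fun h => \int[mu]_(x in E) phi h x (w x)) @ \oo -->
  \int[mu]_(x in E) phi_oo x (w x).
Proof.
move=> phiI phi_ooI phil nw wi mE.
have d0 := oscillation_cvg nw wi.
have j1 j x : `|grid w j x - w x| <= 1.
  by apply: (le_trans (ltW (codeP j (w x)))); rewrite invf_le1// ler1n.
have close psi j : integrand beta W psi ->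
   `|\int[mu]_(x in E) psi x (w x) - \int[mu]_(x in E) psi x (grid w j x)| <=
   \int[mu]_(x in setT) oscillation w j x.
  move=> psiI; apply: Rintegral_dist_le.
  - exact: mE.
  - exact: integrand_integrable.
  - apply: (dominated_integrable mE (integrand_measurable psiI (grid_measurable_grid j nw)) _ (local_bound_integrable wi)).
    by move=> x; exact: integrand_norm_le.
  - exact: oscillation_integrable.
  - by move=> x; rewrite distrC; apply: oscillationP => //; exact: codeP.
have [L [uL lL]] := cvgn_uniform_approx (fun j => superposition_grid_cvg (j := j) phiI phi_ooI phil nw wi mE)
  (fun j h => close _ j (phiI h)) d0.
suff <- : L = \int[mu]_(x in E) phi_oo x (w x) by [].
apply: (cvg_unique _ lL); first exact: norm_hausdorff.
have := d0; move/cvgrPdist_le => d0'; apply/cvgrPdist_le => e e0.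
have := d0' e e0; apply: filterS => j; rewrite sub0r normrN => /(le_trans (ler_norm _)).
exact: le_trans (close _ j phi_ooI).
Qed.

(** Where w_h is close to w the oscillation controls the difference.  Where it
  is not, the p-growth bounds the difference by a multiple of |w_h - w|^p and by
  a function B2 of x; the part of B2 above a level N is small in integral, and
  the part below is at most N times the p-th power of (N+1)|w_h - w|, because
  |w_h - w| is at least 1/(N+1) there. *)
Lemma superposition_continuous (phi : nat -> T -> V -> R) (w : T -> V) (w_ : nat -> T -> V) E :
  (forall h, integrand beta W (phi h)) -> grid_measurable w -> p_integrable w ->
  (forall h, grid_measurable (w_ h)) -> (forall h, p_integrable (w_ h)) ->
  (fun h => \int[mu]_(x in setT) (`|w_ h x - w x| `^ p)) @ \oo --> (0 : R) ->
  measurable E ->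
  (fun h => \int[mu]_(x in E) phi h x (w_ h x) - \int[mu]_(x in E) phi h x (w x)) @ \oo --> (0 : R).
Proof.
move=> phiI nw wi nw_ wi_ w_w mE.
pose C2 := 2 `^ p : R.
pose B2 x := `|b x| + c * (C2 * (`|w x| `^ p)).
pose tail N x := Num.max (B2 x - N%:R) 0.
pose dl h x := `|w_ h x - w x| `^ p.
have mb : measurable_fun [set: T] b by have /measurable_int/measurable_EFinP := b_int.
have mB2 : measurable_fun [set: T] B2.
  apply: measurable_funD; first exact: measurableT_comp.
  apply: measurable_funM => //; apply: measurable_funM => //.
  exact: (measurableT_comp (measurable_powR p) (measurable_grid_norm nw)).
have B2i : mu.-integrable [set: T] (EFin \o B2).
  have := integrableD measurableT (integrable_norm b_int)
    (integrableZl measurableT c (integrableZl measurableT (2 `^ p) wi)).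
  by apply: eq_integrable.
have B20 x : 0 <= B2 x by rewrite addr_ge0// !mulr_ge0// powR_ge0.
have mtail N : measurable_fun [set: T] (tail N).
  by apply: measurable_maxr => //; exact: measurable_funB.
have tail0 N x : 0 <= tail N x by rewrite le_max lexx orbT.
have tailB N x : tail N x <= B2 x by rewrite ge_max B20 andbT gerBl.
have taili N : mu.-integrable [set: T] (EFin \o tail N).
  by apply: (dominated_integrable measurableT (mtail N) _ B2i) => x; rewrite ger0_norm.
have tail_cvg : (fun N => \int[mu]_x tail N x) @ \oo --> (0 : R).
  rewrite /Rintegral; apply: fine_cvg.
  rewrite -[X in _ --> X](integral0 mu [set: T]).
  apply: (dominated_cvg measurableT _ _ _ B2i).
  - by move=> N; exact/measurable_EFinP.
  - move=> x _; apply: cvg_EFin; first exact: nearW.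
    apply: (@cvg_trans _ ((fun=> 0) @ \oo)); last exact: cvg_cst.
    apply: near_eq_cvg; near=> N; rewrite /tail; apply/esym/max_idPr.
    rewrite subr_le0; near: N; exact: nbhs_infty_ger.
  - by [].
  - by move=> N x _ /=; rewrite lee_fin ger0_norm.
have dli h : mu.-integrable [set: T] (EFin \o dl h).
  have := integrableZl measurableT (2 `^ p) (integrableD measurableT (wi_ h) wi).
  apply: le_integrable => //.
    apply/measurable_EFinP.
    exact: (measurableT_comp (measurable_powR p) (measurable_norm_sub (nw_ h) nw)).
  move=> x _ /=; rewrite lee_fin; apply: le_trans (ler_norm _).
  rewrite ger0_norm ?powR_ge0//.
  apply: le_trans (powR_add_le _ _) => //.
  by apply: ge0_ler_powR => //; rewrite ?nnegrE ?addr_ge0// ler_normB.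
pose A N x := oscillation w N x + tail N x.
have Ai N : mu.-integrable [set: T] (EFin \o A N).
  have := integrableD measurableT (oscillation_integrable N nw wi) (taili N).
  exact: eq_integrable.
(* K N collects the constants in front of the p-th power of the distance:
   N (N+1)^p pays for the part of B2 below N, and c 2^p for the growth. *)
pose K N := N%:R * N.+1%:R `^ p + c * C2 : R.
have K0 N : 0 <= K N by rewrite addr_ge0// mulr_ge0// powR_ge0.
have pointwise N h x : `|phi h x (w_ h x) - phi h x (w x)| <= A N x + K N * dl h x.
  have dl0 : 0 <= K N * dl h x by rewrite mulr_ge0// powR_ge0.
  have [near_w|far] := ltP `|w_ h x - w x| N.+1%:R^-1.
    apply: (le_trans (oscillationP (phiI h) near_w)).
    by rewrite /A -addrA lerDl addr_ge0.
  have [_ phi0 phib _] := phiI h.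
  have dl1 : 1 <= N.+1%:R `^ p * dl h x.
    rewrite -powRM//; apply: (@le_trans _ _ (1 `^ p)); first by rewrite powR1.
    apply: ge0_ler_powR => //; rewrite ?nnegrE ?mulr_ge0//.
    by rewrite -ler_pdivrMl// mulr1.
  have h1 : phi h x (w x) <= B2 x.
    apply: (le_trans (phib _ _)); apply: (le_trans (beta_le _ _)).
    apply: lerD; first exact: ler_norm.
    apply: ler_wpM2l => //; rewrite ler_peMl ?powR_ge0//.
    apply: (@le_trans _ _ (2 `^ 0)); first by rewrite powRr0.
    by rewrite ler_powR// ler1n.
  have h2 : phi h x (w_ h x) <= B2 x + c * C2 * dl h x.
    apply: (le_trans (phib _ _)); apply: (le_trans (beta_le _ _)).
    rewrite /B2 -addrA -mulrA -mulrDr -mulrDr.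
    apply: lerD; first exact: ler_norm.
    apply: ler_wpM2l => //; apply: le_trans (powR_add_le _ _) => //.
    apply: ge0_ler_powR => //; rewrite ?nnegrE ?addr_ge0//.
    by rewrite addrC -[in leLHS](subrK (w x) (w_ h x)) ler_normD.
  have h3 : B2 x <= tail N x + N%:R * (N.+1%:R `^ p * dl h x).
    have t1 : B2 x - N%:R <= tail N x by rewrite le_max lexx.
    have t2 : N%:R <= N%:R * (N.+1%:R `^ p * dl h x) by rewrite ler_peMr.
    lra.
  have o0 := oscillation_ge0 w N x.
  have e : K N * dl h x = N%:R * (N.+1%:R `^ p * dl h x) + c * C2 * dl h x.
    by rewrite /K mulrDl mulrA.
  have cd0 : 0 <= c * C2 * dl h x by rewrite !mulr_ge0 ?powR_ge0.
  rewrite ler_norml /A e; have := phi0 x (w x); have := phi0 x (w_ h x).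
  by move=> ? ?; apply/andP; split; lra.
have bound N h : `|\int[mu]_(x in E) phi h x (w_ h x) - \int[mu]_(x in E) phi h x (w x)| <=
    \int[mu]_x oscillation w N x + \int[mu]_x tail N x + K N * \int[mu]_x dl h x.
  have := Rintegral_dist_le mE (integrand_integrable (phiI h) (nw_ h) (wi_ h) mE)
    (integrand_integrable (phiI h) nw wi mE) _ (pointwise N h).
  have Zi := integrableZl measurableT (K N) (dli h).
  have i1 : mu.-integrable [set: T] (EFin \o (fun x => A N x + K N * dl h x)).
    by have := integrableD measurableT (Ai N) Zi; apply: eq_integrable.
  move=> /(_ i1) /le_trans; apply.
  rewrite RintegralD// RintegralD//; [|exact: oscillation_integrable].
  by rewrite RintegralZl.
apply/cvgrPdist_le => e e0.
have e3 : 0 < e / 3 by rewrite divr_gt0.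
have o3 : \forall N \near \oo, \int[mu]_x oscillation w N x <= e / 3.
  by have /cvgrPdist_le /(_ _ e3) := oscillation_cvg nw wi; apply: filterS => N; rewrite sub0r normrN => /(le_trans (ler_norm _)).
have t3 : \forall N \near \oo, \int[mu]_x tail N x <= e / 3.
  by have /cvgrPdist_le /(_ _ e3) := tail_cvg; apply: filterS => N; rewrite sub0r normrN => /(le_trans (ler_norm _)).
have [N [oN tN]] : exists N, \int[mu]_x oscillation w N x <= e / 3 /\ \int[mu]_x tail N x <= e / 3.
  by have [N _ /(_ N (leqnn N))] := filterI o3 t3; exists N.
have d3 : \forall h \near \oo, \int[mu]_x dl h x <= e / 3 / (K N + 1).
  have eK : 0 < e / 3 / (K N + 1) by rewrite divr_gt0// ltr_wpDl.
  by have /cvgrPdist_le /(_ _ eK) := w_w; apply: filterS => h; rewrite sub0r normrN => /(le_trans (ler_norm _)).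
apply: filterS d3 => h; rewrite ler_pdivlMr ?ltr_wpDl// => dh.
rewrite sub0r normrN; apply: (le_trans (bound N h)).
have i0 : 0 <= \int[mu]_x dl h x by apply: Rintegral_ge0 => x _; exact: powR_ge0.
have : K N * \int[mu]_x dl h x <= e / 3 by apply: le_trans dh; rewrite mulrC ler_wpM2l// lerDl.
lra.
Unshelve. all: by end_near. Qed.

End superposition.

(** * A countable grid; the Euclidean norm; inequalities on open sets *)

Section grid.
Context {R : realType} (n : nat).

(** The mesh 1/(2(k+1)) leaves room for the strict inequality of
  [grid_codeP]. *)
Definition grid_code (k : nat) (z : R * 'rV[R]_n) : int * 'rV[int]_n :=
  (Num.floor ((k.+1 * 2)%:R * z.1), map_mx Num.floor ((k.+1 * 2)%:R *: z.2)).

Definition grid_pt (q : nat * (int * 'rV[int]_n)) : R * 'rV[R]_n :=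
  (q.2.1%:~R / (q.1.+1 * 2)%:R, \row_i ((q.2.2 0 i)%:~R / (q.1.+1 * 2)%:R)).

Lemma floor_dist (k : nat) (t : R) :
  `|(Num.floor ((k.+1 * 2)%:R * t))%:~R / (k.+1 * 2)%:R - t| <= k.+1%:R^-1 / 2.
Proof.
set M : R := (k.+1 * 2)%:R.
have M0 : 0 < M by rewrite ltr0n.
have MV : k.+1%:R^-1 / 2 = M^-1 :> R by rewrite /M natrM invfM.
have /andP[fl fu] := floor_itv (M * t).
set q : R := (Num.floor (M * t))%:~R.
have -> : q / M - t = (q - M * t) / M by field; rewrite gt_eqF.
rewrite MV normrM normfV (gtr0_norm M0) ler_piMl ?invr_ge0 ?ltW// ltr_norml.
by move: fl fu; rewrite intrD -/q => ? ?; apply/andP; split; lra.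
Qed.

Lemma grid_codeP k z : `|grid_pt (k, grid_code k z) - z| < k.+1%:R^-1.
Proof.
have k0 : 0 < k.+1%:R^-1 :> R by rewrite invr_gt0.
apply: (@le_lt_trans _ _ (k.+1%:R^-1 / 2)).
  rewrite prod_normE ge_max; apply/andP; split; first exact: floor_dist.
  apply: row_norm_le => [|i]; first by rewrite divr_ge0 ?invr_ge0.
  by rewrite !mxE; exact: floor_dist.
by rewrite ltr_pdivrMr// ltr_pMr// ltr1n.
Qed.

Lemma prod_norm_le (z : R * 'rV[R]_n) : `|z.1| <= `|z| /\ `|z.2| <= `|z|.
Proof. by rewrite prod_normE !le_max !lexx orbT. Qed.

End grid.

Section euclidean.
Context {R : realType} {m : nat}.
Implicit Types v : 'rV[R]_m.

Lemma eucl_norm_ge0 v : 0 <= eucl_norm v.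
Proof. exact: sqrtr_ge0. Qed.

Lemma eucl_norm_continuous : continuous (@eucl_norm R m).
Proof.
move=> v; apply: (@continuous_cvg _ _ _ (nbhs v)); first exact: sqrt_continuous.
have -> : (fun v : 'rV[R]_m => \sum_(j < m) v 0 j ^+ 2) =
    \sum_(j < m) (fun v : 'rV[R]_m => v 0 j ^+ 2).
  by apply/funext => y; rewrite fct_sumE.
have : {for v, continuous (\sum_(j < m) (fun v : 'rV[R]_m => v 0 j ^+ 2))}.
  elim/big_ind: _ => [|f g cf cg|j _]; first exact: (cvg_cst (0 : R) (F := nbhs v)).
    exact: (cvgD (F := nbhs v) cf cg).
  apply: (cvgM (F := nbhs v)); exact: coord_continuous.
by rewrite /prop_for fct_sumE.
Qed.

Lemma coord_le_eucl v j : `|v 0 j| <= eucl_norm v.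
Proof.
rewrite /eucl_norm -sqrtr_sqr ler_wsqrtr// (bigD1 j)//= lerDl.
by apply: sumr_ge0 => i _; exact: sqr_ge0.
Qed.

Lemma norm_le_eucl v : `|v| <= eucl_norm v.
Proof. apply: row_norm_le; [exact: eucl_norm_ge0|exact: coord_le_eucl]. Qed.

Lemma eucl_le_norm v : eucl_norm v <= m%:R * `|v|.
Proof.
have s0 : 0 <= m%:R * `|v| by rewrite mulr_ge0.
rewrite /eucl_norm -(ger0_norm s0) -sqrtr_sqr ler_wsqrtr//.
apply: (@le_trans _ _ (\sum_(j < m) `|v| ^+ 2)).
  apply: ler_sum => j _; rewrite -[leLHS]ger0_norm ?sqr_ge0// normrX.
  by rewrite ler_sqr ?nnegrE// row_coord_le.
rewrite sumr_const card_ord exprMn -[leLHS]mulr_natl ler_wpM2r ?sqr_ge0//.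
by rewrite -natrX ler_nat; case: (m) => // k; rewrite leq_pmulr.
Qed.

End euclidean.

Section open_sets_comparison.
Context {R : realType} {n : nat}.
Local Notation mu := (@leb R n).

Lemma opp_add_le_halves (a b c e : R) : `|a| < e / 2 -> `|b| < e / 2 ->
  0 <= c + b -> - (c + a) <= e.
Proof. by rewrite !ltr_norml => /andP[? ?] /andP[? ?] ?; lra. Qed.

(** A measurable set is approximated in measure by open ones, and integrals are
  absolutely continuous, so nonnegativity of the integral passes from open sets
  to the set where h is negative. *)
Lemma ae_ge0_open (D : set 'rV[R]_n) (h : 'rV[R]_n -> R) : open D -> (mu D < +oo)%E ->
  mu.-integrable D (EFin \o h) ->
  (forall U, open U -> U `<=` D -> 0 <= \int[mu]_(x in U) h x) ->
  {ae mu, forall x, D x -> 0 <= h x}.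
Proof.
move=> oD Doo hi hU.
have mD : measurable D by exact: open_measurable_row.
pose g := h \_ D.
have gi : mu.-integrable [set: 'rV[R]_n] (EFin \o g).
  by move/(integrable_mkcond _ mD) : hi; rewrite /g restrict_EFin.
have gU E : E `<=` D -> \int[mu]_(x in E) g x = \int[mu]_(x in E) h x.
  by move=> ED; apply: eq_Rintegral => x; rewrite inE => /ED Dx; rewrite /g patchE mem_set.
have mg : measurable_fun [set: 'rV[R]_n] g by have /measurable_int/measurable_EFinP := gi.
pose E := [set x | g x < 0].
have mE : measurable E.
  have := measurable_fun_ltr mg (measurable_cst (0 : R)) measurableT => /(_ [set true]).
  by rewrite setTI => H; apply: H.
have ED : E `<=` D.
  by move=> x; rewrite /E /= /g patchE; case: ifPn => [/set_mem//|_]; rewrite ltxx.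
have gA A : measurable A -> mu.-integrable A (EFin \o g).
  by move=> mA; exact: (integrableS measurableT mA (@subsetT _ _) gi).
have E0 : 0 <= \int[mu]_(x in E) g x.
  rewrite -lerN2 oppr0; apply/ler_addgt0Pr => e e0; rewrite add0r.
  have [dl [dl0 dlP]] := integral_normr_continuous gi (divr_gt0 e0 (ltr0n _ 2)).
  have [U [oU UD EU]] := open_approx oD Doo mE ED dl0.
  have mU : measurable U by exact: open_measurable_row.
  have small A : measurable A -> A `<=` (E `\` U) `|` (U `\` E) -> `|\int[mu]_(x in A) g x| < e / 2.
    move=> mA AEU; apply: (le_lt_trans (le_normr_Rintegral mA (gA A mA))).
    apply: dlP => //; apply: le_lt_trans EU; apply: le_measure; rewrite ?inE//.
    by apply: measurableU; exact: measurableD.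
  have s1 := small (E `\` U) (measurableD mE mU) (@subsetUl _ _ _).
  have s2 := small (U `\` E) (measurableD mU mE) (@subsetUr _ _ _).
  have mEU : measurable (E `&` U) by exact: measurableI.
  have e1 : \int[mu]_(x in E) g x = \int[mu]_(x in E `&` U) g x + \int[mu]_(x in E `\` U) g x.
    rewrite -[in LHS](setUIDK E U) Rintegral_disjoint_union//.
    - exact: measurableD.
    - by rewrite -subset0 => x [[_ ?] []].
    - by apply: gA; apply: measurableU => //; exact: measurableD.
  have e2 : \int[mu]_(x in U) g x = \int[mu]_(x in E `&` U) g x + \int[mu]_(x in U `\` E) g x.
    rewrite setIC -[in LHS](setUIDK U E) Rintegral_disjoint_union//.
    - exact: measurableI.
    - exact: measurableD.
    - by rewrite -subset0 => x [[_ ?] []].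
    - by apply: gA; apply: measurableU; [exact: measurableI|exact: measurableD].
  have := hU U oU UD; rewrite -gU// e2 e1; exact: opp_add_le_halves.
have I0 : (\int[mu]_(x in E) `|(g x)%:E| = 0)%E.
  have fin : (\int[mu]_(x in E) `|(g x)%:E|)%E \is a fin_num.
    have := integrable_fin_num mE (integrable_norm (gA E mE)); exact.
  have E1 : fine (\int[mu]_(x in E) `|(g x)%:E|)%E = \int[mu]_(x in E) (-1 * g x).
    by apply: eq_Rintegral => x; rewrite inE /E /= mulN1r => /ltr0_norm.
  rewrite -(fineK fin) E1 (RintegralZl _ mE (gA E mE)) mulN1r.
  congr EFin; apply/eqP; rewrite oppr_eq0 eq_le E0 andbT -oppr_ge0 -mulN1r.
  rewrite -(RintegralZl _ mE (gA E mE)) -E1; apply: fine_ge0.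
  by apply: integral_ge0 => x _; exact: abse_ge0.
have mgE : measurable_fun E (fun x => (g x)%:E) by apply/measurable_EFinP; exact: measurable_funTS.
have := (ae_eq_integral_abs mu mE mgE).1 I0.
apply: ae_imp => x Hx Dx; rewrite leNgt; apply/negP => hx0.
have gx : g x = h x by rewrite /g patchE mem_set.
have Ex : E x by rewrite /E /= gx.
by have [/eqP] := Hx Ex; rewrite gx lt_eqF.
Qed.

End open_sets_comparison.

(** * Extension by zero and restriction to a set of finite measure *)

Section zero_extension.
Context d (T : measurableType d) (R : realType) (n : nat).

Lemma level_measurable (g : T -> R) (c : R) (i : int) : 0 < c -> measurable_fun [set: T] g ->
  measurable [set x | Num.floor (c * g x) = i].
Proof.
move=> c0 mg.
rewrite (_ : [set x | _] = (fun x => c * g x) @^-1` `[i%:~R, (i + 1)%:~R[).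
  by rewrite -[X in measurable X]setTI; apply: measurable_funM.
apply/seteqP; split => x /=; rewrite in_itv/=.
  by move=> <-; exact: floor_itv.
exact: floor_def.
Qed.

Lemma grid_measurable_pair (u : T -> R) (g : T -> 'rV[R]_n) : measurable_fun [set: T] u ->
  (forall j, measurable_fun [set: T] (fun x => g x 0 j)) ->
  grid_measurable (@grid_code R n) (fun x => (u x, g x)).
Proof.
move=> mu_ mg k [i1 i2].
have c0 : 0 < (k.+1 * 2)%:R :> R by rewrite ltr0n.
rewrite (_ : [set x | _] = [set x | Num.floor ((k.+1 * 2)%:R * u x) = i1] `&`
    \bigcap_(j in [set: 'I_n]) [set x | Num.floor ((k.+1 * 2)%:R * g x 0 j) = i2 0 j]).
  apply: measurableI; first exact: level_measurable.
  by apply: fin_bigcap_measurable => // j _; exact: (level_measurable _ c0 (mg j)).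
apply/seteqP; split => x /=; rewrite /grid_code /=.
  by move=> [-> <-]; split => // j _ /=; rewrite !mxE.
move=> [-> H]; congr pair; apply/rowP => j; rewrite !mxE; exact: H.
Qed.

Definition zero_extension (D : set T) (V : zmodType) (w : T -> V) (x : T) : V :=
  if x \in D then w x else 0.

Lemma grid_measurable_zero_extension (D : set T) (u : T -> R) (g : T -> 'rV[R]_n) : measurable D ->
  measurable_fun D u -> (forall j, measurable_fun D (fun x => g x 0 j)) ->
  grid_measurable (@grid_code R n) (zero_extension D (fun x => (u x, g x))).
Proof.
move=> mD mu_ mg.
have -> : zero_extension D (fun x => (u x, g x)) =
    (fun x => ((u \_ D) x, \row_j ((fun x => g x 0 j) \_ D) x)).
  apply/funext => x; rewrite /zero_extension patchE; case: ifPn => xD.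
    by congr pair; apply/rowP => j; rewrite mxE patchE xD.
  by congr pair; apply/rowP => j; rewrite !mxE patchE (negbTE xD).
apply: grid_measurable_pair; first exact/(measurable_restrictT _ mD).
move=> j; under eq_fun do rewrite mxE; exact/(measurable_restrictT _ mD).
Qed.

End zero_extension.

Section finite_restriction.
Context d (T : measurableType d) (R : realType).
Variable mu : {measure set T -> \bar R}.
Variables (D : set T) (mD : measurable D) (Doo : (mu D < +oo)%E).

Definition finite_restriction : {finite_measure set T -> \bar R} := mfrestr mD Doo.

Lemma integral_finite_restriction E (f : T -> \bar R) : E `<=` D ->
  (\int[finite_restriction]_(x in E) f x = \int[mu]_(x in E) f x)%E.
Proof.
move=> ED; apply: eq_measure_integral => A mA AE.
rewrite -[LHS]/(mu (A `&` D)); congr (mu _); apply/setIidPl.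
exact: subset_trans AE ED.
Qed.

Lemma integrable_finite_restriction (f : T -> R) :
  mu.-integrable D (EFin \o f) -> (forall x, ~ D x -> f x = 0) ->
  finite_restriction.-integrable [set: T] (EFin \o f).
Proof.
move=> /integrableP[mf foo] f0.
have fD : f = f \_ D.
  apply/funext => x; rewrite patchE; case: ifPn => //.
  by rewrite notin_setE => /f0.
have mfT : measurable_fun [set: T] f.
  by rewrite fD; apply/(measurable_restrictT _ mD); exact/measurable_EFinP.
apply/integrableP; split; first exact/measurable_EFinP.
rewrite -(setUv D) ge0_integral_setU//.
- rewrite integral_finite_restriction// (_ : (\int[finite_restriction]_(x in ~` D) _)%E = 0%E) ?adde0//.
  by rewrite -(integral0 finite_restriction (~` D)); apply: eq_integral => x; rewrite inE => /f0 /= ->; rewrite normr0.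
- exact: measurableC.
- apply: measurableT_comp => //; apply/measurable_EFinP; exact: measurable_funTS.
- exact/disj_setPCl.
Qed.

End finite_restriction.

(** * Real integrands representing a functional *)

Section powers.
Context {R : realType}.
Variable p : R.
Hypothesis p1 : 1 <= p.

Lemma norm_powR_continuous : continuous (fun t : R => `|t| `^ p).
Proof.
have p0 : 0 < p by exact: lt_le_trans p1.
move=> t; have [->|t0] := eqVneq t 0.
  apply/cvgrPdist_le => e e0; rewrite normr0 powR0 ?gt_eqF//.
  have r0 : 0 < e `^ p^-1 by rewrite powR_gt0.
  have := @nbhs0_lt R R _ r0; apply: filterS => s sr.
  rewrite sub0r normrN ger0_norm ?powR_ge0//.
  apply: (@le_trans _ _ ((e `^ p^-1) `^ p)); last first.
    by rewrite -powRrM mulVf ?gt_eqF// powRr1// ltW.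
  by apply: ge0_ler_powR => //; rewrite ?nnegrE ?ltW.
apply: (@continuous_comp _ _ _ (fun t : R => `|t|) (fun s => s `^ p)).
  exact: norm_continuous.
have tp : `|t| \in `]0, +oo[ by rewrite in_itv/= andbT normr_gt0.
have := @derivable_powR R 1 p `|t| tp.
by move=> /derivable1_diffP /differentiable_continuous.
Qed.

End powers.

Section regular_integrand.
Context {R : realType} {m n : nat}.
Variables (Omega : set 'rV[R]_n) (C : 'rV[R]_n -> 'M[R]_(m, n)) (p : R).
Variables (a : 'rV[R]_n -> R) (c1 c2 : R).
Hypothesis oO : open Omega.
Hypothesis bO : bounded_set Omega.
Hypothesis lC : forall j i, [lipschitz C x j i | x in Omega].
Hypothesis p1 : 1 <= p.
Hypothesis ai : leb.-integrable Omega (EFin \o a).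
Hypothesis c10 : 0 <= c1.
Hypothesis c20 : 0 <= c2.
Local Notation mu := (@leb R n).
Local Notation V := (R * 'rV[R]_m)%type.

Let mO : measurable Omega. Proof. exact: open_measurable_row. Qed.

Definition field (u : 'rV[R]_n -> R) : 'rV[R]_n -> V :=
  zero_extension Omega (fun x => (u x, Xgrad Omega C u x)).

(** The bound of the class, with a replaced by the absolute value of its
  extension by zero in order to be nonnegative everywhere; a is nonnegative
  almost everywhere when the class is nonempty ([class_U_coefficient_ge0]). *)
Definition growth (x : 'rV[R]_n) (z : V) : R :=
  `|(a \_ Omega) x| + c1 * eucl_norm z.2 `^ p + c2 * `|z.1| `^ p.

Lemma growth_ge0 x z : 0 <= growth x z.
Proof. by rewrite !addr_ge0// mulr_ge0// powR_ge0. Qed.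

Lemma growth_continuous x : continuous (growth x).
Proof.
move=> z; apply: cvgD; first apply: cvgD; first exact: cvg_cst.
  apply: cvgM; first exact: cvg_cst.
  have -> : (fun z : V => eucl_norm z.2 `^ p) = (fun z : V => `|eucl_norm z.2| `^ p).
    by apply/funext => y; rewrite ger0_norm// eucl_norm_ge0.
  rewrite -[X in X `^ p](ger0_norm (eucl_norm_ge0 _)).
  apply: (@continuous_cvg _ _ _ (nbhs z) _ _ (fun t : R => `|t| `^ p)); first exact: norm_powR_continuous.
  apply: (@continuous_cvg _ _ _ (nbhs z) _ _ (@eucl_norm R m)); first exact: eucl_norm_continuous.
  exact: cvg_snd.
apply: cvgM; first exact: cvg_cst.
apply: (@continuous_cvg _ _ _ (nbhs z) _ _ (fun t : R => `|t| `^ p)); first exact: norm_powR_continuous.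
exact: cvg_fst.
Qed.

Lemma growth_le x z :
  growth x z <= `|(a \_ Omega) x| + (c1 * m%:R `^ p + c2) * `|z| `^ p.
Proof.
have p0 : 0 <= p by exact: le_trans p1.
have [z1 z2] := prod_norm_le z.
rewrite /growth -addrA lerD2l mulrDl; apply: lerD.
  rewrite -mulrA ler_wpM2l// -powRM//; apply: ge0_ler_powR; rewrite ?nnegrE ?mulr_ge0 ?eucl_norm_ge0//.
  by apply: (le_trans (eucl_le_norm _)); rewrite ler_wpM2l.
by rewrite ler_wpM2l//; apply: ge0_ler_powR => //; rewrite nnegrE.
Qed.

Lemma restrict_integrable : mu.-integrable Omega (EFin \o (fun x => `|(a \_ Omega) x|)).
Proof.
have := integrable_norm ai; apply: eq_integrable => // x xO.
by rewrite /= patchE xO.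
Qed.

Lemma field_grid_measurable u : WX Omega C p u -> grid_measurable (@grid_code R m) (field u).
Proof.
move=> Wu; apply: grid_measurable_zero_extension; first exact: mO.
  by apply: (Lp_measurable oO (p := p)); case: Wu.
by move=> j; have [] := WX_Xgrad_integrable oO p1 j Wu.
Qed.

(** Outside a null set the integrand is finite, continuous and bounded by the
  growth function; on that null set and outside Omega it is replaced by zero.
  Lebesgue measure is complete, so the superposition with the original integrand
  is measurable as well. *)
Lemma regular_integrand F : class_U Omega C p a c1 c2 F ->
  exists phi : 'rV[R]_n -> V -> R,
    [/\ forall z, measurable_fun [set: 'rV[R]_n] (phi^~ z),
      forall x, continuous (phi x), forall x z, 0 <= phi x z,
      forall x z, phi x z <= growth x z &
      forall A u, open A -> A `<=` Omega -> WX Omega C p u ->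
        F u A = (\int[leb]_(x in A) (phi x (field u x))%:E)%E].
Proof.
move=> [f [f0 [mf cf] fb FE]].
have [N [mN N0 NH]] := ae_and cf fb.
pose D := Omega `\` N.
have mD : measurable D by exact: measurableD.
have DP x : D x -> continuous (fun z : V => f x z.1 z.2) /\ forall u eta,
    (f x u eta <= (a x + c1 * eucl_norm eta `^ p + c2 * `|u| `^ p)%:E)%E.
  by move=> [Ox Nx]; have [] : (Omega x -> continuous (fun z : V => f x z.1 z.2)) /\
    (Omega x -> forall u eta, (f x u eta <= (a x + c1 * eucl_norm eta `^ p + c2 * `|u| `^ p)%:E)%E)
     by [apply: contrapT => H; apply: Nx; exact: NH]; split; auto.
have ffin x u eta : D x -> f x u eta \is a fin_num.
  move=> Dx; rewrite ge0_fin_numE; last by apply: f0; case: Dx.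
  by apply: le_lt_trans ((DP x Dx).2 u eta) _; exact: ltry.
pose phi x (z : V) := ((fun y => fine (f y z.1 z.2)) \_ D) x.
have mphi z : measurable_fun [set: 'rV[R]_n] (phi^~ z).
  apply/(measurable_restrictT _ mD).
  have mz : measurable_fun D (fun y => f y z.1 z.2).
    by apply: measurable_funS (mf z.1 z.2) => // x [].
  exact: (measurableT_comp (fine_measurable measurableT) mz).
have cphi x : continuous (phi x).
  have [Dx|nDx] := pselect (D x).
    have -> : phi x = fun z : V => fine (f x z.1 z.2).
      by apply/funext => z; rewrite /phi patchE mem_set.
    move=> z; apply: fine_cvg; rewrite fineK; last exact: ffin.
    exact: (DP x Dx).1.
  have -> : phi x = fun=> 0 by apply/funext => z; rewrite /phi patchE memNset.
  exact: cst_continuous.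
exists phi; split => //.
- move=> x z; rewrite /phi patchE; case: ifPn => // /set_mem[Ox _].
  by apply: fine_ge0; exact: f0.
- move=> x z; rewrite /phi patchE; case: ifPn => [/set_mem Dx|_]; last exact: growth_ge0.
  rewrite -lee_fin fineK; last exact: ffin.
  apply: le_trans ((DP x Dx).2 _ _) _; rewrite lee_fin /growth !lerD2r.
  by rewrite patchE mem_set ?ler_norm//; case: Dx.
- move=> A u oA AO Wu; rewrite FE//.
  have mA := open_measurable_row oA.
  have mphiu : measurable_fun A (EFin \o (fun x => phi x (field u x))).
    apply/measurable_EFinP; apply: measurable_funTS.
    apply: (measurable_superposition (@grid_codeP R m) (field_grid_measurable Wu)) => //.
  have ae : {ae mu, forall x, A x -> (phi x (field u x))%:E = f x (u x) (Xgrad Omega C u x)}.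
    exists N; split => // x /= /not_implyP[Ax H]; apply: contrapT => Nx; apply: H.
    have Dx : D x by split => //; exact: AO.
    rewrite /phi patchE mem_set// /field /zero_extension mem_set ?fineK//; last exact: AO.
    exact: ffin.
  have ae' : {ae mu, forall x, A x -> f x (u x) (Xgrad Omega C u x) = (phi x (field u x))%:E}.
    by move: ae; apply: ae_imp => x H Ax; rewrite H.
  apply: ae_eq_integral.
  + exact: mA.
  + apply: (ae_measurable_fun _ ae mphiu).
    exact: measure_is_complete_caratheodory.
  + exact: mphiu.
  + exact: ae'.
Qed.

End regular_integrand.

(** * From the strong condition to a modulus of continuity *)

Section rows_topology.
Context {R : realType} {m n : nat}.

Lemma sum_cvg (T : Type) (F : set_system T) {FF : Filter F} (k : nat)
    (f : 'I_k -> T -> R) (l : 'I_k -> R) :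
  (forall i, f i @ F --> l i) -> (fun x => \sum_i f i x) @ F --> \sum_i l i.
Proof.
move=> fl; have := @cvg_big R 'I_k +%R 0 xpredT add_continuous T F (index_enum 'I_k) f l FF.
by apply => i _; exact: fl.
Qed.

Lemma row_cvg (T : Type) (F : set_system T) {FF : Filter F} (f : T -> 'rV[R]_m) (l : 'rV[R]_m) :
  (forall j, (fun x => f x 0 j) @ F --> l 0 j) -> f @ F --> l.
Proof.
move=> fl; apply/cvgrPdist_le => e e0.
have H : \forall x \near F, forall j, `|l 0 j - f x 0 j| <= e.
  apply: filter_forall => j; exact: (proj1 (cvgrPdist_le _ _) (fl j) e e0).
apply: filterS H => x H; apply: row_norm_le => [|j]; first exact: ltW.
by rewrite !mxE.
Qed.

Lemma pair_cvg (T : Type) (F : set_system T) {FF : Filter F} (U W : topologicalType)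
    (f : T -> U) (g : T -> W) (l : U) (l' : W) :
  f @ F --> l -> g @ F --> l' -> (fun x => (f x, g x)) @ F --> (l, l').
Proof. exact: cvg_pair. Qed.

(** The linear independence condition only speaks of the outer measure of a set
  that need not be measurable a priori. *)
Lemma leb_null_measurable (A : set 'rV[R]_n) : leb A = 0%E -> measurable A.
Proof.
move=> A0.
have outer0 X : X `<=` A -> (@lebesgue_outer R n) X = 0%E.
  move=> XA; apply/eqP; rewrite eq_le outer_measure_ge0 andbT -[leRHS]A0.
  exact: (le_outer_measure (@lebesgue_outer R n) _ _ XA).
apply: (@le_caratheodory_measurable _ _ (@lebesgue_outer R n)) => X.
apply: (@le_trans _ _ (0 + (@lebesgue_outer R n) X)%E); last by rewrite add0e.
apply: leeD.
  by rewrite -[leRHS](outer0 (X `&` A)) ?lexx// => x [].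
by apply: (le_outer_measure (@lebesgue_outer R n)); apply: subIset; left.
Qed.

(** The constraints of the strong condition with strict inequalities, so that
  they are open conditions. *)
Definition admissible (S r : R) (z z' : R * 'rV[R]_m) :=
  [/\ `|z.1| < S, `|z'.1| < S, eucl_norm z.2 < S & eucl_norm z'.2 < S] /\
  (`|z.1 - z'.1| < r /\ eucl_norm (z.2 - z'.2) < r).

Lemma admissible_near (T : Type) (F : set_system T) {FF : Filter F}
    (f g : T -> R * 'rV[R]_m) z z' S r :
  f @ F --> z -> g @ F --> z' -> admissible S r z z' ->
  \forall x \near F, admissible S r (f x) (g x).
Proof.
move=> fz gz [[h1 h2 h3 h4] [h5 h6]].
have f1 : (fun x => (f x).1) @ F --> z.1 by apply: (cvg_comp _ _ fz); exact: cvg_fst.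
have g1 : (fun x => (g x).1) @ F --> z'.1 by apply: (cvg_comp _ _ gz); exact: cvg_fst.
have f2 : (fun x => (f x).2) @ F --> z.2 by apply: (cvg_comp _ _ fz); exact: cvg_snd.
have g2 : (fun x => (g x).2) @ F --> z'.2 by apply: (cvg_comp _ _ gz); exact: cvg_snd.
have eu (k : T -> 'rV[R]_m) l : k @ F --> l -> (fun x => eucl_norm (k x)) @ F --> eucl_norm l.
  by move=> kl; apply: continuous_cvg kl; exact: eucl_norm_continuous.
have N1 : \forall x \near F, `|(f x).1| < S by exact: (cvgr_lt _ (cvg_norm f1)).
have N2 : \forall x \near F, `|(g x).1| < S by exact: (cvgr_lt _ (cvg_norm g1)).
have N3 : \forall x \near F, eucl_norm (f x).2 < S by exact: (cvgr_lt _ (eu _ _ f2)).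
have N4 : \forall x \near F, eucl_norm (g x).2 < S by exact: (cvgr_lt _ (eu _ _ g2)).
have N5 : \forall x \near F, `|(f x).1 - (g x).1| < r.
  exact: (cvgr_lt _ (cvg_norm (cvgB f1 g1))).
have N6 : \forall x \near F, eucl_norm ((f x).2 - (g x).2) < r.
  exact: (cvgr_lt _ (eu _ _ (cvgB f2 g2))).
have N := @filterI T F FF _ _ N1 (@filterI T F FF _ _ N2 (@filterI T F FF _ _ N3 (@filterI T F FF _ _ N4 (@filterI T F FF _ _ N5 N6)))).
apply: (@filterS T F FF _ _ _ N) => x /= [? [? [? [? [? ?]]]]].
by split; split.
Qed.

(** The Euclidean norm is at most m times the sup norm, hence the factors m in
  the modulus below. *)
Lemma admissible_of_norm (s k : nat) z z' : (0 < m)%N ->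
  `|z| < s%:R -> `|z'| < s%:R -> `|z - z'| < k.+1%:R^-1 ->
  admissible (m * s)%:R (m%:R / k.+1%:R) z z'.
Proof.
move=> m0 zs z's zz'.
have m1 : 1 <= m%:R :> R by rewrite ler1n.
have mp : 0 < m%:R :> R by rewrite ltr0n.
have H (y : R * 'rV[R]_m) (e : R) : `|y| < e -> `|y.1| < m%:R * e /\ eucl_norm y.2 < m%:R * e.
  move=> ye; have [y1 y2] := prod_norm_le y.
  have e0 : 0 <= e by rewrite (le_trans _ (ltW ye)).
  split; first by rewrite (le_lt_trans y1)// (lt_le_trans ye)// ler_peMl.
  by rewrite (le_lt_trans (eucl_le_norm _))// ltr_pM2l// (le_lt_trans y2).
rewrite natrM; have [? ?] := H _ _ zs; have [? ?] := H _ _ z's; have [? ?] := H _ _ zz'.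
by split; split.
Qed.

End rows_topology.

Lemma eucl_normN {R : realType} {m : nat} (v : 'rV[R]_m) : eucl_norm (- v) = eucl_norm v.
Proof. by rewrite /eucl_norm; congr Num.sqrt; apply: eq_bigr => j _; rewrite mxE sqrrN. Qed.

Section pointwise_modulus.
Context {R : realType} {m n : nat}.
Variables (Omega : set 'rV[R]_n) (C : 'rV[R]_n -> 'M[R]_(m, n)) (p : R).
Variables (a : 'rV[R]_n -> R) (c1 c2 : R) (omega : R -> 'rV[R]_n -> R -> R).
Variable F : ('rV[R]_n -> R) -> set 'rV[R]_n -> \bar R.
Variable phi : 'rV[R]_n -> R * 'rV[R]_m -> R.
Hypothesis m0 : (0 < m)%N.
Hypothesis oO : open Omega.
Hypothesis bO : bounded_set Omega.
Hypothesis lC : forall j i, [lipschitz C x j i | x in Omega].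
Hypothesis lic : LIC Omega C.
Hypothesis p1 : 1 <= p.
Hypothesis ai : leb.-integrable Omega (EFin \o a).
Hypothesis c10 : 0 <= c1.
Hypothesis c20 : 0 <= c2.
Hypothesis om : integrable_moduli Omega omega.
Hypothesis mphi : forall z, measurable_fun [set: 'rV[R]_n] (phi^~ z).
Hypothesis cphi : forall x, continuous (phi x).
Hypothesis phi0 : forall x z, 0 <= phi x z.
Hypothesis phib : forall x z, phi x z <= growth Omega p a c1 c2 x z.
Hypothesis FE : forall A u, open A -> A `<=` Omega -> WX Omega C p u ->
  F u A = (\int[leb]_(x in A) (phi x (field Omega C u x))%:E)%E.
Hypothesis sF : strong_condition Omega C p omega F.
Local Notation mu := (@leb R n).
Local Notation V := (R * 'rV[R]_m)%type.

Let mO : measurable Omega. Proof. exact: open_measurable_row. Qed.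
Let Ooo : (mu Omega < +oo)%E. Proof. exact: leb_bounded. Qed.

Definition affine_field (z : R * 'rV[R]_n) (x : 'rV[R]_n) : V :=
  (affine z.1 z.2 x, z.2 *m (C x)^T).

Lemma affine_field_continuous z x : Omega x -> affine_field z y @[y --> x] --> affine_field z x.
Proof.
move=> Ox; apply: (pair_cvg (F := nbhs x) (f := affine z.1 z.2) (g := fun y => z.2 *m (C y)^T)).
  apply: (@lipschitz_on_continuous _ _ setT (affine z.1 z.2) (\sum_k `|z.2 0 k|)) => //.
    exact: openT.
  by move=> y y' _ _; exact: affine_lipschitz.
apply: row_cvg => j; rewrite mxE.
under eq_cvg do rewrite mxE.
apply: sum_cvg => i; rewrite mxE; under eq_cvg do rewrite mxE.
apply: (cvgM (F := nbhs x)); first exact: cvg_cst.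
have [K [_ [CK _]]] := lipschitz_on_bounds bO (lC j i).
exact: (lipschitz_on_continuous oO CK Ox).
Qed.

Lemma affine_field_continuous_coeff x z : affine_field y x @[y --> z] --> affine_field z x.
Proof.
have c2' k : (fun y : R * 'rV[R]_n => y.2 0 k) @ z --> z.2 0 k.
  apply: (@continuous_cvg _ _ _ (nbhs z) _ _ (fun v : 'rV[R]_n => v 0 k)); last exact: cvg_snd.
  exact: coord_continuous.
apply: (pair_cvg (F := nbhs z) (f := fun y => affine y.1 y.2 x) (g := fun y => y.2 *m (C x)^T)).
  apply: (cvgD (F := nbhs z)); first exact: cvg_fst.
  apply: sum_cvg => k; apply: (cvgM (F := nbhs z)); [exact: c2'|exact: cvg_cst].
apply: row_cvg => j; rewrite mxE.
under eq_cvg do rewrite mxE.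
by apply: sum_cvg => k; apply: (cvgM (F := nbhs z)); [exact: c2'|exact: cvg_cst].
Qed.

Lemma affine_growth z : exists N : R, forall x, Omega x ->
  `|phi x (affine_field z x)| <= `|(a \_ Omega) x| + N.
Proof.
have [N1 N1P] := affine_bounded bO z.1 z.2.
have N2P := @choice _ _ _ (fun j => affine_Xgrad_L1loc oO bO lC z.2 j).
have [N2 {}N2P] := N2P.
pose S := `|N1| + \sum_j `|N2 j|.
have S0 : 0 <= S by rewrite addr_ge0// sumr_ge0.
exists ((c1 * m%:R `^ p + c2) * S `^ p) => x Ox.
rewrite ger0_norm//; apply: (le_trans (phib _ _)).
apply: (le_trans (growth_le Omega a p1 c10 c20 x _)); rewrite lerD2l.
have p0 : 0 <= p by exact: le_trans p1.
apply: ler_wpM2l; first by rewrite addr_ge0// mulr_ge0// powR_ge0.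
apply: ge0_ler_powR => //; rewrite ?nnegrE//.
rewrite prod_normE ge_max; apply/andP; split => /=.
  by rewrite (le_trans (N1P x Ox))// (le_trans (ler_norm _))// lerDl sumr_ge0.
apply: row_norm_le => // j; rewrite (le_trans ((N2P j).2 x Ox))// (le_trans (ler_norm _))//.
by rewrite /S (bigD1 j)//= addrCA lerDl addr_ge0// sumr_ge0.
Qed.

Lemma affine_measurable_field z : measurable_fun Omega (fun x => phi x (affine_field z x)).
Proof.
have nw : grid_measurable (@grid_code R m) (zero_extension Omega (affine_field z)).
  apply: grid_measurable_zero_extension; first exact: mO.
    by apply: measurable_funTS; exact: affine_measurable.
  by move=> j; have [N []] := affine_Xgrad_L1loc oO bO lC z.2 j.
have := measurable_superposition (@grid_codeP R m) nw mphi cphi.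
move=> /(measurable_funTS (D := Omega)).
by apply: eq_measurable_fun => x Ox; rewrite /zero_extension Ox.
Qed.

Lemma affine_integrable z : mu.-integrable Omega (EFin \o (fun x => phi x (affine_field z x))).
Proof.
have [N NP] := affine_growth z.
have Ni : mu.-integrable Omega (EFin \o cst N).
  apply: (measurable_bounded_integrable (f := cst N) mO Ooo); first exact: measurable_cst.
  by exists `|N|; split => [|r /ltW r1 x _ /=]; [exact: num_real|].
have := integrableD mO (restrict_integrable oO ai) Ni.
apply: (le_integrable mO); first by apply/measurable_EFinP; exact: affine_measurable_field.
by move=> x Ox /=; rewrite lee_fin; apply: (le_trans (NP x Ox)); exact: ler_norm.
Qed.

Lemma affine_field_ae z : {ae mu, forall x, Omega x ->
   field Omega C (affine z.1 z.2) x = affine_field z x}.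
Proof.
apply: ae_imp (Xgrad_ae oO (is_Xgrad_affine oO bO lC z.1 z.2)) => x H Ox.
by rewrite /field /zero_extension mem_set// H.
Qed.

Lemma affine_functional z U : open U -> U `<=` Omega ->
  F (affine z.1 z.2) U = (\int[mu]_(x in U) phi x (affine_field z x))%:E.
Proof.
move=> oU UO; have mU := open_measurable_row oU.
have Ui : mu.-integrable U (EFin \o (fun x => phi x (affine_field z x))).
  exact: (integrableS mO mU UO (affine_integrable z)).
have Wz := affine_WX oO bO lC p1 z.1 z.2.
rewrite FE// /Rintegral fineK; last exact: integrable_fin_num Ui.
apply: ae_eq_integral.
- exact: mU.
- apply/measurable_EFinP; apply: measurable_funTS.
  exact: (measurable_superposition (@grid_codeP R m) (field_grid_measurable oO p1 Wz) mphi cphi).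
- exact: measurable_int Ui.
- by apply: ae_imp (affine_field_ae z) => x H /UO Ox; rewrite H.
Qed.

Lemma omega_integrable S r ab : 0 <= S -> 0 <= r -> closed_rat_box ab `<=` Omega ->
  mu.-integrable (rat_box ab) (EFin \o (fun x => omega S x r)).
Proof.
move=> S0 r0 abO; have [_ _ _ oi] := om.
have := oi r S r0 S0 (closed_rat_box ab) (@compact_closed_box R n _ _) abO.
apply: integrableS.
- exact: closed_box_measurable.
- apply: open_measurable_row; exact: open_box.
- exact: box_sub_closed.
Qed.

(** On the open set where the constraints hold, intersected with a box whose
  closure lies in Omega, every open subset is a legitimate test set for the
  strong condition. *)
Lemma affine_modulus_half z z' S r : 0 <= S -> 0 <= r ->
  {ae mu, forall x, Omega x -> admissible S r (affine_field z x) (affine_field z' x) ->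
    phi x (affine_field z' x) - phi x (affine_field z x) <= omega S x r}.
Proof.
move=> S0 r0; apply: (ae_rat_boxes oO) => ab abO.
pose D := rat_box ab `&` [set x | Omega x /\ admissible S r (affine_field z x) (affine_field z' x)].
have oD : open D.
  apply: openI; first exact: open_box.
  rewrite openE => x [Ox adm]; rewrite /interior.
  apply: filterI; first exact: open_nbhs_nbhs.
  exact: (admissible_near (affine_field_continuous Ox) (affine_field_continuous Ox) adm).
have DO : D `<=` Omega by move=> x [_ []].
have mD := open_measurable_row oD.
have Doo : (mu D < +oo)%E.
  apply: le_lt_trans Ooo; apply: le_measure; rewrite ?inE//.
have omi : mu.-integrable D (EFin \o (fun x => omega S x r)).
  apply: (integrableS _ mD _ (omega_integrable S0 r0 abO)); first by apply: open_measurable_row; exact: open_box.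
  by move=> x [].
have phii y E : measurable E -> E `<=` Omega ->
    mu.-integrable E (EFin \o (fun x => phi x (affine_field y x))).
  by move=> mE EO; exact: (integrableS mO mE EO (affine_integrable y)).
pose diff x := phi x (affine_field z' x) - phi x (affine_field z x).
have diffi E : measurable E -> E `<=` Omega -> mu.-integrable E (EFin \o diff).
  move=> mE EO.
  by have := integrableB mE (phii z' E mE EO) (phii z E mE EO); apply: eq_integrable.
have : {ae mu, forall x, D x -> 0 <= omega S x r - diff x}.
  apply: (ae_ge0_open oD Doo).
    by have := integrableB mD omi (diffi D mD DO); apply: eq_integrable.
  move=> U oU UD.
  have mU := open_measurable_row oU.
  have UO : U `<=` Omega by move=> x /UD/DO.
  have omU : mu.-integrable U (EFin \o (fun x => omega S x r)) by exact: (integrableS mD mU UD omi).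
  rewrite (RintegralB mU omU (diffi U mU UO)) (RintegralB mU (phii z' U mU UO) (phii z U mU UO)).
  rewrite subr_ge0.
  have clU : closure U `<=` Omega.
    apply: (subset_trans _ abO).
    have cl : closed (closed_rat_box ab : set 'rV[R]_n).
      apply: compact_closed_row; rewrite /closed_rat_box; exact: compact_closed_box.
    rewrite ((closure_id _).1 cl).
    by apply: closure_subset => x /UD[+ _]; exact: box_sub_closed.
  have H := @sF S r U (affine z.1 z.2) (affine z'.1 z'.2) S0 r0 oU clU
     (affine_WX oO bO lC p1 z.1 z.2) (affine_WX oO bO lC p1 z'.1 z'.2).
  have gradE y : {ae mu, forall x, Omega x -> Xgrad Omega C (affine y.1 y.2) x = y.2 *m (C x)^T}.
    by apply: Xgrad_ae => //; exact: is_Xgrad_affine.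
  have aez := ae_and (gradE z) (gradE z').
  rewrite !affine_functional// in H.
  have b1 : {ae mu, forall x, U x -> [/\ `|affine z.1 z.2 x| <= S, `|affine z'.1 z'.2 x| <= S,
      eucl_norm (Xgrad Omega C (affine z.1 z.2) x) <= S &
      eucl_norm (Xgrad Omega C (affine z'.1 z'.2) x) <= S]}.
    apply: ae_imp aez => x [E1 E2] Ux; rewrite E1 ?E2; [|exact: UO..].
    by have [_ [_ [[? ? ? ?] _]]] := UD x Ux; split; exact: ltW.
  have b2 : {ae mu, forall x, U x -> `|affine z.1 z.2 x - affine z'.1 z'.2 x| <= r /\
      eucl_norm (Xgrad Omega C (affine z.1 z.2) x - Xgrad Omega C (affine z'.1 z'.2) x) <= r}.
    apply: ae_imp aez => x [E1 E2] Ux; rewrite E1 ?E2; [|exact: UO..].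
    by have [_ [_ [_ [? ?]]]] := UD x Ux; split; exact: ltW.
  have {}H := H b1 b2.
  have omfin : (\int[mu]_(x in U) (omega S x r)%:E)%E \is a fin_num := integrable_fin_num mU omU.
  rewrite -(fineK omfin) in H; have {}H : `|\int[mu]_(x in U) phi x (affine_field z' x) -
      \int[mu]_(x in U) phi x (affine_field z x)| <= \int[mu]_(x in U) omega S x r by exact: H.
  apply: le_trans H; exact: ler_norm.
apply: ae_imp => x Hx abx adm; rewrite -subr_ge0; apply: Hx; split => //; split => //.
by apply: abO; exact: box_sub_closed.
Qed.

Lemma affine_modulus z z' S r : 0 <= S -> 0 <= r ->
  {ae mu, forall x, Omega x -> admissible S r (affine_field z x) (affine_field z' x) ->
    `|phi x (affine_field z x) - phi x (affine_field z' x)| <= omega S x r}.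
Proof.
move=> S0 r0.
have := ae_and (affine_modulus_half z z' S0 r0) (affine_modulus_half z' z S0 r0).
apply: ae_imp => x [H1 H2] Ox adm.
rewrite ler_norml; apply/andP; split.
  by rewrite lerNl opprB; exact: H1.
apply: H2 => //; case: adm => [[? ? ? ?] [? ?]]; split; split => //; first by rewrite distrC.
by rewrite -opprB eucl_normN.
Qed.

(** Linear independence of the X_j at x means that xi |-> C(x) xi is
  onto. *)
Lemma coefficients_of_field x (z : V) : row_free (C x) -> exists y, affine_field y x = z.
Proof.
move=> Cx.
have Ct : row_full (C x)^T by rewrite /row_full mxrank_tr.
have /submxP[xi xiE] : (z.2 <= (C x)^T)%MS by exact: submx_full.
exists (z.1 - \sum_k xi 0 k * x 0 k, xi); rewrite /affine_field /affine /= subrK.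
by rewrite -xiE; case: (z).
Qed.

(** By [affine_modulus] the inequality holds, outside one null set, for the
  countably many affine functions with coefficients in the grid.  Their values
  at x are dense because of linear independence, and the integrand is
  continuous. *)
Theorem pointwise_modulus : {ae mu, forall x, Omega x -> forall (s k : nat) (z z' : V),
  `|z| < s%:R -> `|z'| < s%:R -> `|z - z'| < k.+1%:R^-1 ->
  `|phi x z - phi x z'| <= omega (m * s)%:R x (m%:R / k.+1%:R)}.
Proof.
have ae1 : {ae mu, forall x, forall q : (nat * (int * 'rV[int]_n)) * (nat * (int * 'rV[int]_n)) * (nat * nat),
   Omega x -> admissible (m * q.2.1)%:R (m%:R / q.2.2.+1%:R)
     (affine_field (grid_pt q.1.1) x) (affine_field (grid_pt q.1.2) x) ->
    `|phi x (affine_field (grid_pt q.1.1) x) - phi x (affine_field (grid_pt q.1.2) x)| <=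
      omega (m * q.2.1)%:R x (m%:R / q.2.2.+1%:R)}.
  by apply/ae_forall_countable => q; apply: affine_modulus => //; rewrite divr_ge0.
have ae2 : {ae mu, forall x, Omega x -> row_free (C x)}.
  exists [set x | Omega x /\ ~~ row_free (C x)]; split => //.
    exact: leb_null_measurable.
  by move=> x /= /not_implyP[Ox /negP].
have := ae_and ae1 ae2; apply: ae_imp => x [H1 H2] Ox s k z z' zs z's zz'.
have adm := admissible_of_norm m0 zs z's zz'.
have [y yz] := coefficients_of_field z (H2 Ox).
have [y' yz'] := coefficients_of_field z' (H2 Ox).
have c (w : R * 'rV[R]_n) : (fun j => affine_field (grid_pt (j, grid_code j w)) x) @ \oo --> affine_field w x.
  have cw := @affine_field_continuous_coeff x w.
  exact: (@continuous_cvg _ _ _ _ _ _ (fun y => affine_field y x) w cw (@grid_cvg _ _ _ _ _ (@grid_codeP R n) w)).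
have cy := c y; have cy' := c y'; rewrite yz in cy; rewrite yz' in cy'.
have N1 : \forall j \near \oo, admissible (m * s)%:R (m%:R / k.+1%:R)
    (affine_field (grid_pt (j, grid_code j y)) x) (affine_field (grid_pt (j, grid_code j y')) x).
  exact: (admissible_near cy cy' adm).
have cp (w : nat -> V) l : w @ \oo --> l -> (fun j => phi x (w j)) @ \oo --> phi x l.
  by move=> wl; apply: continuous_cvg wl; exact: cphi.
have cl : (fun j => `|phi x (affine_field (grid_pt (j, grid_code j y)) x) -
    phi x (affine_field (grid_pt (j, grid_code j y')) x)|) @ \oo --> `|phi x z - phi x z'|.
  by apply: cvg_norm; apply: cvgB; exact: cp.
rewrite -(cvg_lim _ cl); last exact: norm_hausdorff.
apply: limr_le; first by apply/cvg_ex; eexists; exact: cl.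
apply: filterS N1 => j Nj.
exact: (H1 ((j, grid_code j y), (j, grid_code j y'), (s, k)) Ox Nj).
Qed.

End pointwise_modulus.

(** * A common modulus for the whole sequence *)

Section uniform_integrands.
Context {R : realType} {m n : nat}.
Variables (Omega : set 'rV[R]_n) (C : 'rV[R]_n -> 'M[R]_(m, n)) (p : R).
Variables (a : 'rV[R]_n -> R) (c1 c2 : R) (omega : R -> 'rV[R]_n -> R -> R).
Hypothesis m0 : (0 < m)%N.
Hypothesis oO : open Omega.
Hypothesis bO : bounded_set Omega.
Hypothesis lC : forall j i, [lipschitz C x j i | x in Omega].
Hypothesis lic : LIC Omega C.
Hypothesis p1 : 1 <= p.
Hypothesis ai : leb.-integrable Omega (EFin \o a).
Hypothesis c10 : 0 <= c1.
Hypothesis c20 : 0 <= c2.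
Hypothesis om : integrable_moduli Omega omega.
Local Notation mu := (@leb R n).
Local Notation V := (R * 'rV[R]_m)%type.

Variables (mO : measurable Omega) (Ooo : (mu Omega < +oo)%E).
Local Notation muO := (finite_restriction mO Ooo).

Lemma L1loc_measurable (g : 'rV[R]_n -> R) : L1loc Omega g -> measurable_fun Omega g.
Proof.
move=> gL _ Y mY.
rewrite (_ : Omega `&` _ = \bigcup_(ab : 'rV[rat]_n * 'rV[rat]_n)
    (if `[< closed_rat_box ab `<=` Omega >] then closed_rat_box ab `&` g @^-1` Y else set0)).
  apply: countable_bigcupT_measurable => //= ab; case: asboolP => // abO.
  have := gL _ (@compact_closed_box R n _ _) abO.
  by move=> /measurable_int/measurable_EFinP; apply => //; exact: closed_box_measurable.
apply/seteqP; split => [x [Ox gx]|x [ab _]].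
  have [ab [xab abO]] := rat_box_nbhs oO Ox.
  by exists ab => //; case: asboolP => // _; split => //; exact: box_sub_closed.
by case: asboolP => // abO [xab gx]; split => //; exact: abO.
Qed.

(** The modulus m/(k+1) and the radius m s come from [admissible_of_norm];
  the values tend to zero because r |-> omega_s(x,r) is continuous and vanishes
  at 0. *)
Lemma moduli_majorant : exists (D : set 'rV[R]_n) (W : nat -> nat -> 'rV[R]_n -> R),
  [/\ measurable D /\ D `<=` Omega, mu (Omega `\` D) = 0%E,
    forall s k, measurable_fun [set: 'rV[R]_n] (W s k),
    (forall s k x, 0 <= W s k x) /\ (forall s x, (fun k => W s k x) @ \oo --> (0 : R)) &
    forall s k x, D x -> W s k x = omega (m * s)%:R x (m%:R / k.+1%:R)].
Proof.
have [om0 [N [mN N0 NH]] _ omL] := om.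
pose D := Omega `\` N.
have mD : measurable D by exact: measurableD.
have DO : D `<=` Omega by move=> x [].
have r0 k : 0 <= m%:R / k.+1%:R :> R by rewrite divr_ge0.
exists D, (fun s k => (fun x => omega (m * s)%:R x (m%:R / k.+1%:R)) \_ D); split.
- by [].
- apply/eqP; rewrite eq_le measure_ge0 andbT -[leRHS]N0.
  apply: le_measure; rewrite ?inE//; first exact: measurableD.
  by move=> x [Ox nDx]; apply: contrapT => Nx; apply: nDx.
- move=> s k; apply/(measurable_restrictT _ mD).
  apply: (measurable_funS mO DO); apply: L1loc_measurable; exact: omL.
- split => [s k x|s x].
    by rewrite patchE; case: ifPn => // /set_mem[Ox _]; exact: om0.
  have [Dx|nDx] := pselect (D x); last first.
    under eq_cvg do rewrite patchE memNset//.
    exact: cvg_cst.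
  under eq_cvg do rewrite patchE mem_set//.
  have [_ omc omz] : [/\ {in `[0, +oo[ &, {homo omega (m * s)%:R x : r1 r2 / r1 <= r2}},
            {within `[0, +oo[, continuous (omega (m * s)%:R x)} &
            omega (m * s)%:R x 0 = 0].
    have [Ox Nx] := Dx; move: (m * s)%:R (ler0n R (m * s)) => S S0.
    apply: contrapT => H; apply: Nx; apply: NH => /(_ Ox S S0); exact: H.
  have := omc; rewrite continuous_within_itvcyP => -[_]; rewrite omz => /cvg_at_rightP.
  move=> /(_ (fun k => m%:R / k.+1%:R)); apply; split.
    by move=> k; rewrite divr_gt0// ltr0n.
  rewrite -[X in _ --> X](mulr0 m%:R); apply: cvgM; first exact: cvg_cst.
  exact: cvg_harmonic.
- by move=> s k x Dx; rewrite patchE mem_set.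
Qed.

Lemma restricted_coefficient_integrable :
  muO.-integrable [set: 'rV[R]_n] (EFin \o (fun x => `|(a \_ Omega) x|)).
Proof.
apply: (integrable_finite_restriction mO Ooo (restrict_integrable oO ai)) => x nOx.
by rewrite patchE memNset// normr0.
Qed.

Lemma growth_integrable z : muO.-integrable [set: 'rV[R]_n] (EFin \o (growth (m := m) Omega p a c1 c2)^~ z).
Proof.
have b_int := restricted_coefficient_integrable.
have ci : muO.-integrable [set: 'rV[R]_n] (EFin \o cst (c1 * eucl_norm z.2 `^ p + c2 * `|z.1| `^ p)).
  exact: finite_measure_integrable_cst.
have := integrableD measurableT b_int ci; apply: eq_integrable => // x _.
by rewrite /= /growth -addrA.
Qed.

(** The norm of a pair is a maximum of coordinates, so one term of the sum
  suffices; the p-th root of the sum bounds every coordinate. *)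
Lemma pair_norm_powR_le (z : V) : `|z| `^ p <= `|z.1| `^ p + \sum_j `|z.2 0 j| `^ p.
Proof.
have p0 : 0 < p by exact: lt_le_trans p1.
have pn0 : p != 0 by rewrite gt_eqF.
have S0 : 0 <= \sum_j `|z.2 0 j| `^ p by apply: sumr_ge0 => j _; exact: powR_ge0.
rewrite prod_normE; case: (leP `|z.1| `|z.2|) => _; last by rewrite lerDl.
rewrite ler_wpDl ?powR_ge0//.
have z2 : `|z.2| <= (\sum_j `|z.2 0 j| `^ p) `^ p^-1.
  apply: row_norm_le => [|j]; first exact: powR_ge0.
  rewrite -[leLHS]powRr1// -(mulfV pn0) powRrM.
  apply: ge0_ler_powR; rewrite ?nnegrE ?powR_ge0 ?invr_ge0 ?(ltW p0)//.
  by rewrite (bigD1 j)//= lerDl; apply: sumr_ge0 => i _; exact: powR_ge0.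
rewrite -[leRHS]powRr1// -(mulVf pn0) powRrM.
by apply: ge0_ler_powR; rewrite ?nnegrE ?powR_ge0 ?(ltW p0).
Qed.

Lemma field_p_integrable u : WX Omega C p u -> p_integrable muO p (field Omega C u).
Proof.
move=> Wu; have p0 : 0 <= p by exact: le_trans p1.
apply: (integrable_finite_restriction mO Ooo (f := fun x => `|field Omega C u x| `^ p)).
  have ui : mu.-integrable Omega (fun x => (`|u x| `^ p)%:E) by apply: (Lp_integrable oO p1); case: Wu.
  have gi j := (WX_Xgrad_integrable oO p1 j Wu).2.
  have := integrableD mO ui (integrable_sum mO (index_enum 'I_m) (P := xpredT) (fun j _ => gi j)).
  apply: (le_integrable mO).
    apply/measurable_EFinP; apply: measurable_funTS.
    exact: (measurableT_comp (measurable_powR p) (measurable_grid_norm (@grid_codeP R m) (field_grid_measurable oO p1 Wu))).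
  move=> x Ox /=; rewrite sumEFin -EFinD abse_EFin lee_fin; apply: le_trans (ler_norm _).
  rewrite ger0_norm ?powR_ge0//; apply: le_trans (pair_norm_powR_le _) _.
  by rewrite /field /zero_extension mem_set.
move=> x nOx; rewrite /field /zero_extension memNset// normr0 powR0//.
by rewrite gt_eqF// (lt_le_trans ltr01).
Qed.

Lemma rat_boxes_generate : exists G : nat -> set 'rV[R]_n,
  (forall i, measurable (G i)) /\ dynkin_generated muO G.
Proof.
exists (fun i => if unpickle i is Some ab then rat_box ab else set0); split.
  by move=> i; case: unpickle => // ab; apply: open_measurable_row; exact: open_box.
move=> P PT PC PF PG Pnull; apply: leb_dynkin; [exact: PT|exact: PC|exact: PF| |].
  by move=> ab; have := PG (pickle ab); rewrite pickleK.
move=> A B mA mB AB BA0; apply: (Pnull A B mA mB AB).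
have mBA : measurable (B `\` A) by exact: measurableD.
apply/eqP; rewrite eq_le measure_ge0 andbT -[leRHS]BA0.
rewrite -[leLHS]/(mu ((B `\` A) `&` Omega)).
by apply: le_measure; rewrite ?inE//; exact: measurableI.
Qed.

Section with_majorant.
Variables (D : set 'rV[R]_n) (W : nat -> nat -> 'rV[R]_n -> R).
Hypotheses (mD : measurable D) (DO : D `<=` Omega) (OD0 : mu (Omega `\` D) = 0%E).
Hypothesis W0 : forall s k x, 0 <= W s k x.
Hypothesis mW : forall s k, measurable_fun [set: 'rV[R]_n] (W s k).
Hypothesis Wcvg : forall s x, (fun k => W s k x) @ \oo --> (0 : R).
Hypothesis WE : forall s k x, D x -> W s k x = omega (m * s)%:R x (m%:R / k.+1%:R).

(** The null set on which the modulus fails depends on the functional; setting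
  the integrand to zero there makes the class of integrands uniform without
  changing the functional. *)
Lemma integrand_of_functional F : class_W Omega C p a c1 c2 omega F ->
  exists phi : 'rV[R]_n -> V -> R, integrand (growth Omega p a c1 c2) W phi /\
    forall A u, open A -> A `<=` Omega -> WX Omega C p u ->
      F u A = (\int[muO]_(x in A) phi x (field Omega C u x))%:E.
Proof.
move=> [UF sF].
have [phi [mphi cphi phi0 phib FE]] := regular_integrand oO p1 c10 c20 UF.
have [N [mN N0 NH]] := pointwise_modulus m0 oO bO lC lic p1 ai c10 c20 om mphi cphi phi0 phib FE sF.
have aeDN : {ae mu, forall x, (Omega x -> D x) /\ ~ N x}.
  apply: ae_and.
    by exists (Omega `\` D); split => //; [exact: measurableD|move=> x /= /not_implyP].
  by exists N; split => // x /= /contrapT.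
pose E := D `\` N.
have mE : measurable E by exact: measurableD.
pose phi' x z := (phi^~ z \_ E) x.
have I' : integrand (growth Omega p a c1 c2) W phi'.
  split.
  - by move=> z; apply/(measurable_restrictT _ mE); exact: measurable_funTS.
  - by move=> x z; rewrite /phi' patchE; case: ifP.
  - by move=> x z; rewrite /phi' patchE; case: ifP => // _; exact: growth_ge0.
  - move=> s k x z z' zs z's zz'; rewrite /phi' !patchE; case: ifPn => [/set_mem[Dx Nx]|_].
      rewrite WE//.
      have H : Omega x -> forall (s k : nat) (z z' : V),
         `|z| < s%:R -> `|z'| < s%:R -> `|z - z'| < k.+1%:R^-1 ->
         `|phi x z - phi x z'| <= omega (m * s)%:R x (m%:R / k.+1%:R).
        by apply: contrapT => H; apply: Nx; exact: NH.
      exact: H (DO Dx) s k z z' zs z's zz'.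
    by rewrite subrr normr0.
exists phi'; split => // A u oA AO Wu.
have mA := open_measurable_row oA.
have nw := field_grid_measurable oO p1 Wu.
have cc0 : 0 <= c1 * m%:R `^ p + c2 by rewrite addr_ge0// mulr_ge0// powR_ge0.
have b_int := restricted_coefficient_integrable.
have phi'i : muO.-integrable A (EFin \o (fun x => phi' x (field Omega C u x))).
  exact: (integrand_integrable (@grid_codeP R m) W0 Wcvg (le_trans ler01 p1) cc0 b_int
    (growth_le Omega a p1 c10 c20) I' nw (field_p_integrable Wu) mA).
rewrite /Rintegral fineK; last exact: integrable_fin_num phi'i.
rewrite integral_finite_restriction// FE//; apply: ae_eq_integral.
- exact: mA.
- apply/measurable_EFinP; apply: measurable_funTS.
  exact: (measurable_superposition (@grid_codeP R m) nw mphi cphi).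
- exact: measurable_int phi'i.
- apply: ae_imp aeDN => x [OD Nx] Ax; rewrite /phi' patchE mem_set//.
  by split => //; apply: OD; exact: AO.
Qed.

End with_majorant.

End uniform_integrands.

(** * Strong convergence in the Sobolev space *)

Section restriction_integral.
Context d (T : measurableType d) (R : realType).
Variable mu : {measure set T -> \bar R}.
Variables (D : set T) (mD : measurable D) (Doo : (mu D < +oo)%E).

Lemma ge0_integral_finite_restriction (f : T -> R) : measurable_fun D f ->
  (forall x, 0 <= f x) -> (forall x, ~ D x -> f x = 0) ->
  (\int[finite_restriction mD Doo]_x (f x)%:E = \int[mu]_(x in D) (f x)%:E)%E.
Proof.
move=> mf f0 fD.
rewrite -(integral_finite_restriction mD Doo _ (@subset_refl _ D)) [RHS]integral_mkcond.
apply: eq_integral => x _; rewrite patchE; case: ifPn => //.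
by rewrite notin_setE => /fD ->.
Qed.

End restriction_integral.

Section strong_convergence.
Context {R : realType} {m n : nat}.
Variables (Omega : set 'rV[R]_n) (C : 'rV[R]_n -> 'M[R]_(m, n)) (p : R).
Hypothesis oO : open Omega.
Hypothesis bO : bounded_set Omega.
Hypothesis lC : forall j i, [lipschitz C x j i | x in Omega].
Hypothesis p1 : 1 <= p.
Local Notation mu := (@leb R n).
Local Notation V := (R * 'rV[R]_m)%type.
Variables (mO : measurable Omega) (Ooo : (mu Omega < +oo)%E).
Local Notation muO := (finite_restriction mO Ooo).

Let p0 : 0 < p. Proof. exact: lt_le_trans p1. Qed.
Let pn0 : p != 0. Proof. by rewrite gt_eqF. Qed.

Lemma Lp_norm_power (v : 'rV[R]_n -> R) :
  Lp_norm Omega p v = ((\int[mu]_(x in Omega) (`|v x| `^ p)%:E) `^ p^-1)%E.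
Proof.
rewrite /Lp_norm unlock; congr (_ `^ _)%E; rewrite [RHS]integral_mkcond.
apply: eq_integral => x _; rewrite /= !patchE; case: ifP => _ //=.
by rewrite [X in X `^ p](_ : _ = 0) ?powR0//; exact: normr0.
Qed.

(** The converse reading of the norm as a p-th root, in the form in which
  convergence of norms is used. *)
Lemma Lp_norm_le (v : 'rV[R]_n -> R) (e : R) : 0 <= e ->
  (Lp_norm Omega p v <= (e `^ p^-1)%:E)%E ->
  (\int[mu]_(x in Omega) (`|v x| `^ p)%:E <= e%:E)%E.
Proof.
move=> e0; rewrite Lp_norm_power; set I := (\int[mu]_(x in Omega) _)%E => H.
have I0 : (0 <= I)%E by apply: integral_ge0 => x _; rewrite lee_fin powR_ge0.
rewrite -(poweRe1 I0) -(mulVf pn0) poweRrM.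
have -> : e%:E = ((e `^ p^-1)%:E `^ p)%E.
  by rewrite poweR_EFin -powRrM mulVf// powRr1.
apply: gt0_ler_poweR => //; first exact: ltW.
  by rewrite in_itv/= poweR_ge0 leey.
by rewrite in_itv/= lee_fin powR_ge0 leey.
Qed.

Lemma Xgrad_diff_measurable u v : WX Omega C p u -> WX Omega C p v ->
  measurable_fun Omega (fun x => eucl_norm (Xgrad Omega C v x - Xgrad Omega C u x) `^ p).
Proof.
move=> Wu Wv; apply: (measurableT_comp (measurable_powR p)).
apply: (measurableT_comp (f := @Num.sqrt R)).
  by apply: continuous_measurable_fun; exact: sqrt_continuous.
apply: measurable_sum => j; apply: measurable_funX.
have [gu _] := WX_Xgrad_integrable oO p1 j Wu.
have [gv _] := WX_Xgrad_integrable oO p1 j Wv.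
have := measurable_funB gv gu; apply: eq_measurable_fun => x _.
by rewrite /= !mxE.
Qed.

(** The X-gradient of a difference is the difference of the X-gradients almost
  everywhere, although it is a representative chosen separately. *)
Lemma field_distance_le u v : WX Omega C p u -> WX Omega C p v ->
  (\int[muO]_x (`|field Omega C v x - field Omega C u x| `^ p)%:E <=
   \int[mu]_(x in Omega) (`|(v \- u) x| `^ p)%:E +
   \int[mu]_(x in Omega) (`|(@eucl_norm R m \o Xgrad Omega C (v \- u)) x| `^ p)%:E)%E.
Proof.
move=> Wu Wv.
have mu_ := Lp_measurable oO Wu.1; have mv := Lp_measurable oO Wv.1.
have mE := Xgrad_diff_measurable Wu Wv.
have -> : (\int[mu]_(x in Omega) (`|(@eucl_norm R m \o Xgrad Omega C (v \- u)) x| `^ p)%:E =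
  \int[mu]_(x in Omega) (eucl_norm (Xgrad Omega C v x - Xgrad Omega C u x) `^ p)%:E)%E.
  have ae : {ae mu, forall x, Omega x ->
     eucl_norm (Xgrad Omega C v x - Xgrad Omega C u x) `^ p =
     `|(@eucl_norm R m \o Xgrad Omega C (v \- u)) x| `^ p}.
    apply: ae_imp (XgradB_ae oO bO lC p1 Wv Wu) => x H Ox.
    by rewrite /= H// ger0_norm// eucl_norm_ge0.
  apply: ae_eq_integral.
  - exact: mO.
  - by apply/measurable_EFinP; exact: (ae_measurable_row ae mE).
  - exact/measurable_EFinP.
  - by move: ae; apply: ae_imp => x H Ox; rewrite H.
have mA : measurable_fun Omega (fun x => `|(v \- u) x| `^ p).
  apply: (measurableT_comp (measurable_powR p)); apply: measurableT_comp => //.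
  exact: measurable_funB.
have md : measurable_fun Omega (fun x => `|field Omega C v x - field Omega C u x| `^ p).
  apply: measurable_funTS; apply: (measurableT_comp (measurable_powR p)).
  exact: (measurable_norm_sub (@grid_codeP R m) (field_grid_measurable oO p1 Wv) (field_grid_measurable oO p1 Wu)).
rewrite ge0_integral_finite_restriction//; last first.
  move=> x nOx; rewrite /field /zero_extension memNset// subrr normr0 powR0//.
have A0 x : Omega x -> (0 <= (`|(v \- u) x| `^ p)%:E)%E by move=> _; rewrite lee_fin powR_ge0.
have E0 x : Omega x -> (0 <= (eucl_norm (Xgrad Omega C v x - Xgrad Omega C u x) `^ p)%:E)%E.
  by move=> _; rewrite lee_fin powR_ge0.
have mA' := (measurable_EFinP _ _).2 mA.
have mE' := (measurable_EFinP _ _).2 mE.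
rewrite -(ge0_integralD mu mO A0 mA' E0 mE').
apply: ge0_le_integral.
- exact: mO.
- by move=> x _; rewrite lee_fin powR_ge0.
- exact/measurable_EFinP.
- by apply/measurable_EFinP; exact: measurable_funD.
move=> x Ox; rewrite -EFinD lee_fin /field /zero_extension mem_set//.
rewrite prod_normE /=; rewrite maxEle; case: ifP => _; last by apply: ler_wpDr; rewrite ?powR_ge0.
rewrite ler_wpDl ?powR_ge0//; apply: ge0_ler_powR; rewrite ?nnegrE ?eucl_norm_ge0 ?(ltW p0)//.
exact: norm_le_eucl.
Qed.

(** Strong convergence in the Sobolev space is L^p convergence of (u,Xu). *)
Lemma field_cvg (u_ : nat -> 'rV[R]_n -> R) u : (forall h, WX Omega C p (u_ h)) ->
  WX Omega C p u -> WX_cvg Omega C p u_ u ->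
  (fun h => \int[muO]_(x in setT) (`|field Omega C (u_ h) x - field Omega C u x| `^ p)) @ \oo
    --> (0 : R).
Proof.
move=> Wu_ Wu u_u; apply/cvgrPdist_le => e e0.
have e2 : 0 < e / 2 by rewrite divr_gt0.
have t0 : 0 < (e / 2) `^ p^-1 by rewrite powR_gt0.
have nb : nbhs (0%E : \bar R) [set y | (y < ((e / 2) `^ p^-1)%:E)%E].
  have : nbhs (0 : R) [set r | r < (e / 2) `^ p^-1] by exact: lt_nbhsl t0.
  by apply: filterS => r /=; rewrite lte_fin.
have := u_u _ nb; rewrite /nbhs/=; apply: filterS => h; rewrite /= => small.
have N0 (v : 'rV[R]_n -> R) : (0 <= Lp_norm Omega p v)%E by exact: Lnorm_ge0.
have s1 : (\int[mu]_(x in Omega) (`|(u_ h \- u) x| `^ p)%:E <= (e / 2)%:E)%E.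
  apply: Lp_norm_le; first exact: ltW.
  by apply: le_trans (ltW small); rewrite leeDl.
have s2 : (\int[mu]_(x in Omega) (`|(@eucl_norm R m \o Xgrad Omega C (u_ h \- u)) x| `^ p)%:E <= (e / 2)%:E)%E.
  apply: Lp_norm_le; first exact: ltW.
  by apply: le_trans (ltW small); rewrite leeDr.
have := le_trans (field_distance_le Wu (Wu_ h)) (leeD s1 s2).
rewrite -EFinD -splitr sub0r normrN /Rintegral.
set I := (\int[muO]_x _)%E => Ie.
have I0 : (0 <= I)%E by apply: integral_ge0 => x _; rewrite lee_fin powR_ge0.
rewrite ger0_norm ?fine_ge0// -lee_fin fineK// ge0_fin_numE//.
exact: le_lt_trans Ie (ltry _).
Qed.

Lemma WX_cvg_cst u : WX Omega C p u -> WX_cvg Omega C p (fun _ => u) u.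
Proof.
move=> Wu; suff E : WX_norm Omega C p (u \- u) = 0%E by rewrite /WX_cvg E; exact: cvg_cst.
rewrite /WX_norm !Lp_norm_power.
have z v : {ae mu, forall x, Omega x -> v x = 0} ->
    (\int[mu]_(x in Omega) (`|v x| `^ p)%:E = 0)%E.
  move=> v0; rewrite -(integral0 mu Omega).
  have ae : {ae mu, forall x, Omega x -> 0 = `|v x| `^ p}.
    by apply: ae_imp v0 => x H Ox; rewrite H// normr0 powR0.
  apply: ae_eq_integral.
  - exact: mO.
  - apply/measurable_EFinP; apply: (ae_measurable_row ae); exact: measurable_cst.
  - exact: measurable_cst.
  - by move: ae; apply: ae_imp => x H Ox; rewrite -H.
have pV0 : p^-1 != 0 by rewrite invr_eq0.
rewrite z; last by apply: aeW => x _; rewrite /= subrr.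
rewrite z; first by rewrite poweR0r// adde0.
apply: ae_imp (XgradB_ae oO bO lC p1 Wu Wu) => x H Ox.
rewrite /= H// subrr /eucl_norm big1 ?sqrtr0// => j _.
by rewrite mxE expr0n.
Qed.

End strong_convergence.

(** * The limit functional *)

Section limit_functional.
Context {R : realType} {m n : nat}.
Variables (Omega : set 'rV[R]_n) (C : 'rV[R]_n -> 'M[R]_(m, n)) (p : R).
Variables (a : 'rV[R]_n -> R) (c1 c2 : R) (omega : R -> 'rV[R]_n -> R -> R).
Hypothesis oO : open Omega.
Hypothesis p1 : 1 <= p.
Hypothesis c10 : 0 <= c1.
Hypothesis c20 : 0 <= c2.

(** The integrand is nonnegative and at most a at (0,0). *)
Lemma class_U_coefficient_ge0 F : class_U Omega C p a c1 c2 F ->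
  {ae leb, forall x, Omega x -> 0 <= a x}.
Proof.
move=> [f [f0 _ fb _]]; apply: ae_imp fb => x fb Ox.
have := le_trans (f0 x 0 0 Ox) (fb Ox 0 0).
have e0 : eucl_norm (0 : 'rV[R]_m) = 0.
  by rewrite /eucl_norm big1 ?sqrtr0// => j _; rewrite mxE expr0n.
by rewrite e0 normr0 powR0 ?gt_eqF ?(lt_le_trans ltr01)// !mulr0 !addr0 lee_fin.
Qed.

Definition integral_functional (phi : 'rV[R]_n -> R * 'rV[R]_m -> R)
    (u : 'rV[R]_n -> R) (A : set 'rV[R]_n) : \bar R :=
  (\int[leb]_(x in A) (phi x (field Omega C u x))%:E)%E.

Lemma integral_functional_class_U W phi :
  {ae leb, forall x, Omega x -> 0 <= a x} ->
  integrand (growth Omega p a c1 c2) W phi -> (forall x, continuous (phi x)) ->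
  class_U Omega C p a c1 c2 (integral_functional phi).
Proof.
move=> a0 [mphi phi0 phib _] cphi.
exists (fun x u eta => (phi x (u, eta))%:E); split.
- by move=> x u eta _; rewrite lee_fin.
- split.
    by move=> u eta; apply/measurable_EFinP; exact: measurable_funTS.
  apply: aeW => x _.
  have -> : (fun z : R * 'rV[R]_m => (phi x (z.1, z.2))%:E) = EFin \o phi x.
    by apply/funext => -[].
  move=> z; apply: cvg_EFin; first exact: nearW.
  exact: cphi.
- apply: ae_imp a0 => x a0 Ox u eta; rewrite lee_fin.
  by apply: (le_trans (phib x (u, eta))); rewrite /growth patchE mem_set//= ger0_norm// a0.
- move=> A u oA AO Wu; apply: eq_integral => x; rewrite inE => /AO Ox.
  by rewrite /field /zero_extension mem_set.
Qed.

Lemma strong_condition_limit (F_ : nat -> ('rV[R]_n -> R) -> set 'rV[R]_n -> \bar R)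
    (I_ : nat -> ('rV[R]_n -> R) -> set 'rV[R]_n -> R) I F :
  (forall h, strong_condition Omega C p omega (F_ h)) ->
  (forall A u, open A -> A `<=` Omega -> WX Omega C p u ->
     [/\ forall h, F_ h u A = (I_ h u A)%:E, F u A = (I u A)%:E &
         (fun h => I_ h u A) @ \oo --> (I u A : R)]) ->
  strong_condition Omega C p omega F.
Proof.
move=> sF FI s r A u v s0 r0 oA AO Wu Wv b1 b2.
have AO' : A `<=` Omega by apply: subset_trans AO; exact: subset_closure.
have [Fu FuE cu] := FI A u oA AO' Wu; have [Fv FvE cv] := FI A v oA AO' Wv.
have H h := sF h s r A u v s0 r0 oA AO Wu Wv b1 b2.
have {}H h : (`|I_ h v A - I_ h u A|%:E <= \int[leb]_(x in A) (omega s x r)%:E)%E.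
  by have := H h; rewrite Fu Fv.
rewrite FuE FvE -EFinB abse_EFin.
move: H; case: (\int[leb]_(x in A) (omega s x r)%:E)%E => [J| |] H.
- have c : (fun h => `|I_ h v A - I_ h u A|) @ \oo --> `|I v A - I u A|.
    by apply: cvg_norm; exact: cvgB.
  rewrite lee_fin -(cvg_lim _ c)//; apply: limr_le; first by apply/cvg_ex; eexists; exact: c.
  by apply: nearW => h; have := H h; rewrite lee_fin.
- exact: leey.
- by have := H 0%N; rewrite leeNy_eq.
Qed.

(** If the functionals converge along every strongly convergent sequence, all
  sequences in the two infima give the same value, and constant sequences show
  that there is at least one. *)
Lemma Gamma_lim_of_cvg (G : nat -> ('rV[R]_n -> R) -> \bar R) G0 :
  (forall u, WX Omega C p u -> WX_cvg Omega C p (fun=> u) u) ->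
  (forall u_ u, (forall h, WX Omega C p (u_ h)) -> WX Omega C p u -> WX_cvg Omega C p u_ u ->
     (fun h => G h (u_ h)) @ \oo --> G0 u) ->
  is_Gamma_lim Omega C p G G0.
Proof.
move=> cst GG u Wu; rewrite /Gamma_liminf /Gamma_limsup.
have lims u_ : (forall h, WX Omega C p (u_ h)) -> WX_cvg Omega C p u_ u ->
    limn_einf (fun h => G h (u_ h)) = G0 u /\ limn_esup (fun h => G h (u_ h)) = G0 u.
  by move=> Wu_ c; have [-> ->] := cvg_limn_einf_sup (GG u_ u Wu_ Wu c).
by split; rewrite -[RHS]ereal_inf1; congr ereal_inf; apply/seteqP; split => y /=;
  [case=> u_ [Wu_ /(lims _ Wu_)[]] -> _ <-|move=> ->; exists (fun=> u); [split => //; exact: cst|];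
   have [] := lims (fun=> u) (fun=> Wu) (cst u Wu)
  |case=> u_ [Wu_ /(lims _ Wu_)[]] _ -> <-|move=> ->; exists (fun=> u); [split => //; exact: cst|];
   have [] := lims (fun=> u) (fun=> Wu) (cst u Wu)].
Qed.

End limit_functional.

Theorem theorem4p4 (R : realType) (m n : nat)
    (Omega : set 'rV[R]_n) (C : 'rV[R]_n -> 'M[R]_(m, n))
    (p : R) (a : 'rV[R]_n -> R) (c1 c2 : R)
    (omega : R -> 'rV[R]_n -> R -> R)
    (F_ : nat -> ('rV[R]_n -> R) -> set 'rV[R]_n -> \bar R) :
  (0 < m)%N -> (m <= n)%N ->
  open Omega -> bounded_set Omega ->
  (forall j i, [lipschitz C x j i | x in Omega]) ->
  LIC Omega C ->
  1 <= p ->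
  leb.-integrable Omega (EFin \o a) ->
  0 <= c1 -> 0 <= c2 ->
  integrable_moduli Omega omega ->
  (forall h, class_W Omega C p a c1 c2 omega (F_ h)) ->
  exists (k : nat -> nat) (F : ('rV[R]_n -> R) -> set 'rV[R]_n -> \bar R),
    [/\ {homo k : i j / (i < j)%N},
        class_W Omega C p a c1 c2 omega F &
        forall A, open A -> A `<=` Omega ->
          is_Gamma_lim Omega C p (fun h u => F_ (k h) u A) (fun u => F u A)].
Proof.
move=> m0 mn oO bO lC lic p1 ai c10 c20 om FW.
have p0 : 0 <= p by exact: le_trans p1.
have mO : measurable Omega by exact: open_measurable_row.
have Ooo : (leb Omega < +oo)%E by exact: leb_bounded.
pose muO := finite_restriction mO Ooo.
have [D [W [[mD DO] OD0 mW [W0 Wcvg] WE]]] := moduli_majorant m0 oO om mO.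
have K0 : 0 <= c1 * m%:R `^ p + c2 by rewrite addr_ge0// mulr_ge0// powR_ge0.
have codeP := @grid_codeP R m.
have growthK := @growth_le R m n Omega p a c1 c2 p1 c10 c20.
have aI := restricted_coefficient_integrable oO ai mO Ooo.
have [phi phiE] := choice (fun h => integrand_of_functional m0 oO bO lC lic p1 ai c10 c20 om
  mO Ooo mD DO OD0 W0 Wcvg WE (FW h)).
have phiI h : integrand (growth Omega p a c1 c2) W (phi h) by have [] := phiE h.
have [G [mG dG]] := rat_boxes_generate mO Ooo.
have [k [kH [phi_oo [phi_ooI lim]]]] :=
  integrand_compactness codeP (growth_integrable p c1 c2 oO ai mO Ooo)
    (fun x => @growth_continuous R m n Omega p a c1 c2 p1 x) mW W0 Wcvg phiI mG dG.
have field_gm u : WX Omega C p u -> grid_measurable (@grid_code R m) (field Omega C u).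
  exact: field_grid_measurable.
have int_field u : WX Omega C p u -> p_integrable muO p (field Omega C u).
  exact: field_p_integrable.
pose I_ h u A := \int[muO]_(x in A) phi (k h) x (field Omega C u x).
pose I u A := \int[muO]_(x in A) phi_oo x (field Omega C u x).
have FI h A u : open A -> A `<=` Omega -> WX Omega C p u -> F_ (k h) u A = (I_ h u A)%:E.
  by have [_] := phiE (k h); exact.
have FooI A u : open A -> A `<=` Omega -> WX Omega C p u ->
    integral_functional Omega C phi_oo u A = (I u A)%:E.
  move=> oA AO Wu; have mA := open_measurable_row oA.
  have i := integrand_integrable codeP W0 Wcvg p0 K0 aI growthK phi_ooI (field_gm u Wu) (int_field u Wu) mA.
  rewrite /I /Rintegral fineK; last exact: integrable_fin_num i.
  by rewrite integral_finite_restriction.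
have cI A u : open A -> A `<=` Omega -> WX Omega C p u -> (fun h => I_ h u A) @ \oo --> I u A.
  move=> oA AO Wu; have mA := open_measurable_row oA.
  exact: (superposition_cvg codeP mW W0 Wcvg p0 K0 aI growthK (fun h => phiI (k h)) phi_ooI lim
    (field_gm u Wu) (int_field u Wu) mA).
exists k, (integral_functional Omega C phi_oo); split; first exact: kH.
  split.
    apply: integral_functional_class_U.
    - by have [UF _] := FW 0%N; exact: (class_U_coefficient_ge0 p1 UF).
    - exact: phi_ooI.
    - by move=> x; case: phi_ooI => _ _ _ modul; exact: (modulus_continuous W0 Wcvg modul).
  apply: (strong_condition_limit (F_ := F_ \o k) (I_ := I_) (I := I)).
    by move=> h; have [] := FW (k h).
  by move=> A u oA AO Wu; split => [h| |]; [exact: FI|exact: FooI|exact: cI].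
move=> A oA AO; apply: Gamma_lim_of_cvg.
  by move=> u Wu; exact: (WX_cvg_cst oO bO lC p1 mO Wu).
(* F(u_h) - F(u) tends to zero uniformly in the functional, and F_h(u) converges. *)
move=> u_ u Wu_ Wu u_u; have mA := open_measurable_row oA.
rewrite FooI//; under eq_cvg do rewrite FI//.
apply: cvg_EFin; first exact: nearW.
have d0 := superposition_continuous codeP mW W0 Wcvg p0 K0 aI growthK (fun h => phiI (k h))
  (field_gm u Wu) (int_field u Wu) (fun h => field_gm _ (Wu_ h)) (fun h => int_field _ (Wu_ h))
  (field_cvg oO bO lC p1 mO Ooo Wu_ Wu u_u) mA.
have E : (fun h => I_ h (u_ h) A) = (fun h => (I_ h (u_ h) A - I_ h u A) + I_ h u A).
  by apply/funext => h; rewrite subrK.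
suff : (fun h => I_ h (u_ h) A) @ \oo --> I u A by [].
by rewrite E -[I u A]add0r; exact: cvgD d0 (cI A u oA AO Wu).
Qed.
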